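(* Let $K$ be a field of characteristic $p>0$ and let $G$ be a nilpotent group such that $|G'|=p^{n}$. Then $t^{L}(KG)=|G'|-14p+15$ if and only if one of the following conditions holds: (i) $G'\cong C_{16}\times C_{2}$, $G'^{2}\subseteq\gamma_{3}(G)\cong C_{8}\times C_{2}$ and $\gamma_{4}(G)\subseteq\gamma_{3}(G)^{2}$; (ii) either (a) $G'\cong C_{16}\times C_{2}$, $\gamma_{3}(G)\cong C_{8}$ and $\gamma_{4}(G)\subseteq G'^{4}=\gamma_{3}(G)^{2}=G'^{2}\cap\gamma_{3}(G)\cong C_{4}$; or (b) $G'\cong C_{16}\times C_{2}$, $\gamma_{3}(G)\cong C_{4}\times C_{2}$, $G'^{2}\cap\gamma_{3}(G)\cong C_{4}$, $\gamma_{4}(G)\subseteq G'^{4}$ and $\gamma_{3}(G)^{2}\subseteq G'^{4}$; (iii) $G'\cong C_{16}\times C_{2}$, $|\gamma_{3}(G)|=4$, $|G'^{2}\cap\gamma_{3}(G)|=2$, $\gamma_{4}(G)\subseteq G'^{4}$ and $\gamma_{3}(G)^{2}\subseteq G'^{4}$; (iv) $G'\cong C_{16}\times C_{2}$, $\gamma_{3}(G)\cong C_{2}$ and $G'^{2}\cap\gamma_{3}(G)=1$; (v) $G'\cong C_{8}\times C_{4}$, $G'^{2}\subseteq\gamma_{3}(G)\cong C_{8}\times C_{2}$ and $\gamma_{4}(G)\subseteq\gamma_{3}(G)^{2}$; (vi) $G'\cong C_{8}\times C_{4}$, $\gamma_{3}(G)\cong C_{8}$, $|G'^{2}\cap\gamma_{3}(G)|=2$,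 $\gamma_{4}(G)\subseteq\gamma_{3}(G)^{2}$ and $G'^{4}\subseteq\gamma_{3}(G)^{2}$; (vii) $G'\cong C_{8}\times C_{2}\times C_{2}$, $G'^{2}\subseteq\gamma_{3}(G)\cong C_{8}\times C_{2}$ and $\gamma_{4}(G)\subseteq\gamma_{3}(G)^{2}$; (viii) $G'\cong C_{8}\times C_{2}\times C_{2}$, $\gamma_{3}(G)\cong C_{8}$, $|G'^{2}\cap\gamma_{3}(G)|=2$, $\gamma_{4}(G)\subseteq\gamma_{3}(G)^{2}$ and $G'^{4}\subseteq\gamma_{3}(G)^{2}$; (ix) $G'\cong S(32,4)$ or $S(32,5)$ or $S(32,12)$, and $G'^{2}\subseteq\gamma_{3}(G)\cong C_{8}\times C_{2}$, $\gamma_{4}(G)=\gamma_{3}(G)^{2}$ and $\gamma_{5}(G)\cong C_{2}$; (x) $G'\cong S(32,4)$, $\gamma_{3}(G)\cong C_{8}$, $G'^{4}\subseteq G'^{2}\cap\gamma_{3}(G)=\gamma_{4}(G)=\gamma_{3}(G)^{2}$ and $\gamma_{5}(G)\cong C_{2}$; (xi) $G'\cong S(32,37)$, $G'^{2}\subseteq\gamma_{3}(G)\cong C_{8}\times C_{2}$, $\gamma_{4}(G)=\gamma_{3}(G)^{2}$ and $\gamma_{5}(G)\cong C_{2}$; (xii) $G'\cong S(32,17)$, $\gamma_{5}(G)\cong C_{2}$, and one of the following three holds: [$G'^{2}\subseteq\gamma_{3}(G)\cong C_{8}\times C_{2}$ and $\gamma_{4}(G)=\gamma_{3}(G)^{2}$];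 or [$\gamma_{3}(G)\cong C_{8}$ and $G'^{2}\cap\gamma_{3}(G)=\gamma_{4}(G)=\gamma_{3}(G)^{2}=G'^{4}$]; or [$\gamma_{3}(G)\cong C_{4}\times C_{2}$ and $\gamma_{3}(G)^{2}\subseteq G'^{2}\cap\gamma_{3}(G)=\gamma_{4}(G)=G'^{4}\cong C_{4}$]; (xiii) $G'\cong S(32,38)$, $G'^{2}\subseteq\gamma_{3}(G)\cong C_{8}\times C_{2}$, $\gamma_{4}(G)=\gamma_{3}(G)^{2}$ and $\gamma_{5}(G)\cong C_{2}$.
   Context: The group $G$ is not necessarily finite. $KG$ is the group algebra of $G$ over $K$. The upper Lie powers of $KG$ are defined by $KG^{(1)}=KG$ and, for $n\geq 2$, $KG^{(n)}$ is the two-sided ideal of $KG$ generated by all Lie commutators $[x,y]=xy-yx$ with $x\in KG^{(n-1)}$, $y\in KG$. The upper Lie nilpotency index of $KG$ is $t^{L}(KG)=\min\{n: KG^{(n)}=0\}$ (it is finite when $G$ is nilpotent and $G'$ is a finite $p$-group, $p=\operatorname{char}K$). $\gamma_i(G)$ is the $i$th term of the lower central series of $G$ ($\gamma_1(G)=G$, $\gamma_{i+1}(G)=[\gamma_i(G),G]$), and $G'=\gamma_2(G)$ is the commutator subgroup. For a group $H$ and positive integer $m$, $H^{m}$ denotes the subgroup generated by all $m$th powers of elements of $H$; thus $G'^{2}=(G')^{2}$, $G'^{4}=(G')^{4}$. $C_m$ is the cyclic group of order $m$. $S(n,m)$ denotes the group number $m$ of order $n$ in the Small Groups Library of GAP,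 i.e. SmallGroup$(n,m)$. A chain such as $A\subseteq B\cong C$ means $A\subseteq B$ and $B\cong C$. *)

(* Defs.v *)
From HB Require Import structures.
From mathcomp Require Import all_boot all_order all_algebra.
From mathcomp Require Import all_fingroup all_solvable.
From mathcomp Require Import finmap monalg.
From mathcomp Require Import boolp classical_sets cardinality.

Set Implicit Arguments.
Unset Strict Implicit.
Unset Printing Implicit Defensive.

Import GRing.Theory.

Local Open Scope classical_set_scope.
Local Open Scope ring_scope.

(* The group algebra KG on the free module {malg K[G]}.  The ring structure
   of monalg.v requires a monomType, i.e., a monoid whose only unit is 1, so
   the convolution product is redone here for a group. *)
Definition grpalg (K : fieldType) (G : groupType) : Type := {malg K[G]}.

Section GroupAlgebra.
Context (K : fieldType) (G : groupType).

HB.instance Definition _ := GRing.Lmodule.on (grpalg K G).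

Implicit Types (a b c : {malg K[G]}).

Definition gaone : {malg K[G]} := << 1%g >>.

Definition gamul a b : {malg K[G]} :=
  \sum_(x <- msupp a) \sum_(y <- msupp b) << a@_x * b@_y *g (x * y)%g >>.

Lemma gamulw (d1 d2 : {fset G}) a b :
  (msupp a `<=` d1)%fset -> (msupp b `<=` d2)%fset ->
  gamul a b = \sum_(x <- d1) \sum_(y <- d2) << a@_x * b@_y *g (x * y)%g >>.
Proof.
move=> le_d1 le_d2; rewrite /gamul (big_fset_incl _ le_d1) /=.
  apply/eq_bigr=> x _; apply/big_fset_incl => // y _ /mcoeff_outdom ->.
  by rewrite mulr0 monalgU0.
move=> x _ /mcoeff_outdom ax.
by rewrite big1 => // y _; rewrite ax mul0r monalgU0.
Qed.

Lemma gamul0g : left_zero 0 gamul.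
Proof. by move=> a; rewrite /gamul msupp0 big_seq_fset0. Qed.

Lemma gamulg0 : right_zero 0 gamul.
Proof. by move=> a; rewrite /gamul exchange_big msupp0 big_seq_fset0. Qed.

Lemma gamulUg k x a :
  gamul << k *g x >> a = \sum_(y <- msupp a) << k * a@_y *g (x * y)%g >>.
Proof.
rewrite (gamulw msuppU_le (fsubset_refl _)) big_seq_fset1.
by apply/eq_bigr => y _; rewrite mcoeffUU.
Qed.

Lemma gamulgU k y a :
  gamul a << k *g y >> = \sum_(x <- msupp a) << a@_x * k *g (x * y)%g >>.
Proof.
rewrite (gamulw (fsubset_refl _) msuppU_le) exchange_big big_seq_fset1.
by apply/eq_bigr => x _; rewrite mcoeffUU.
Qed.

Lemma gamulUU k l x y :
  gamul << k *g x >> << l *g y >> = << k * l *g (x * y)%g >>.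
Proof. by rewrite (gamulw msuppU_le msuppU_le) !big_seq_fset1 !mcoeffUU. Qed.

Lemma gamulEl a b : gamul a b = \sum_(x <- msupp a) gamul << a@_x *g x >> b.
Proof. by apply/eq_bigr=> x _; rewrite gamulUg. Qed.

Lemma gamulEr a b : gamul a b = \sum_(y <- msupp b) gamul a << b@_y *g y >>.
Proof.
by rewrite [LHS]exchange_big; apply/eq_bigr=> y _; rewrite gamulgU.
Qed.

Lemma gamul1g : left_id gaone gamul.
Proof.
move=> a; rewrite gamulUg [RHS]monalgE.
by apply/eq_bigr=> x _; rewrite mul1r mul1g.
Qed.

Lemma gamulg1 : right_id gaone gamul.
Proof.
move=> a; rewrite gamulgU [RHS]monalgE.
by apply/eq_bigr=> x _; rewrite mulr1 mulg1.
Qed.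

Lemma gamulDl : left_distributive gamul +%R.
Proof.
move=> a b c; rewrite (gamulw (msuppD_le _ _) (fsubset_refl _)).
rewrite (gamulw (fsubsetUl _ (msupp b)) (fsubset_refl (msupp c))).
rewrite (gamulw (fsubsetUr (msupp a) _) (fsubset_refl (msupp c))).
rewrite -big_split /=; apply/eq_bigr=> x _.
rewrite -big_split /=; apply/eq_bigr=> y _.
by rewrite mcoeffD mulrDl monalgUD.
Qed.

Lemma gamulDr : right_distributive gamul +%R.
Proof.
move=> a b c; rewrite (gamulw (fsubset_refl _) (msuppD_le _ _)).
rewrite (gamulw (fsubset_refl (msupp a)) (fsubsetUl _ (msupp c))).
rewrite (gamulw (fsubset_refl (msupp a)) (fsubsetUr (msupp b) _)).
rewrite -big_split /=; apply/eq_bigr=> x _.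
rewrite -big_split /=; apply/eq_bigr=> y _.
by rewrite mcoeffD mulrDr monalgUD.
Qed.

Lemma gamulA : associative gamul.
Proof.
move=> a b c.
rewrite [RHS](big_morph (gamul^~ _) (fun _ _ => gamulDl _ _ _) (gamul0g _)).
rewrite gamulEl; apply/eq_bigr=> x _.
rewrite [LHS](big_morph (gamul _) (fun _ _ => gamulDr _ _ _) (gamulg0 _)).
rewrite [RHS](big_morph (gamul^~ _) (fun _ _ => gamulDl _ _ _) (gamul0g _)).
apply/eq_bigr=> y _.
rewrite [LHS](big_morph (gamul _) (fun _ _ => gamulDr _ _ _) (gamulg0 _)).
by rewrite gamulEr; apply/eq_bigr=> z _; rewrite !gamulUU mulrA mulgA.
Qed.

Lemma gaone_neq0 : gaone != 0.
Proof.
apply/eqP => /(congr1 (mcoeff 1%g)).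
by rewrite mcoeffUU mcoeff0 => /eqP; rewrite oner_eq0.
Qed.

HB.instance Definition _ := GRing.Zmodule_isNzRing.Build (grpalg K G)
  gamulA gamul1g gamulg1 gamulDl gamulDr gaone_neq0.

Definition gaconst (k : K) : grpalg K G := << k *g 1%g >>.

Lemma gascaleEl k (a : grpalg K G) : k *: a = gaconst k * a.
Proof.
rewrite [LHS]malgZ_def /fgscale [RHS]gamulUg.
by apply/eq_bigr=> x _; rewrite mul1g.
Qed.

Lemma gascaleEr k (a : grpalg K G) : k *: a = a * gaconst k.
Proof.
rewrite [LHS]malgZ_def /fgscale [RHS]gamulgU.
by apply/eq_bigr=> x _; rewrite mulg1 mulrC.
Qed.

Lemma gascaleAl k (a b : grpalg K G) : k *: (a * b) = (k *: a) * b.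
Proof. by rewrite !gascaleEl mulrA. Qed.

HB.instance Definition _ :=
  GRing.Lmodule_isLalgebra.Build K (grpalg K G) gascaleAl.

Lemma gascaleAr k (a b : grpalg K G) : k *: (a * b) = a * (k *: b).
Proof. by rewrite !gascaleEr mulrA. Qed.

HB.instance Definition _ :=
  GRing.Lalgebra_isAlgebra.Build K (grpalg K G) gascaleAr.

End GroupAlgebra.

Definition two_sided_ideal (R : nzRingType) (I : set R) : Prop :=
  [/\ I 0, (forall x y, I x -> I y -> I (x + y))
    & (forall r x, I x -> I (r * x) /\ I (x * r))].

Definition ideal_gen (R : nzRingType) : set R -> set R :=
  smallest (@two_sided_ideal R).

Section UpperLiePowers.
Context (R : nzRingType).

(* R^(n) for n >= 1; the value at n = 0 is irrelevant. *)
Fixpoint upper_lie_power (n : nat) : set R :=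
  match n with
  | (_.+1 as k).+1 =>
      ideal_gen [set x * y - y * x | x in upper_lie_power k & y in setT]
  | _ => setT
  end.

Definition lie_vanishes (n : nat) : Prop :=
  (0 < n)%N /\ upper_lie_power n = [set 0].

(* The minimum n >= 1 with R^(n) = 0 when one exists, i.e., when R is upper
   Lie nilpotent; otherwise the conventional value 0, which is never a
   genuine index. *)
Definition tL : nat :=
  if pselect (exists n, `[< lie_vanishes n >]) is left h then ex_minn h
  else 0%N.

End UpperLiePowers.

Arguments upper_lie_power : clear implicits.
Arguments lie_vanishes : clear implicits.
Arguments tL : clear implicits.

Section Subgroups.
Context (G : groupType).
Implicit Types (A B : set G).

Definition subgroup A : Prop :=
  [/\ A 1%g, (forall x y, A x -> A y -> A (x * y)%g)
    & (forall x, A x -> A (x^-1)%g)].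

Definition subgroup_gen : set G -> set G := smallest subgroup.

Definition commutator_sub A B : set G :=
  subgroup_gen [set [~ x, y]%g | x in A & y in B].

(* gamma_i(G) for i >= 1; the value at i = 0 is irrelevant. *)
Fixpoint lcs (i : nat) : set G :=
  match i with
  | (_.+1 as k).+1 => commutator_sub (lcs k) setT
  | _ => setT
  end.

Definition nilpotent_group : Prop := exists c, lcs c.+1 = [set 1%g].

Definition powers A (m : nat) : set G := subgroup_gen [set (x ^+ m)%g | x in A].

Definition iso_to A (gT : finGroupType) (S : {group gT}) : Prop :=
  exists f : gT -> G,
    [/\ {in S &, {morph f : x y / (x * y)%g}}, {in S &, injective f}
      & f @` [set x | x \in S] = A].

End Subgroups.

Arguments lcs : clear implicits.
Arguments nilpotent_group : clear implicits.

(* C_m is the additive group of 'Z_m (m > 1), which is its finGroupType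
   structure. *)
Notation C16xC2 := [set: ('Z_16 * 'Z_2)%type]%G.
Notation C8xC4 := [set: ('Z_8 * 'Z_4)%type]%G.
Notation C8xC2xC2 := [set: ('Z_8 * 'Z_2 * 'Z_2)%type]%G.
Notation C8xC2 := [set: ('Z_8 * 'Z_2)%type]%G.
Notation C4xC2 := [set: ('Z_4 * 'Z_2)%type]%G.
Notation C8 := [set: 'Z_8]%G.
Notation C4 := [set: 'Z_4]%G.
Notation C2 := [set: 'Z_2]%G.

Local Open Scope group_scope.

(* S is a copy of SmallGroup(32, m), for the m that are needed:
     4  = C8 : C4 with C4 acting on C8 through x -> x^5,
     5  = (C8 x C2) : C2, minimal nonabelian and not metacyclic,
     12 = C4 : C8 with C8 acting on C4 by inversion,
     17 = the modular group M_32,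
     37 = M_16 x C2,
     38 = the central product of C8 and D8.
   Each presentation defines a group of order 32 in which every element is
   uniquely x^i y^j (z^k). *)
Definition small_group_32 (m : nat) (gT : finGroupType) (S : {group gT}) :=
  match m return Prop with
  | 4%N => S \isog Grp (x : y : (x ^+ 8, y ^+ 4, x ^ y = x ^+ 5))
  | 5%N => S \isog Grp (x : y : z : (x ^+ 8, y ^+ 2, z ^+ 2,
                        [~ x, y] = z, [~ x, z], [~ y, z]))
  | 12%N => S \isog Grp (x : y : (x ^+ 4, y ^+ 8, x ^ y = x ^-1))
  | 17%N => S \isog Grp (x : y : (x ^+ 16, y ^+ 2, x ^ y = x ^+ 9))
  | 37%N => S \isog Grp (x : y : z : (x ^+ 8, y ^+ 2, z ^+ 2,
                        x ^ y = x ^+ 5, [~ x, z], [~ y, z]))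
  | 38%N => S \isog Grp (x : y : z : (x ^+ 8, y ^+ 2, z ^+ 2,
                        [~ x, y], [~ x, z], [~ y, z] = x ^+ 4))
  | _ => False
  end.

Definition iso_to_S32 (G : groupType) (A : set G) (m : nat) : Prop :=
  exists (gT : finGroupType) (S : {group gT}),
    small_group_32 m S /\ iso_to A S.

(* Main.v *)
(* Let E_m be the span of the products of differences x - 1, x in G', of total
   weight at least m, where x has weight w if it lies in gamma_{w+1}(G).  Then
   KG^(m+1) = E_m KG.  Put D_m = {x in G' | x - 1 in E_m}.  Ordering a
   generating sequence of G' along the D_m, the products of powers of the x - 1
   with exponents below p show that E_m = 0 exactly when m exceeds
   (p - 1) sum_{m >= 1} log_p |D_m|, so that
     t^L(KG) = 2 + (p - 1) sum_{m >= 1} log_p |D_m|.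
   The vanishing half holds for every series S_m with the same closure
   properties, and so D_m is generated by gamma_{m+1}(G), D_{m+1} and the p-th
   powers of D_{m/p}.  This restricts the jumps of (D_m) so much that the index
   is p^n - 14p + 15 only if p = 2, n = 5 and the D_m have the orders
   32, 16, 4, 4, 2, 2, 2, 2, 1, which means that H = gamma_3(G) G'^2 has order
   16 and H^2 is cyclic of order 4 and contains gamma_4(G).  Writing
   G' = <a> gamma_3(G), an abelian G' has to be C_16 x C_2, and otherwise
   [G', G'] = gamma_5(G) has order 2, gamma_4(G) = H^2, and a presentation of G'
   can be read off from the action of a on gamma_3(G) and from a^2 or a^4. *)
Require Import Defs.
From HB Require Import structures.
From mathcomp Require Import boolp classical_sets cardinality.
From mathcomp Require Import all_boot all_order all_algebra.
From mathcomp Require Import all_fingroup all_solvable.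
From mathcomp Require Import finmap monalg zify.

Set Implicit Arguments.
Unset Strict Implicit.
Unset Printing Implicit Defensive.

Import GRing.Theory.

(** * Commutator calculus in the lower central series *)

Section Subgroups.
Local Open Scope classical_set_scope.
Local Open Scope group_scope.
Context (G : groupType).
Implicit Types (A B C : set G) (x y z : G).

(** The sum (p - 1) sum log_p |D_m| is at most p^n - 1, a bound attained by the weights 1, p, p^2,
    ...; the index in question falls short of it by 14 (p - 1). In the only solution the weights 1,
    2, 4, 8, 16 are replaced by 1, 2, 2, 4, 8. G may be infinite while G' is finite. So G' is
    replaced by a finite group [gT] with an embedding [j] into G. Conjugation by elements of G,
    which in general is not inner in G', survives as a family of operators on [gT], and the lower
    central series is pulled back along [j]. No closed formula for the D_m is used. What controls
    them is one element of KG, the sum of all elements of G': it is nonzero and lies in the last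
    nonzero E_m, so a series with the closure properties of (D_m) but of smaller total weight would
    force it to be 0. The arithmetic sees only the orders of the D_m and a restriction on where they
    can drop. For the converse it is enough to exhibit one explicit series inside (D_m). *)

Lemma conjg_def x y : x ^ y = y^-1 * (x * y). Proof. by []. Qed.

Lemma commg_def x y : [~ x, y] = x^-1 * (y^-1 * (x * y)). Proof. by []. Qed.

Lemma Hall_Witt x y z :
  [~ x, y^-1, z] ^ y * [~ y, z^-1, x] ^ z * [~ z, x^-1, y] ^ x = 1.
Proof.
rewrite !(conjg_def, commg_def) !(invgM, invgK) !mulgA.
by do !rewrite ?mulgK ?mulgVK ?mulVg ?mulgV ?mul1g ?mulg1.
Qed.

Definition conj_stable A := forall x g, A x -> A (x ^ g).

Lemma subgroup_genP A : subgroup (subgroup_gen A).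
Proof.
split=> [B [[]]//|x y Ax Ay B AB|x Ax B AB].
  by have [[_ BM _] _] := AB; apply: BM; [apply: Ax|apply: Ay].
by have [[_ _ BV] _] := AB; apply: BV; apply: Ax.
Qed.

Lemma subgroup_gen_sub A : A `<=` subgroup_gen A.
Proof. by move=> x Ax B [_]; apply. Qed.

Lemma subgroup_gen_min A B : subgroup B -> A `<=` B -> subgroup_gen A `<=` B.
Proof. by move=> gB AB x; apply. Qed.

Lemma subgroup_setT : subgroup [set: G]. Proof. by []. Qed.

Lemma conj_stable_gen A : conj_stable A -> conj_stable (subgroup_gen A).
Proof.
move=> nA x g; move: x.
have sgB : subgroup [set x | subgroup_gen A (x ^ g)].
  have [A1 AM AV] := subgroup_genP A; split=> [|x y Ax Ay|x Ax] /=.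
  - by rewrite conj1g.
  - by rewrite conjMg; apply: AM.
  - by rewrite conjVg; apply: AV.
apply: (subgroup_gen_min sgB) => x Ax.
by apply: subgroup_gen_sub; apply: nA.
Qed.

Lemma conj_stable_comm A B :
  conj_stable A -> conj_stable B -> conj_stable (commutator_sub A B).
Proof.
move=> nA nB; apply: conj_stable_gen => z g [x Ax [y By <-]].
by rewrite conjRg; exists (x ^ g); [exact: nA|exists (y ^ g); [exact: nB|]].
Qed.

Lemma lcs_subgroup i : subgroup (lcs G i).
Proof. by case: i => [|[|i]]; [exact: subgroup_setT..|exact: subgroup_genP]. Qed.

Lemma lcs_conj i : conj_stable (lcs G i).
Proof.
by case: i => [|i]; [|elim: i => [|i IH]] => //; apply: conj_stable_comm.
Qed.

Lemma lcsS_comm i x g : lcs G i.+1 x -> lcs G i.+2 [~ x, g].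
Proof. by move=> Ax; apply: subgroup_gen_sub; exists x => //; exists g. Qed.

Lemma lcsS_min i A : subgroup A ->
  (forall x g, lcs G i.+1 x -> A [~ x, g]) -> lcs G i.+2 `<=` A.
Proof.
by move=> gA cA; apply: subgroup_gen_min => // _ [x Ax [g _ <-]]; apply: cA.
Qed.

Lemma lcsSS i : lcs G i.+1 `<=` lcs G i.
Proof.
case: i => [//|i]; apply: lcsS_min => [|x g Ax]; first exact: lcs_subgroup.
have [_ AM AV] := lcs_subgroup i.+1.
by apply: AM; [exact: AV|exact: lcs_conj].
Qed.

Lemma lcs_le i k : (i <= k)%N -> lcs G k `<=` lcs G i.
Proof.
move/subnKC <-; elim: (k - i)%N => [|d IH]; first by rewrite addn0.
by rewrite addnS; apply: classical_sets.subset_trans IH; apply: lcsSS.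
Qed.

Lemma subgroup_commg A y : subgroup A -> conj_stable A ->
  subgroup [set x | A [~ x, y]].
Proof.
move=> [A1 AM AV] nA; split=> [|x z Ax Az|x Ax] /=.
- by rewrite comm1g.
- suff ->: [~ x * z, y] = [~ x, y] ^ z * [~ z, y] by apply: AM => //; apply: nA.
  rewrite !(conjg_def, commg_def) !(invgM, invgK) !mulgA.
  by do !rewrite ?mulgK ?mulgVK ?mulVg ?mulgV ?mul1g ?mulg1.
- suff ->: [~ x^-1, y] = [~ x, y]^-1 ^ x^-1 by apply: nA; apply: AV.
  rewrite !(conjg_def, commg_def) !(invgM, invgK) !mulgA.
  by do !rewrite ?mulgK ?mulgVK ?mulVg ?mulgV ?mul1g ?mulg1.
Qed.

(** Three subgroups argument on elements, by induction on [k]. For a generator [[~ y, g]] of the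
    next term, the Hall-Witt identity expresses a conjugate of [[~ y, g, x]] by two other triple
    commutators, both in [C] by the induction hypothesis. *)
Lemma lcs_commg i k x y :
  lcs G i.+1 x -> lcs G k.+1 y -> lcs G (i + k).+2 [~ x, y].
Proof.
elim: k i x y => [|k IH] i x y Ax Ay; first by rewrite addn0; apply: lcsS_comm.
set C := lcs G (i + k.+1).+2.
have gC : subgroup C := lcs_subgroup _.
have nC : conj_stable C := @lcs_conj _.
have [C1 CM CV] := gC.
rewrite -invgR; suff: C [~ y, x] by exact: CV.
move: y Ay; apply: (lcsS_min (A := [set y | C [~ y, x]])) => [|y g Ay /=].
  exact: subgroup_commg.
have HW := Hall_Witt y g^-1 x; rewrite invgK in HW.
have h2 : C ([~ g^-1, x^-1, y] ^ x).
  apply: nC; rewrite /C addnS -addSn; apply: IH => //.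
  rewrite -invgR; have [_ _ V] := lcs_subgroup i.+2; apply: V.
  by apply: lcsS_comm; have [_ _ V'] := lcs_subgroup i.+1; apply: V'.
have h3 : C ([~ x, y^-1, g^-1] ^ y).
  apply: nC; rewrite /C addnS; apply: lcsS_comm; apply: IH => //.
  by have [_ _ V'] := lcs_subgroup k.+1; apply: V'.
have h1 : C ([~ y, g, x] ^ g^-1).
  have -> : [~ y, g, x] ^ g^-1 =
      ([~ g^-1, x^-1, y] ^ x * [~ x, y^-1, g^-1] ^ y)^-1.
    by apply/eqP; rewrite -mulg_eq1 mulgA; apply/eqP.
  by apply: CV; apply: CM.
by move: (nC _ g h1); rewrite conjgKV.
Qed.

Lemma lcsS_id i : nilpotent_group G -> lcs G i.+2 = lcs G i.+1 ->
  lcs G i.+1 = [set 1].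
Proof.
move=> [c nilc] eqi.
have eqk k : lcs G (i + k).+1 = lcs G i.+1.
  elim: k => [|k IH]; first by rewrite addn0.
  by rewrite addnS /= in IH *; rewrite IH.
have le1 : lcs G i.+1 `<=` [set 1].
  rewrite -(eqk c) -nilc; apply: lcs_le; rewrite ltnS leq_addl //.
rewrite classical_sets.eqEsubset; split=> // _ ->.
by have [] := lcs_subgroup i.+1.
Qed.

End Subgroups.

(** * Which weight sequences give index 14 p - 15 below the maximum *)

Section Weights.
(** The [w j] are the indices m at which D_m drops, in nondecreasing order and repeated according to
    the size of the drop. [w_closed] records the two origins of a weight: a term of the lower
    central series, and then all smaller positive integers are weights, or a p-th power. *)
Context (p n : nat) (w : nat -> nat).
Hypothesis p_pr : prime p.
Hypothesis w0 : w 0 = 1.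
Hypothesis w_mono : forall i j, i <= j -> j < n -> w i <= w j.
Hypothesis w_closed : forall j, j < n ->
  (forall i, 0 < i <= w j -> exists2 k, k < n & w k = i) \/
  (exists2 k, k < n & w j = p * w k).

Let p_gt1 : 1 < p. Proof. exact: prime_gt1. Qed.

Lemma weight_gt0 j : j < n -> 0 < w j.
Proof. by move=> lt_jn; have := w_mono (leq0n j) lt_jn; rewrite w0. Qed.

(** If no value below w (j+1) is missing, then w (j+1) is at most w j + 1; otherwise it is p times
    an earlier weight. *)
Lemma weight_succ j : j.+1 < n -> w j.+1 <= p * w j.
Proof.
move=> lt_jn; have ltn := ltnW lt_jn; have w_gt0 := weight_gt0 ltn.
case: (w_closed lt_jn) => [alt|[k lt_kn eq_k]].
  have [le_w|lt_w] := leqP (w j.+1) (w j).+1.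
    by apply: leq_trans le_w _; nia.
  have [|k lt_kn wk] := alt (w j).+1; first by lia.
  have [le_kj|lt_jk] := leqP k j; first by have := w_mono le_kj ltn; lia.
  by have := w_mono lt_jk lt_kn; lia.
have [le_kj|lt_jk] := leqP k j.
  by rewrite eq_k leq_mul2l w_mono ?orbT.
by have := w_mono lt_jk lt_kn; have := weight_gt0 lt_kn; nia.
Qed.

(** Geometric bound from [weight_succ]: the sum from i on is at most w i (p^(n-i) - 1) / (p - 1),
    written without division or subtraction. *)
Lemma weight_tail i : i < n ->
  p.-1 * (\sum_(i <= j < n) w j) + w i <= w i * p ^ (n - i).
Proof.
have [d] := ubnP (n - i); elim: d i => // d IH i lt_d lt_in.
rewrite big_ltn //.
have [lt_iSn|le_ni] := ltnP i.+1 n.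
  have := IH i.+1 _ lt_iSn; rewrite subnS prednK ?subn_gt0 // => /(_ _)H.
  have {H} : p.-1 * (\sum_(i.+1 <= j < n) w j) + w i.+1 <=
      w i.+1 * p ^ (n - i).-1 by apply: H; lia.
  have := weight_succ lt_iSn.
  have -> : p ^ (n - i) = p * p ^ (n - i).-1.
    by rewrite -expnS prednK // subn_gt0.
  have e_gt0 : 0 < p ^ (n - i).-1 by rewrite expn_gt0 ltnW.
  move: (p ^ _) e_gt0 (\sum_(i.+1 <= j < n) _) => e e_gt0 s le1 le2.
  have le3 : p.-1 * s + w i.+1 + (p * w i - w i.+1) <=
    w i.+1 * e + (p * w i - w i.+1) * e.
    by apply: leq_add => //; apply: leq_pmulr.
  rewrite -mulnDl subnKC // in le3; have := p_gt1; nia.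
have -> : n = i.+1 by lia.
by rewrite big_geq // subSnn expn1 addn0; nia.
Qed.

Hypothesis w_sum : p.-1 * (\sum_(0 <= j < n) w j) + 14 * p = p ^ n + 13.

(** A missing value q rules out the first alternative of [w_closed] for every weight above q. Such a
    weight is p times an earlier one, so the sequence stays geometric until it first repeats a
    value, at index i. *)
Lemma weight_geometric q : 1 < n -> q <= p.+1 -> (forall k, k < n -> w k != q) ->
    (forall j, j < n -> w j < q -> w j = p ^ j) -> 0 < q -> w 1 = p -> 
  (forall j, j < n -> w j = p ^ j) \/
  (exists i, [/\ 1 < i < n, w i = p ^ i.-1 & forall j, j < i -> w j = p ^ j]).
Proof.
move=> n_gt1 le_qp wq w_small q_gt0 w1.
suff H m : m <= n -> (forall j, j < m -> w j = p ^ j) \/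
  (exists i, [/\ 1 < i < n, w i = p ^ i.-1 & forall j, j < i -> w j = p ^ j]).
  by have [] := H n (leqnn _); [left|right].
elim: m => [|m IH] lt_mn; first by left.
have [eqw|] := IH (ltnW lt_mn); last by right.
have [lt_wq|le_qw] := ltnP (w m) q.
  left=> j; rewrite ltnS leq_eqVlt => /predU1P[->|]; last exact: eqw.
  exact: w_small.
case: (w_closed lt_mn) => [alt|[k lt_kn eq_k]].
  have [|k lt_kn wk] := alt q; first by rewrite q_gt0.
  by have := wq k lt_kn; rewrite wk eqxx.
have w_gt0 := weight_gt0 lt_kn.
have lt_km : k < m.
  rewrite ltnNge; apply/negP => le_mk; have := w_mono le_mk lt_kn.
  by have := p_gt1; nia.
have m_gt0 : 0 < m by lia.
have wm : w m = p ^ k.+1 by rewrite eq_k eqw // expnS.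
have le_mk : m.-1 <= k.+1.
  have := w_mono (leq_pred m) lt_mn; rewrite wm eqw ?prednK //.
  by rewrite leq_exp2l.
have [eq_km|lt_km'] : k.+1 = m \/ k.+1 = m.-1 by lia.
  left=> j; rewrite ltnS leq_eqVlt => /predU1P[->|]; last exact: eqw.
  by rewrite wm eq_km.
right; exists m; split=> //; last by rewrite wm lt_km'.
have m_neq1 : m <> 1 by move=> m1; rewrite m1 in lt_km'.
by lia.
Qed.

Lemma weight_geometric_sum i : i <= n -> (forall j, j < i -> w j = p ^ j) ->
  p.-1 * (\sum_(0 <= j < i) w j) + 1 = p ^ i.
Proof.
move=> le_in eqw; have -> : \sum_(0 <= j < i) w j = \sum_(j < i) p ^ j.
  by rewrite big_mkord; apply: eq_bigr => j _; apply: eqw.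
by rewrite -predn_exp addn1 prednK // expn_gt0 ltnW.
Qed.

Lemma weight_cat i : i <= n ->
  \sum_(0 <= j < n) w j = \sum_(0 <= j < i) w j + \sum_(i <= j < n) w j.
Proof. by move=> le_in; rewrite (big_cat_nat (leq0n i) le_in). Qed.

Lemma weight_sum_ge : n <= \sum_(0 <= j < n) w j.
Proof.
rewrite big_mkord -[X in X <= _]card_ord -sum1_card.
by apply: leq_sum => j _; apply: weight_gt0.
Qed.

Lemma weight_head_bound i : i < n ->
  p ^ n + 13 + w i <=
    p.-1 * (\sum_(0 <= j < i) w j) + w i * p ^ (n - i) + 14 * p.
Proof.
move=> lt_in; rewrite -w_sum (weight_cat (ltnW lt_in)) mulnDr.
by have := weight_tail lt_in; lia.
Qed.

Lemma weight_size_gt1 : 1 < n.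
Proof.
case: n w_sum => [|[|//]]; first by rewrite big_geq // expn0; lia.
by rewrite big_nat1 w0 expn1; lia.
Qed.

Lemma weight1_cases : [\/ w 1 = 1, w 1 = 2 | w 1 = p].
Proof.
have n_gt1 := weight_size_gt1; have le_w1 := weight_succ n_gt1.
rewrite w0 muln1 in le_w1; have w1_gt0 := weight_gt0 n_gt1.
have [->|w1_neq1] := eqVneq (w 1) 1; first by constructor 1.
have [->|w1_neq2] := eqVneq (w 1) 2; first by constructor 2.
constructor 3; case: (w_closed n_gt1) => [alt|[k lt_kn eq_k]].
  have [|k lt_kn wk] := alt 2; first by lia.
  case: k lt_kn wk => [|k] lt_kn wk; first by rewrite w0 in wk.
  by have := w_mono (ltn0Sn k) lt_kn; lia.
by have := weight_gt0 lt_kn; nia.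
Qed.

Lemma weight1_neq1 : w 1 <> 1.
Proof.
move=> w1; have n_gt1 := weight_size_gt1.
have := weight_head_bound n_gt1; rewrite w1 big_nat1 w0 muln1 mul1n.
have := w_sum; have := weight_sum_ge.
have -> : p ^ n = p * p ^ (n - 1) by rewrite -expnS subn1 prednK // ltnW.
move: (\sum_(_ <= j < _) _) => s le_ns eq_s le1.
(* The bound reads (p - 1) e <= 15 (p - 1). *)
have le15 : p ^ (n - 1) <= 15 by move: (p ^ _) le1 => e; have := p_gt1; nia.
have le_n5 : n <= 4.
  rewrite leqNgt; apply/negP => lt4n.
  have : 2 ^ 4 <= p ^ (n - 1).
    apply: (@leq_trans (p ^ 4)); first by rewrite leq_exp2r.
    by rewrite leq_exp2l //; lia.
  by lia.
have : n \in [:: 2; 3; 4] by rewrite !inE; lia.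
rewrite !inE => /or3P[] /eqP n_eq; rewrite n_eq /= ?expnS ?expn0 ?muln1 in le15 eq_s le_ns *.
(* For n = 2 the equation becomes (p - 1)(p - 15) = 0. *)
- have p15 : p != 15 by apply/eqP => p15; move: p_pr; rewrite p15.
  have [q p_eq] : exists q, p = q.+2 by exists p.-2; have := p_gt1; lia.
  by move: p15 le15 eq_s; rewrite p_eq /=; nia.
- by have : p = 2 \/ p = 3; [have := p_gt1; nia|case=> p_eq; rewrite p_eq in eq_s; lia].
- by have p_eq : p = 2; [have := p_gt1; nia|rewrite p_eq in eq_s; lia].
Qed.

Lemma prime_ge5 : 3 < p -> 5 <= p.
Proof.
move=> lt3p; rewrite ltn_neqAle lt3p andbT; apply/eqP => p4.
by move: p_pr; rewrite -p4.
Qed.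

Lemma weight1_p : w 1 = p.
Proof.
have n_gt1 := weight_size_gt1.
case: weight1_cases => // [/weight1_neq1//|w1].
have [p2|p_gt2] : p = 2 \/ 2 < p by have := p_gt1; lia.
  by rewrite p2.
exfalso; have le1 := weight_head_bound n_gt1.
rewrite w1 big_nat1 w0 muln1 in le1.
have e_n : p ^ n = p * p ^ (n - 1) by rewrite -expnS subn1 prednK // ltnW.
rewrite e_n in le1.
have [n2|n_gt2] : n = 2 \/ 2 < n by lia.
  have := w_sum; rewrite n2; do 2!rewrite big_ltn //; rewrite big_geq // w0 w1 addn0 expnS expn1.
  (* Here the equation becomes (p - 1)(p - 16) = 0. *)
  have p16 : p != 16 by apply/eqP => p16; move: p_pr; rewrite p16.
  move: p16 p_gt2; case: p => [|[|q]] //= q_neq _ eq_q.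
  have q14 : q * q = 13 * q + 14 by lia.
  by have : q = 14; [nia|move: q_neq; lia].
have e_n1 : p ^ (n - 1) = p * p * p ^ (n - 3).
  by rewrite -mulnA -!expnS; congr (_ ^ _); lia.
have e_gt0 : 0 < p ^ (n - 3) by rewrite expn_gt0 ltnW.
have [p3|lt3p] : p = 3 \/ 3 < p by lia.
  have le_n : n <= 4.
    rewrite leqNgt; apply/negP => lt4n.
    have : 3 ^ 4 <= p ^ (n - 1) by rewrite p3 leq_exp2l //; lia.
    by rewrite p3 in le1 *; lia.
  have [n3|n4] : n = 3 \/ n = 4 by lia.
    by have := w_sum; rewrite n3 p3; lia.
  have lt2n : 2 < n by rewrite n4.
  have lt3n : 3 < n by rewrite n4.
  have := w_sum; rewrite n4; do 4!rewrite big_ltn //; rewrite big_geq // w0 w1 p3 => eq_s.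
  have := weight_succ lt2n; have := weight_succ lt3n; rewrite w1 p3 => le3 le2.
  have eq23 : w 2 + w 3 = 23 by move: eq_s; rewrite /=; lia.
  have [eq2 eq3] : w 2 = 6 /\ w 3 = 17 by lia.
  case: (w_closed lt3n) => [alt|[k lt_kn]]; last by rewrite eq3 p3; lia.
  have [|k lt_kn wk] := alt 3; first by rewrite eq3.
  have : k \in [:: 0; 1; 2; 3] by rewrite !inE; lia.
  by rewrite !inE => /or4P[] /eqP k_eq; move: wk; rewrite k_eq; lia.
have := prime_ge5 lt3p; rewrite e_n1 in le1; move: (p ^ _) e_gt0 le1 => e.
by move=> e_gt0 le1 p_ge5; have : p * p * e >= p * 5 * e; nia.
Qed.

Lemma weight_no_geometric : ~ (forall j, j < n -> w j = p ^ j).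
Proof.
move=> eqw; have := weight_geometric_sum (leqnn n) eqw.
by have := w_sum; have := p_gt1; lia.
Qed.

(* A first deviation from the geometric sequence at index i costs at least
   p ^ (n - 1) - p ^ (i - 1) in the sum. *)
Lemma weight_deviation i : 1 < i < n -> w i = p ^ i.-1 ->
  (forall j, j < i -> w j = p ^ j) -> p ^ n.-1 <= 14 + p ^ i.-1.
Proof.
case/andP=> i_gt1 lt_in wi eqw; have := weight_head_bound lt_in.
have := weight_geometric_sum (ltnW lt_in) eqw; rewrite wi -expnD.
have -> : i.-1 + (n - i) = n.-1 by lia.
have -> : p ^ n = p * p ^ n.-1 by rewrite -expnS prednK //; lia.
have -> : p ^ i = p * p ^ i.-1 by rewrite -expnS prednK //; lia.
move: (\sum_(_ <= _ < _) _) (p ^ n.-1) (p ^ i.-1) => s a b.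
by have := p_gt1; nia.
Qed.

Lemma weight_classification :
  [/\ p = 2, n = 5 & [/\ w 1 = 2, w 2 = 2, w 3 = 4 & w 4 = 8]].
Proof.
have n_gt1 := weight_size_gt1; have w1 := weight1_p.
have [p2|p_gt2] : p = 2 \/ 2 < p by have := p_gt1; lia.
  have n_gt2 : 2 < n.
    rewrite ltnNge; apply/negP => le_n2; have n2 : n = 2 by lia.
    by have := w_sum; rewrite n2 p2; do 2!rewrite big_ltn //; rewrite big_geq // w0 w1 p2; lia.
  have n5 : 4 < n.
    have := weight_sum_ge; have := w_sum; rewrite p2 mul1n.
    have [n3|[n4|//]] : n = 3 \/ n = 4 \/ 4 < n by lia.
      by rewrite n3 -[2 ^ 3]/8; lia.
    by rewrite n4 -[2 ^ 4]/16; lia.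
  have w2_le := weight_succ n_gt2; have := w_mono (leqnSn 1) n_gt2.
  rewrite w1 p2 in w2_le * => w2_ge.
  have lt3n : 3 < n by lia.
  have le3 := weight_succ lt3n; have le4 := weight_succ n5.
  have mono3 := w_mono (leqnSn 2) lt3n; have mono4 := w_mono (leqnSn 3) n5.
  rewrite p2 in le3 le4.
  have e_n : p ^ n = 8 * 2 ^ (n - 3).
    by rewrite p2 -[8]/(2 ^ 3) -expnD; congr (_ ^ _); lia.
  have e_n2 : p ^ (n - 2) = 2 * 2 ^ (n - 3).
    by rewrite p2 -expnS; congr (_ ^ _); lia.
  (* With e = 2^(n-3) this is (8 - 2 w 2) e <= 18 - w 2, which forces n = 5 unless w 2 = 4. *)
  have le_bd := weight_head_bound n_gt2; rewrite e_n e_n2 in le_bd.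
  do 2!rewrite big_ltn // in le_bd.
  rewrite big_geq // w0 w1 p2 mul1n in le_bd.
  have n5_of m : 2 ^ (n - 3) <= m -> m < 8 -> n = 5.
    move=> le_m lt_m; have [//|n_gt5] : n = 5 \/ 5 < n by lia.
    have : 2 ^ 3 <= 2 ^ (n - 3) by rewrite leq_exp2l //; lia.
    by lia.
  have in5 k : n = 5 -> k < n -> [\/ k = 0, k = 1, k = 2 | k = 3 ] \/ k = 4.
    move=> ->; case: k => [|[|[|[|[|k]]]]] // _; last by right.
    - by left; constructor 1.
    - by left; constructor 2.
    - by left; constructor 3.
    - by left; constructor 4.
  have sum5 : n = 5 -> w 2 + w 3 + w 4 = 14.
    move=> n_eq; have := w_sum; rewrite n_eq; do 5!rewrite big_ltn //; rewrite big_geq // w0 w1 p2.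
    by rewrite mul1n; lia.
  have [w2|w2|w2] : [\/ w 2 = 2, w 2 = 3 | w 2 = 4].
    by have : w 2 \in [:: 2; 3; 4]; [rewrite !inE; lia|];
      rewrite !inE => /or3P[] /eqP->; [constructor 1|constructor 2|constructor 3].
  - have n_eq : n = 5 by apply: (n5_of 4) => //; lia.
    by have := sum5 n_eq; split=> //; split; rewrite ?w1 //; lia.
  - have n_eq : n = 5 by apply: (n5_of 7) => //; lia.
    exfalso; have eq11 : w 3 + w 4 = 11 by have := sum5 n_eq; lia.
    have val k : k < n -> [\/ w k = 1, w k = 2, w k = 3 | w k = w 3] \/ w k = w 4.
      case/(in5 _ n_eq) => [[]|] ->; last by right.
      - by left; constructor 1.
      - by left; constructor 2; rewrite w1.
      - by left; constructor 3.
      - by left; constructor 4.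
    have [[eq3 eq4]|[eq3 eq4]] : w 3 = 4 /\ w 4 = 7 \/ w 3 = 5 /\ w 4 = 6.
    + by have := sum5 n_eq; lia.
    + case: (w_closed n5) => [alt|[k lt_kn]]; last by rewrite eq4 p2; lia.
      have [|k lt_kn wk] := alt 5; first by rewrite eq4.
      by case: (val k lt_kn) => [[]|]; lia.
    + case: (w_closed lt3n) => [alt|[k lt_kn]]; last by rewrite eq3 p2; lia.
      have [|k lt_kn wk] := alt 4; first by rewrite eq3.
      by case: (val k lt_kn) => [[]|]; lia.
  - exfalso.
    (* The values w 1 = 2 and w 2 = 4 leave a gap at 3, so [weight_geometric] applies with q = 3. *)
    have no3 k : k < n -> w k != 3.
      move=> lt_kn; apply/eqP => wk.
      have [le_k1|lt_1k] := leqP k 1; first by have := w_mono le_k1 n_gt1; lia.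
      by have := w_mono lt_1k lt_kn; lia.
    have small j : j < n -> w j < 3 -> w j = p ^ j.
      case: j => [|[|j]] lt_jn lt_w3; first by rewrite w0.
        by rewrite w1 expn1.
      by have := w_mono (_ : 2 <= j.+2) lt_jn; rewrite w2; lia.
    case: (weight_geometric n_gt1 _ no3 small isT w1).
    + by rewrite p2.
    + exact: weight_no_geometric.
    case=> i [lt_1in wi eqw]; have := weight_deviation lt_1in wi eqw.
    have [i2|i_gt2] : i = 2 \/ 2 < i by lia.
      by move: wi; rewrite i2 w2 p2.
    have le_i : p ^ i.-1 <= p ^ n.-2 by rewrite leq_exp2l //; lia.
    have e_n1 : p ^ n.-1 = 2 * p ^ n.-2.
      by rewrite p2 -expnS; congr (_ ^ _); lia.
    rewrite e_n1 => le14; have le14' : p ^ n.-2 <= 14 by lia.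
    have n_eq : n = 5.
      have [//|n_gt5] : n = 5 \/ 5 < n by lia.
      have : 2 ^ 4 <= p ^ n.-2 by rewrite p2 leq_exp2l //; lia.
      by lia.
    have := sum5 n_eq; rewrite w2.
    have [i3|i4] : i = 3 \/ i = 4 by lia.
      move: wi; rewrite i3 p2 /= => w3; have := mono3.
      case: (w_closed n5) => [alt|[k lt_kn eq_k]].
        have [->|w4_gt] : w 4 = 4 \/ 4 < w 4 by lia.
          by lia.
        have [|k lt_kn wk] := alt 3; first by lia.
        by have := no3 k lt_kn; rewrite wk.
      rewrite eq_k p2 => _ eq_s; have wk : w k = 3 by lia.
      by have := no3 k lt_kn; rewrite wk.
    have w3 : w 3 = 8 by rewrite eqw ?i4 // p2.
    by lia.
(* For odd p the gap is at 2, since w 1 = p. *)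
exfalso; have no2 k : k < n -> w k != 2.
  move=> lt_kn; apply/eqP => wk; case: k lt_kn wk => [|k] lt_kn wk.
    by rewrite w0 in wk.
  by have := w_mono (ltn0Sn k) lt_kn; lia.
have small j : j < n -> w j < 2 -> w j = p ^ j.
  case: j => [|j] lt_jn lt_w2; first by rewrite w0.
  by have := w_mono (ltn0Sn j) lt_jn; lia.
case: (weight_geometric n_gt1 _ no2 small isT w1).
- by lia.
- exact: weight_no_geometric.
case=> i [lt_1in wi eqw]; have := weight_deviation lt_1in wi eqw.
have le_i : p ^ i.-1 <= p ^ n.-2 by rewrite leq_exp2l //; lia.
have e_n1 : p ^ n.-1 = p * p ^ n.-2.
  by rewrite -expnS; congr (_ ^ _); lia.
rewrite e_n1 => le14; have le14' : p.-1 * p ^ n.-2 <= 14 by nia.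
have le_p : p ^ 1 <= p ^ n.-2 by rewrite leq_exp2l //; lia.
rewrite expn1 in le_p.
have [p3|lt3p] : p = 3 \/ 3 < p by lia.
  have n3 : n = 3.
    have [//|n_gt3] : n = 3 \/ 3 < n by lia.
    have : 3 ^ 2 <= p ^ n.-2 by rewrite p3 leq_exp2l //; lia.
    by move: le14'; rewrite p3; lia.
  have i2 : i = 2 by lia.
  have := w_sum; rewrite n3; do 3!rewrite big_ltn //; rewrite big_geq // w0 w1 -[2]i2 wi i2 p3.
  by lia.
by have := prime_ge5 lt3p; nia.
Qed.

End Weights.

(** * From the orders of a descending series to its weights *)

Section Conjugate.
Context (p n M : nat) (l : nat -> nat).
Hypothesis p_pr : prime p.
Hypothesis l1 : l 1 = n.
Hypothesis lS : forall m, l m.+1 <= l m.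
Hypothesis lM : l M = 0.
Hypothesis M_gt0 : 0 < M.
Hypothesis l_closed : forall m, 0 < m -> l m.+1 < l m ->
  (forall i, 0 < i <= m -> l i.+1 < l i) \/
  (exists2 k, m = p * k & l k.+1 < l k).
Hypothesis l_sum : p.-1 * (\sum_(1 <= i < M) l i) + 14 * p = p ^ n + 13.

(* W is the partition conjugate to l; its parts are the weights. *)
Let W t := \sum_(1 <= i < M) (t < l i : nat).

Lemma l_le i k : i <= k -> l k <= l i.
Proof.
move/subnKC <-; elim: (k - i) => [|d IH]; first by rewrite addn0.
by rewrite addnS; apply: leq_trans IH.
Qed.

(** The duality of conjugate partitions, through which values of [W] and drops of [l] are
    exchanged. *)
Lemma conjugateE i t : 0 < i -> (i <= W t) = (t < l i).
Proof.
move=> i_gt0; have [lt_t|le_t] := ltnP t (l i).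
  have lt_iM : i < M.
    by rewrite ltnNge; apply/negP => /l_le; rewrite lM; lia.
  rewrite /W (big_cat_nat _ lt_iM) //=.
  rewrite (eq_big_nat _ _ (F2 := fun=> 1)) => [|k /andP[_ le_ki]].
    by rewrite sum_nat_const_nat; lia.
  by rewrite (leq_trans lt_t) // l_le.
apply/negbTE; rewrite -ltnNge.
have [le_iM|lt_Mi] := leqP i M.
  rewrite /W (big_cat_nat i_gt0 le_iM) /= [X in _ + X]big1_seq.
    rewrite addn0; apply: (@leq_ltn_trans (\sum_(1 <= k < i) 1)).
      by apply: leq_sum => k _; case: (_ < _).
    by rewrite sum_nat_const_nat; lia.
  move=> k /=; rewrite mem_index_iota => /andP[le_ik _].
  by have := l_le le_ik; case: ltnP => //; lia.
apply: (@leq_ltn_trans (\sum_(1 <= k < M) 1)).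
  by apply: leq_sum => k _; case: (_ < _).
by rewrite sum_nat_const_nat; lia.
Qed.

Lemma conjugate_sum : \sum_(0 <= t < n) W t = \sum_(1 <= i < M) l i.
Proof.
rewrite exchange_big_nat /=; apply: eq_big_nat => i /andP[i_gt0 _].
have le_n : l i <= n by rewrite -l1; apply: l_le.
rewrite (big_cat_nat (leq0n _) le_n) /= [X in _ + X]big1_seq.
  rewrite (eq_big_nat _ _ (F2 := fun=> 1)) => [|k /andP[_ ->]] //.
  by rewrite sum_nat_const_nat; lia.
by move=> t /=; rewrite mem_index_iota => /andP[le_t _]; rewrite ltnNge le_t.
Qed.

Lemma jump_conjugate m : 0 < m -> l m.+1 < l m -> W (l m.+1) = m.
Proof.
move=> m_gt0 lt_l; apply/eqP; rewrite eqn_leq (conjugateE _ m_gt0) lt_l andbT.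
by rewrite leqNgt (conjugateE _ (ltn0Sn m)) ltnn.
Qed.

Lemma conjugate_jump t m : 0 < m -> W t = m -> l m.+1 < l m.
Proof.
move=> m_gt0 Wt; have : t < l m by rewrite -conjugateE // Wt.
by have : ~~ (t < l m.+1); [rewrite -conjugateE // Wt ltnn|lia].
Qed.

Theorem series_classification :
  [/\ p = 2, n = 5, l 2 = 4, l 3 = 2 &
      [/\ l 4 = 2, l 5 = 1, l 8 = 1 & l 9 = 0]].
Proof.
have p_gt1 := prime_gt1 p_pr.
have n_gt0 : 0 < n.
  rewrite lt0n; apply/eqP => n0; move: l_sum.
  rewrite -conjugate_sum n0 big_geq // expn0; lia.
(* The conjugate partition is nonincreasing, so it is read backwards. *)
pose w j := W (n - j.+1).
have W_gt0 t : t < n -> 0 < W t by move=> lt_tn; rewrite conjugateE // l1.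
(* The smallest weight m cannot exceed 1: by [l_closed], either 1 would be a weight as well, or m =
   p k for a smaller weight k. *)
have w0 : w 0 = 1.
  have lt_n : n - 1 < n by lia.
  apply/eqP; rewrite eqn_leq W_gt0 // andbT leqNgt; apply/negP => W_gt1.
  have jumpW := conjugate_jump (W_gt0 _ lt_n) (erefl (W (n - 1))).
  case: (l_closed (W_gt0 _ lt_n) jumpW) => [alt|[k eq_k jumpk]].
    have := alt 1; rewrite l1 W_gt0 // => /(_ isT) lt_l2.
    by move: W_gt1; rewrite conjugateE //; lia.
  have k_gt0 : 0 < k by have := W_gt0 _ lt_n; lia.
  have : k.+1 <= W (n - 1) by nia.
  by rewrite conjugateE //; have := l_le k_gt0; lia.
have w_mono i j : i <= j -> j < n -> w i <= w j.
  move=> le_ij lt_jn; apply: leq_sum => k _; case: (ltnP (n - i.+1)) => // lt_l.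
  by have -> : n - j.+1 < l k by lia.
have w_jump j : j < n -> l (w j).+1 < l (w j).
  by move=> lt_jn; apply: (@conjugate_jump (n - j.+1)) => //; apply: W_gt0; lia.
have jump_w m : 0 < m -> l m.+1 < l m -> exists2 k, k < n & w k = m.
  move=> m_gt0 jump; exists (n - (l m.+1).+1); last first.
    rewrite /w -[RHS](jump_conjugate m_gt0 jump); congr W.
    by have := l_le m_gt0; lia.
  by have := l_le m_gt0; lia.
have w_gt0 j : j < n -> 0 < w j by move=> lt_jn; apply: W_gt0; lia.
have w_closed j : j < n ->
  (forall i, 0 < i <= w j -> exists2 k, k < n & w k = i) \/
  (exists2 k, k < n & w j = p * w k).
  move=> lt_jn; case: (l_closed (w_gt0 j lt_jn) (w_jump j lt_jn)).
    move=> alt; left=> i i_in; apply: jump_w; first by case/andP: i_in.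
    exact: alt.
  case=> k eq_k jumpk; right.
  have k_gt0 : 0 < k by have := w_gt0 j lt_jn; lia.
  by have [k' lt_k' wk'] := jump_w k k_gt0 jumpk; exists k'; rewrite // wk'.
have w_sum : p.-1 * (\sum_(0 <= j < n) w j) + 14 * p = p ^ n + 13.
  by rewrite -l_sum -conjugate_sum [in RHS]big_nat_rev.
have [p2 n5 [w1 w2 w3 w4]] := weight_classification p_pr w0 w_mono w_closed w_sum.
have eqW t : t < 5 -> W t = w (4 - t).
  by move=> lt_t; rewrite /w n5; congr W; lia.
have lE i : 0 < i -> l i = \sum_(0 <= t < 5) (i <= W t : nat).
  move=> i_gt0; have le_l : l i <= 5 by rewrite -n5 -l1 l_le.
  rewrite (big_cat_nat (leq0n _) le_l) /= [X in _ + X]big1_seq.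
    rewrite (eq_big_nat _ _ (F2 := fun=> 1)) => [|k /andP[_ lt_k]].
      by rewrite sum_nat_const_nat; lia.
    by rewrite conjugateE // lt_k.
  move=> t /=; rewrite mem_index_iota => /andP[le_t _].
  by rewrite conjugateE // ltnNge le_t.
(* The value l i counts the weights 8, 4, 2, 2, 1 that are at least i. *)
have lE5 i : 0 < i ->
    l i = (i <= 8) + ((i <= 4) + ((i <= 2) + ((i <= 2) + (i <= 1)))) :> nat.
  move=> i_gt0; rewrite lE //; do 5!rewrite big_ltn //.
  by rewrite big_geq // addn0 !eqW // subnn w0 w1 w2 w3 w4.
by split; rewrite ?lE5 //; split; rewrite lE5.
Qed.

End Conjugate.

Local Open Scope ring_scope.

(** * Filtrations of a ring by weights of group elements *)

Section LieIdentities.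
Context (R : pzRingType).

Lemma comm_subl1 (x y : R) : (x - 1) * y - y * (x - 1) = x * y - y * x.
Proof. by rewrite mulrBl mulrBr mul1r mulr1 opprB addrA subrK. Qed.

Lemma lieDr (x y z : R) :
  x * (y + z) - (y + z) * x = (x * y - y * x) + (x * z - z * x).
Proof. by rewrite mulrDr mulrDl opprD addrACA. Qed.

Lemma lieDl (x y z : R) :
  (x + y) * z - z * (x + y) = (x * z - z * x) + (y * z - z * y).
Proof. by rewrite mulrDr mulrDl opprD addrACA. Qed.

Lemma lieMr (x y z : R) :
  x * (y * z) - y * z * x = (x * y - y * x) * z + y * (x * z - z * x).
Proof. by rewrite mulrBl mulrBr !mulrA addrA subrK. Qed.

Lemma lieMl (x y z : R) :
  x * y * z - z * (x * y) = x * (y * z - z * y) + (x * z - z * x) * y.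
Proof. by rewrite mulrBl mulrBr !mulrA addrA subrK. Qed.

End LieIdentities.

Section Filtration.
Context (K : fieldType) (p : nat) (charK : p \in [pchar K]) (R : algType K).
Context (gT : finGroupType) (u : gT -> R).
Hypothesis u1 : u 1%g = 1.
Hypothesis uM : {morph u : x y / (x * y)%g >-> x * y}.
Context (Gam : nat -> {group gT}).
Hypothesis Gam0 : Gam 0 = [set: gT]%G.
Hypothesis Gam1 : Gam 1 = [set: gT]%G.
Hypothesis GamR : forall a b x y, x \in Gam a -> y \in Gam b ->
  [~ x, y]%g \in Gam (a + b).+1.

(** This is E_m, presented by its closure rules so that facts about it are inductions on membership.
    As [Gam 0] is everything, [filt 0] contains all [u x]. *)
Inductive filt : nat -> R -> Prop :=
| filt1 : filt 0 1
| filtU w x : x \in Gam w -> filt w (u x - 1)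
| filt0 m : filt m 0
| filtD m x y : filt m x -> filt m y -> filt m (x + y)
| filtZ m k x : filt m x -> filt m (k *: x)
| filtM a b x y : filt a x -> filt b y -> filt (a + b) (x * y)
| filtW m k x : (m <= k)%N -> filt k x -> filt m x.

Lemma filtX w x n : filt w x -> filt (n * w) (x ^+ n).
Proof.
move=> fx; elim: n => [|n IH]; first by rewrite expr0; exact: filt1.
by rewrite exprS mulSn; apply: filtM.
Qed.

Lemma filt_unit x : filt 0 (u x).
Proof.
rewrite -[u x](subrK 1); apply: filtD; last exact: filt1.
by apply: filtU; rewrite Gam0 inE.
Qed.

Lemma filtMl m x y : filt 0 x -> filt m y -> filt m (x * y).
Proof. exact: filtM. Qed.

Lemma filtMr m x y : filt m x -> filt 0 y -> filt m (x * y).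
Proof. by move=> fx fy; rewrite -[m]addn0; apply: filtM. Qed.

Lemma u_inv x : u x * u x^-1%g = 1. Proof. by rewrite -uM mulgV u1. Qed.
Lemma u_invl x : u x^-1%g * u x = 1. Proof. by rewrite -uM mulVg u1. Qed.

Lemma uX x n : u (x ^+ n)%g = u x ^+ n.
Proof.
elim: n => [|n IH]; first by rewrite expg0 expr0 u1.
by rewrite expgS exprS uM IH.
Qed.

Lemma u_comm x y : u x * u y - u y * u x = u (y * x)%g * (u [~ x, y]%g - 1).
Proof. by rewrite mulrBr mulr1 -!uM -commgC. Qed.

(* The associated graded ring is commutative: a commutator gains one extra
   degree, since [Gam a, Gam b] lies in Gam (a + b + 1). *)
Lemma filt_comm a b x y : filt a x -> filt b y ->
  filt (a + b).+1 (x * y - y * x).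
Proof.
move=> fx; elim: fx b y => {a x}.
- by move=> b y _; rewrite mul1r mulr1 subrr; apply: filt0.
- move=> w x Gx b y; elim=> {b y}.
  + by rewrite mul1r mulr1 subrr; apply: filt0.
  + move=> v y Gy.
    rewrite (_ : _ - _ = u x * u y - u y * u x); last first.
      by rewrite comm_subl1 -[LHS]opprB comm_subl1 opprB.
    rewrite u_comm; apply: filtMl; first exact: filt_unit.
    by apply: filtU; apply: GamR.
  + by move=> m; rewrite mul0r mulr0 subrr; apply: filt0.
  + move=> m y z _ IHy _ IHz; rewrite lieDr.
    exact: filtD.
  + move=> m k y _ IHy; rewrite -scalerAl -scalerAr -scalerBr.
    exact: filtZ.
  + move=> c b y z fy IHy fz IHz.
    rewrite lieMr.
    apply: filtD.
      by rewrite addnA -addSn; apply: filtM.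
    by rewrite addnCA -addnS; apply: filtM.
  + move=> m k y le_mk _ IHy; apply: filtW IHy.
    by rewrite ltnS leq_add2l.
- by move=> m b y _; rewrite mul0r mulr0 subrr; apply: filt0.
- move=> m x z _ IHx _ IHz b y fy; rewrite lieDl.
  by apply: filtD; [apply: IHx|apply: IHz].
- move=> m k x _ IHx b y fy; rewrite -scalerAl -scalerAr -scalerBr.
  by apply: filtZ; apply: IHx.
- move=> a c x z fx IHx fz IHz b y fy.
  rewrite lieMl.
  apply: filtD.
    by rewrite -addnA -addnS; apply: filtM => //; apply: IHz.
  by rewrite addnAC -addSn; apply: filtM => //; apply: IHx.
- move=> m k x le_mk _ IHx b y fy; apply: filtW (IHx _ _ fy).
  by rewrite ltnS leq_add2r.
Qed.

(** The commutator rule asks for degree a + b only, one less than what the D_m satisfy; this leaves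
    room for the perturbed and the explicit series to which the vanishing bound is applied. *)
Definition good_series (S : nat -> {group gT}) (M : nat) :=
  [/\ S 0 = [set: gT]%G /\ S 1 = [set: gT]%G,
      forall m, S m.+1 \subset S m /\ Gam m \subset S m,
      forall a b x y, x \in S a -> y \in S b -> [~ x, y]%g \in S (a + b)%N,
      forall a x, x \in S a -> (x ^+ p)%g \in S (p * a)%N
    & (0 < M)%N /\ S M = 1%G].

Definition series_weight (S : nat -> {group gT}) (M : nat) :=
  (\sum_(1 <= i < M) logn p #|S i|)%N.

Let p_pr : prime p. Proof. by case/andP: charK. Qed.
Let p_gt0 : (0 < p)%N. Proof. exact: prime_gt0. Qed.
Let p_gt1 : (1 < p)%N. Proof. exact: prime_gt1. Qed.

Lemma charR : p \in [pchar R].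
Proof. by rewrite GRing.pchar_lalg. Qed.

Lemma usub1_expp x : (u x - 1) ^+ p = u (x ^+ p)%g - 1.
Proof.
have := pFrobenius_autB_comm charR (commr1 (u x)).
by rewrite !pFrobenius_autE expr1n uX.
Qed.

(* Linear combinations of the ordered products of the (u x_i - 1) ^+ a_i with
   a_i < p and \sum_i a_i * w_i >= m, where s lists the pairs (x_i, w_i). *)
Fixpoint ordfilt (s : seq (gT * nat)) (m : nat) (f : R) : Prop :=
  if s is (x, w) :: s' then
    exists2 c : nat -> R, (forall a, ordfilt s' (m - a * w) (c a))
      & f = \sum_(a < p) (u x - 1) ^+ a * c a
  else if m is 0 then exists k, f = k%:A else f = 0.

Lemma ordfilt0 s m : ordfilt s m 0.
Proof.
elim: s m => [[|m]|[x w] s IH m] /=; first by exists 0; rewrite scale0r.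
  by [].
by exists (fun=> 0) => // ; rewrite big1 // => i _; rewrite mulr0.
Qed.

Lemma ordfiltD s m f g : ordfilt s m f -> ordfilt s m g -> ordfilt s m (f + g).
Proof.
elim: s m f g => [[|m]|[x w] s IH m] /= f g.
- by move=> [k ->] [l ->]; exists (k + l); rewrite scalerDl.
- by move=> -> ->; rewrite addr0.
move=> [c Fc ->] [d Fd ->]; exists (fun a => c a + d a) => [a|].
  exact: IH.
by rewrite -big_split /=; apply: eq_bigr => i _; rewrite mulrDr.
Qed.

Lemma ordfiltZ s m k f : ordfilt s m f -> ordfilt s m (k *: f).
Proof.
elim: s m f => [[|m]|[x w] s IH m] /= f.
- by move=> [l ->]; exists (k * l); rewrite scalerA.
- by move=> ->; rewrite scaler0.
move=> [c Fc ->]; exists (fun a => k *: c a) => [a|]; first exact: IH.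
by rewrite scaler_sumr; apply: eq_bigr => i _; rewrite scalerAr.
Qed.

Lemma ordfilt_sum s m (I : Type) (r : seq I) (P : pred I) (F : I -> R) :
  (forall i, P i -> ordfilt s m (F i)) ->
  ordfilt s m (\sum_(i <- r | P i) F i).
Proof.
by move=> fF; elim/big_ind: _ => //; [exact: ordfilt0|exact: ordfiltD].
Qed.

Lemma ordfiltW s m k f : (m <= k)%N -> ordfilt s k f -> ordfilt s m f.
Proof.
elim: s m k f => [m [|k]|[x w] s IH m k] /= f.
- by case: m.
- by move=> _ ->; case: m => [|//]; exists 0; rewrite scale0r.
move=> le_mk [c Fc ->]; exists c => // a; apply: IH (Fc a).
exact: leq_sub2r.
Qed.

Lemma ordfilt_cons x w s m a f : (a < p)%N ->
  ordfilt s (m - a * w) f -> ordfilt ((x, w) :: s) m ((u x - 1) ^+ a * f).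
Proof.
move=> ltap Ff /=; exists (fun b => if b == a then f else 0) => [b|].
  by case: eqP => [->//|_]; apply: ordfilt0.
rewrite (bigD1 (Ordinal ltap)) //= eqxx big1 ?addr0 // => i.
by rewrite -val_eqE /= => /negbTE->; rewrite mulr0.
Qed.

Lemma ordfilt_lift x w s m f :
  ordfilt s m f -> ordfilt ((x, w) :: s) m f.
Proof.
move=> Ff; rewrite -[f]mul1r -(expr0 (u x - 1)).
by apply: ordfilt_cons; rewrite ?mul0n ?subn0.
Qed.

Lemma ordfilt1 s : ordfilt s 0 1.
Proof.
elim: s => [|[x w] s IH]; first by exists 1; rewrite scale1r.
exact: ordfilt_lift.
Qed.

(** Exponents are at most p - 1, so an ordered product has weight at most (p - 1) times the sum of
    the weights. In higher degree the empty list is reached with a positive degree left, where only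
    0 is allowed. *)
Lemma ordfilt_vanish s m f :
  (p.-1 * sumn [seq y.2 | y <- s] < m)%N -> ordfilt s m f -> f = 0.
Proof.
elim: s m f => [[|m]|[x w] s IH m] f //=.
rewrite mulnDr => lt_m [c Fc ->]; rewrite big1 // => i _.
rewrite (IH _ (c i) _ (Fc i)) ?mulr0 // ltn_subRL.
apply: leq_ltn_trans lt_m; rewrite leq_add2r leq_mul2r.
by rewrite -ltnS prednK // ltn_ord orbT.
Qed.

(** * Bases adapted to a good series *)

Section Adapted.
Context (S : nat -> {group gT}) (M : nat).
Hypothesis goodS : good_series S M.

Let S1 : S 1 = [set: gT]%G. Proof. by case: goodS => -[]. Qed.
Let SR a b x y : x \in S a -> y \in S b -> [~ x, y]%g \in S (a + b)%N.
Proof. by case: goodS => _ _ + _ _; apply. Qed.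
Let SX a x : x \in S a -> (x ^+ p)%g \in S (p * a)%N.
Proof. by case: goodS => _ _ _ + _; apply. Qed.
Let SS m : S m.+1 \subset S m.
Proof. by case: goodS => _ /(_ m)[]. Qed.

Lemma good_le i k : (i <= k)%N -> S k \subset S i.
Proof.
move/subnKC <-; elim: (k - i)%N => [|d IH]; first by rewrite addn0.
by rewrite addnS; apply: subset_trans IH; apply: SS.
Qed.

(** A refinement of [S] with steps of index p, listing for each step a representative x and its
    weight. Since S (w+1) lies in B and A in S w, the element x is in S w but not in S (w+1). *)
Inductive adapted : {group gT} -> seq (gT * nat) -> Prop :=
| adapted1 : adapted 1%G [::]
| adapted_cons (A B : {group gT}) x w s :
    adapted B s -> (0 < w)%N -> S w.+1 \subset B -> B \subset A ->
    A \subset S w -> x \in A -> x \notin B -> (x ^+ p)%g \in B ->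
    (forall a, a \in A -> exists2 i : 'I_p, true & exists2 b, b \in B & a = x ^+ i * b)%g ->
    adapted A ((x, w) :: s).

Let conju g f := u g^-1%g * f * u g.

Lemma conjuM g f h : conju g (f * h) = conju g f * conju g h.
Proof.
rewrite /conju !mulrA; congr (_ * _); rewrite -!mulrA; congr (_ * (_ * _)).
by rewrite mulrA u_inv mul1r.
Qed.

Lemma conju_sum g n (F : 'I_n -> R) :
  conju g (\sum_(i < n) F i) = \sum_(i < n) conju g (F i).
Proof. by rewrite /conju mulr_sumr mulr_suml. Qed.

Lemma conjuE g f : f * u g = u g * conju g f.
Proof. by rewrite /conju !mulrA u_inv mul1r. Qed.

Definition ordfilt_mult s := forall a b f g,
  ordfilt s a f -> ordfilt s b g -> ordfilt s (a + b) (f * g).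

Definition ordfilt_elt (A : {group gT}) s := forall v h,
  h \in A -> h \in S v -> ordfilt s v (u h - 1).

Definition ordfilt_conj s := forall v g m f,
  g \in S v -> ordfilt s m f -> ordfilt s (m + v) (conju g f - f).

(** Two rewritings bring a product to ordered form without loss of degree. An exponent p or more is
    reduced by X^p = [u (x ^+ p) - 1], where [x ^+ p] lies in B with weight p w. A coefficient f
    passes X by f X = X (f + d) + d, where d = [conju x f - f] has gained weight w. *)
Lemma adapted_mult (A B : {group gT}) x w s :
    ordfilt_mult s -> ordfilt_elt B s -> ordfilt_conj s -> B \subset A ->
    A \subset S w -> x \in A -> (x ^+ p)%g \in B ->
  ordfilt_mult ((x, w) :: s).
Proof.
move=> multB eltB conjB sBA sAS xA xpB; have xS := subsetP sAS _ xA.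
set P := ordfilt ((x, w) :: s); set X := u x - 1.
have XXp m f a : ordfilt s m f -> P (m + a * w)%N (X ^+ a * f).
  have [k] := ubnP a; elim: k a m f => // k IHk a m f lt_ak Ff.
  have [lt_ap|le_pa] := ltnP a p.
    by apply: ordfilt_cons; rewrite // addnK.
  rewrite -(subnK le_pa) exprD -mulrA mulnDl addnA addnAC.
  apply: IHk; first by lia.
  rewrite addnC /X usub1_expp; apply: multB => //.
  by apply: eltB => //; apply: SX.
have XP m f a : P m f -> P (m + a * w)%N (X ^+ a * f).
  move=> [c Fc ->]; rewrite mulr_sumr; apply: ordfilt_sum => i _.
  rewrite mulrA -exprD; apply: (@ordfiltW _ _ (m - i * w + (a + i) * w)).
    by lia.
  exact: (XXp _ _ _ (Fc i)).
have fXc a k m f c : ordfilt s k f -> ordfilt s m c ->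
    P (k + a * w + m)%N (f * X ^+ a * c).
  elim: a k f => [|a IH] k f Ff Fc.
    rewrite mul0n addn0 expr0 mulr1; apply: ordfilt_lift; exact: multB.
  set d := conju x f - f.
  have Fd : ordfilt s (k + w) d by apply: conjB.
  have fX : f * X = X * (f + d) + d.
    rewrite /X mulrBr mulr1 conjuE /d [f + _]addrC subrK mulrBl mul1r -addrA.
    by congr (_ + _); rewrite addrA addNr sub0r.
  have -> : f * X ^+ a.+1 * c = X * ((f + d) * X ^+ a * c) + d * X ^+ a * c.
    by rewrite exprS (mulrA f) fX mulrDl mulrDl -!mulrA.
  apply: ordfiltD.
    have Ffd : ordfilt s k (f + d).
      by apply: ordfiltD => //; apply: ordfiltW Fd; apply: leq_addr.
    have := XP _ _ 1 (IH _ _ Ffd Fc); rewrite expr1; apply: ordfiltW.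
    by lia.
  by rewrite mulSn addnA; apply: IH.
move=> a b f g [c Fc ->] [d Fd ->].
rewrite mulr_suml; apply: ordfilt_sum => i _.
apply: (@ordfiltW _ _ (a - i * w + b + i * w)).
  by lia.
rewrite -mulrA; apply: XP; rewrite mulr_sumr; apply: ordfilt_sum => k _.
rewrite mulrA; apply: ordfiltW (fXc _ _ _ _ _ (Fc _) (Fd _)).
by lia.
Qed.

(** An element outside B cannot have weight above w, because S (w+1) lies in B. It remains to expand
    x^i b in degree w. *)
Lemma adapted_elt (A B : {group gT}) x w s :
    ordfilt_mult ((x, w) :: s) -> ordfilt_elt B s ->
    S w.+1 \subset B -> B \subset A -> A \subset S w -> x \in A ->
    (forall a, a \in A -> exists2 i : 'I_p, true & exists2 b, b \in B & a = x ^+ i * b)%g ->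
  ordfilt_elt A ((x, w) :: s).
Proof.
move=> multA eltB sSB sBA sAS xA genA v h hA hS.
have [hB|hB] := boolP (h \in B); first by apply: ordfilt_lift; apply: eltB.
have le_vw : (v <= w)%N.
  rewrite leqNgt; apply: contra hB => lt_wv.
  by apply: (subsetP sSB); apply: subsetP hS; apply: good_le.
apply: ordfiltW le_vw _; have [i _ [b bB ->]] := genA _ hA.
have Fb : ordfilt ((x, w) :: s) w (u b - 1).
  apply: ordfilt_lift; apply: eltB => //.
  by apply: (subsetP sAS); apply: (subsetP sBA).
have F1 := ordfilt1 ((x, w) :: s).
have FX : ordfilt ((x, w) :: s) w (u x - 1).
  rewrite -[u x - 1]mulr1 -[X in X * _]expr1; apply: ordfilt_cons => //.
  by rewrite mul1n subnn; apply: ordfilt1.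
have F0 y : ordfilt ((x, w) :: s) w (u y - 1) -> ordfilt ((x, w) :: s) 0 (u y).
  move=> Fy; rewrite -[u y](subrK 1); apply: ordfiltD => //.
  exact: ordfiltW Fy.
have FM y z : ordfilt ((x, w) :: s) w (u y - 1) ->
    ordfilt ((x, w) :: s) w (u z - 1) ->
    ordfilt ((x, w) :: s) w (u (y * z)%g - 1).
  move=> Fy Fz; have -> : u (y * z)%g - 1 = (u y - 1) * u z + (u z - 1).
    by rewrite uM mulrBl mul1r addrA subrK.
  by apply: ordfiltD => //; have := multA w 0 _ _ Fy (F0 _ Fz); rewrite addn0.
apply: (FM) => //; elim: (i : nat) => [|n IH].
  by rewrite expg0 u1 subrr; apply: ordfilt0.
by rewrite expgS; apply: (FM).
Qed.

(** Conjugation is multiplicative, so the gain of weight v passes from factors to products; this is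
    the property [Q]. On [u x - 1] the difference is u x (u [x, g] - 1), and [x, g] has weight w + v
    and lies in B. *)
Lemma adapted_conj (A B : {group gT}) x w s :
    ordfilt_mult ((x, w) :: s) -> ordfilt_elt A ((x, w) :: s) ->
    ordfilt_conj s -> (0 < w)%N -> S w.+1 \subset B -> B \subset A ->
    A \subset S w -> x \in A ->
  ordfilt_conj ((x, w) :: s).
Proof.
move=> multA eltA conjB w_gt0 sSB sBA sAS xA v g m f gS.
have xS := subsetP sAS _ xA.
pose Q k h := ordfilt ((x, w) :: s) k h /\
              ordfilt ((x, w) :: s) (k + v) (conju g h - h).
have QW k l h : (k <= l)%N -> Q l h -> Q k h.
  move=> le_kl [Fh Fc]; split; first exact: ordfiltW Fh.
  by apply: ordfiltW Fc; rewrite leq_add2r.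
have QM k l h h' : Q k h -> Q l h' -> Q (k + l)%N (h * h').
  move=> [Fh Fc] [Fh' Fc']; split; first exact: multA.
  rewrite conjuM.
  have -> : conju g h * conju g h' - h * h' =
     (conju g h - h) * conju g h' + h * (conju g h' - h').
    by rewrite mulrBl mulrBr addrA subrK.
  apply: ordfiltD; last by rewrite -addnA; apply: multA.
  rewrite addnAC; apply: multA => //; rewrite -(subrK h' (conju g h')).
  by apply: ordfiltD => //; apply: ordfiltW Fc'; apply: leq_addr.
have Q1 : Q 0 1.
  split; first exact: ordfilt1.
  by rewrite /conju mulr1 u_invl subrr; apply: ordfilt0.
have QX : Q w (u x - 1).
  split.
    rewrite -[u x - 1]mulr1 -[X in X * _]expr1; apply: ordfilt_cons => //.
    by rewrite mul1n subnn; apply: ordfilt1.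
  have -> : conju g (u x - 1) - (u x - 1) = u x * (u [~ x, g]%g - 1).
    rewrite /conju mulrBr mulrBl mulr1 u_invl opprB addrA subrK -!uM.
    by rewrite mulrBr mulr1 -uM commgEl mulKVg conjgE mulgA.
  rewrite -[(w + v)%N]add0n; apply: multA.
    rewrite -[u x](subrK 1); apply: ordfiltD; last exact: ordfilt1.
    by apply: ordfiltW (leq0n w) _; apply: eltA.
  apply: eltA; last exact: SR.
  apply: (subsetP sBA); apply: (subsetP sSB); rewrite -addn1.
  by apply: SR => //; rewrite S1 inE.
have QXa a : Q (a * w)%N ((u x - 1) ^+ a).
  by elim: a => [|a IH]; rewrite ?expr0 // exprS mulSn; apply: QM.
move=> [c Fc ->]; rewrite conju_sum -sumrB; apply: ordfilt_sum => i _.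
have Qc : Q (m - i * w)%N (c i).
  split; first by apply: (ordfilt_lift _ _ (Fc i)).
  by apply: ordfilt_lift; apply: (conjB _ _ _ _ gS (Fc i)).
apply: (QW _ _ _ _ (QM _ _ _ _ (QXa i) Qc)).2.
by lia.
Qed.

Lemma adapted_ordfilt A s : adapted A s ->
  [/\ ordfilt_mult s, ordfilt_elt A s & ordfilt_conj s].
Proof.
elim=> {A s} [|A B x w s _ [mB eB cB] w_gt0 sSB sBA sAS xA _ xpB genA].
  split.
  - move=> [|a] [|b] f g //=; first by move=> [k ->] [l ->]; exists (k * l);
      rewrite -scalerAl mul1r scalerA.
    + by move=> _ ->; rewrite mulr0.
    + by move=> -> _; rewrite mul0r.
    + by move=> -> _; rewrite mul0r.
  - by move=> v h /set1P-> _; rewrite u1 subrr; apply: ordfilt0.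
  - move=> v g [|m] f gS /=.
      move=> [k ->]; rewrite /conju -scalerAr -scalerAl mulr1 u_invl subrr.
      exact: (ordfilt0 [::]).
    by move=> ->; rewrite /conju mulr0 mul0r subrr.
have mA := adapted_mult mB eB cB sBA sAS xA xpB.
have eA := adapted_elt mA eB sSB sBA sAS xA genA.
by split=> //; apply: (adapted_conj mA eA cB w_gt0 sSB sBA sAS xA).
Qed.

Lemma adapted_full s m f : adapted [set: gT]%G s -> filt m f -> ordfilt s m f.
Proof.
move=> /adapted_ordfilt[mS eS _]; elim=> {m f}.
- exact: ordfilt1.
- move=> w x Gx; apply: eS; first by rewrite inE.
  by case: goodS => _ /(_ w)[_ /subsetP]-> .
- by move=> m; apply: ordfilt0.
- by move=> m x y _ Fx _ Fy; apply: ordfiltD.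
- by move=> m k x _ Fx; apply: ordfiltZ.
- by move=> a b x y _ Fx _ Fy; apply: mS.
- by move=> m k x le_mk _; apply: ordfiltW.
Qed.

Hypothesis pT : (p.-group [set: gT])%g.

Let pS (A : {group gT}) : (p.-group A)%g.
Proof. exact: pgroupS (subsetT _) pT. Qed.

(** Modulo S (w+1), hence modulo B, elements of S w have trivial p-th powers and are central. So any
    x in S w outside B generates with B a group in which B has index p. *)
Lemma adapted_extend d (B : {group gT}) s w :
    (0 < w)%N -> adapted B s -> S w.+1 \subset B -> B \subset S w ->
    (logn p #|S w| = logn p #|B| + d)%N ->
  exists s', adapted (S w) s' /\
    sumn [seq y.2 | y <- s'] = (sumn [seq y.2 | y <- s] + d * w)%N.
Proof.
move=> w_gt0; elim: d B s => [|d IH] B s adB sSB sBS.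
  rewrite addn0 => eq_log; exists s; rewrite mul0n addn0; split=> //.
  suff <- : B = S w by [].
  apply/group_inj/eqP; rewrite eqEcard sBS /=.
  by rewrite (card_pgroup (pS B)) (card_pgroup (pS (S w))) eq_log.
move=> eq_log.
have [x xS xB] : exists2 x, x \in S w & x \notin B.
  apply/subsetPn; apply/negP => sSwB; move: eq_log.
  have -> : S w = B by apply/group_inj/eqP; rewrite eqEsubset sSwB.
  by lia.
have xpB : (x ^+ p)%g \in B.
  apply: (subsetP sSB); apply: (subsetP (good_le _)) (SX xS).
  by have := p_gt1; nia.
have nBx : x \in 'N(B)%g.
  rewrite inE; apply/subsetP => _ /imsetP[b bB ->].
  rewrite conjg_mulR groupM //; apply: (subsetP sSB).
  have -> : w.+1 = (w + 1)%N by rewrite addn1.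
  rewrite addnC -invgR groupV addnC; apply: SR => //.
  by rewrite S1 inE.
pose A := (<[x]> <*> B)%G.
have defA : A = (<[x]> * B)%g :> {set gT} by rewrite /= norm_joinEl // cycle_subG.
have xA : x \in A by rewrite mem_gen // inE cycle_id.
have sBA : B \subset A by apply: joing_subr.
have genA a : a \in A -> exists2 i : 'I_p, true & exists2 b, b \in B & a = (x ^+ i * b)%g.
  rewrite defA => /mulsgP[_ b /cycleP[n ->] bB ->].
  exists (Ordinal (ltn_pmod n p_gt0)) => //=.
  exists (x ^+ p ^+ (n %/ p) * b)%g; first by rewrite groupM // groupX.
  by rewrite mulgA -expgM -expgD {1}(divn_eq n p) addnC mulnC.
have sAS : A \subset S w by rewrite /= join_subG cycle_subG xS.
have adA : adapted A ((x, w) :: s) by apply: adapted_cons genA.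
have cardA : (logn p #|A| = (logn p #|B|).+1)%N.
  have nAB : A \subset 'N(B)%g by rewrite /= join_subG cycle_subG nBx normG.

  rewrite -(LagrangeI A B) (setIidPr sBA) lognM ?cardG_gt0 //.
  rewrite -(card_quotient nAB) /= quotientYidr ?cycle_subG // quotient_cycle //.
  have ox : #[coset B x]%g = p.
    apply: nt_prime_order => //; first by rewrite -morphX //= coset_id.
    by apply/eqP => /coset_idr xB'; rewrite xB' in xB.
  by rewrite -orderE ox (logn_prime _ p_pr) eqxx addn1.
have [||s' [ads' eqs']] := IH A _ adA _ sAS.
- exact: subset_trans sSB sBA.
- by rewrite cardA eq_log addSnnS.
by exists s'; split=> //; rewrite eqs' /= mulSn addnCA addnA.
Qed.

(** Descending induction from M. The formula for the weight is summation by parts of i (log |S i| -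
    log |S (i+1)|) over i >= k. *)
Lemma adapted_exists k : (0 < k <= M)%N -> exists s, adapted (S k) s /\
  sumn [seq y.2 | y <- s] =
  (k * logn p #|S k| + \sum_(k.+1 <= i < M) logn p #|S i|)%N.
Proof.
case/andP=> k_gt0 le_kM; rewrite -(subKn le_kM).
have : (M - k < M)%N by lia.
elim: (M - k)%N => [|d IH] lt_dM.
  have SM : S M = 1%G by case: goodS => _ _ _ _ [].
  exists [::]; rewrite subn0 SM cards1 logn1 muln0 big_geq //.
  by split=> //; apply: adapted1.
have [s [ads eqs]] := IH (ltnW lt_dM).
set m := (M - d.+1)%N; have eq_m : (M - d)%N = m.+1 by rewrite /m; lia.
rewrite eq_m in ads eqs.
have m_gt0 : (0 < m)%N by rewrite /m; lia.
have eq_log : (logn p #|S m| =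
    logn p #|S m.+1| + (logn p #|S m| - logn p #|S m.+1|))%N.
  by rewrite subnKC // dvdn_leq_log ?cardG_gt0 // cardSg.
have [s' [ads' eqs']] := adapted_extend m_gt0 ads (subxx _) (SS m) eq_log.
exists s'; split=> //; rewrite eqs' eqs mulnBl.
have le_l : (logn p #|S m.+1| <= logn p #|S m|)%N.
  by rewrite dvdn_leq_log ?cardG_gt0 // cardSg.
have [lt_mM|le_Mm] := ltnP m.+1 M; first by rewrite (big_ltn lt_mM); nia.
rewrite !big_geq; try lia.
have SM : S M = 1%G by case: goodS => _ _ _ _ [].
have -> : m.+1 = M by rewrite /m; lia.
by rewrite SM cards1 logn1; nia.
Qed.

Lemma adapted_weight : exists s, adapted [set: gT]%G s /\
  sumn [seq y.2 | y <- s] = series_weight S M.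
Proof.
have M_gt0 : (0 < M)%N by case: goodS => _ _ _ _ [].
have [|s [ads eqs]] := adapted_exists (k := 1); first by rewrite M_gt0.
exists s; rewrite -S1; split=> //; rewrite eqs /series_weight mul1n.
have [lt1M|leM1] := ltnP 1 M; first by rewrite (big_ltn lt1M).
have eqM : M = 1%N by lia.
have SM : S M = 1%G by case: goodS => _ _ _ _ [].
rewrite eqM in SM; rewrite SM cards1 logn1 big_geq ?big_geq //; lia.
Qed.

Lemma filt_vanish m f : (p.-1 * series_weight S M < m)%N -> filt m f -> f = 0.
Proof.
move=> lt_m Ff; have [s [ads eqs]] := adapted_weight.
by apply: (@ordfilt_vanish s m) (adapted_full ads Ff); rewrite eqs.
Qed.

Lemma expg_coprime_mem (B : {group gT}) x m n :
  (0 < m)%N -> coprime m n -> (x ^+ m)%g \in B -> (x ^+ n)%g \in B -> x \in B.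
Proof.
move=> m_gt0 co_mn xm xn; case: (egcdnP n m_gt0) => a b eq_ab _.
have : (x ^+ (a * m))%g \in B by rewrite mulnC expgM groupX.
rewrite eq_ab (eqP co_mn) expgD expg1 groupMl //.
by rewrite mulnC expgM groupX.
Qed.

(** The identity is proved in K[X], where X - 1 can be cancelled, and then evaluated: [u x - 1] may
    be a zero divisor. *)
Lemma geometric_sum_char x : \sum_(i < p) u x ^+ i = (u x - 1) ^+ p.-1.
Proof.
have charP : p \in [pchar {poly K}] by rewrite GRing.pchar_lalg.
have polyE : \sum_(i < p) 'X ^+ i = ('X - 1) ^+ p.-1 :> {poly K}.
  apply: (@mulfI _ ('X - 1)); first by rewrite -polyC1 polyXsubC_eq0.
  rewrite -exprS prednK // -subrX1.
  have := pFrobenius_autB_comm charP (commr1 'X).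
  by rewrite !pFrobenius_autE expr1n.
have := congr1 (horner_alg (u x)) polyE.
rewrite rmorph_sum rmorphXn rmorphB /= horner_algX rmorph1 => <-.
by apply: eq_bigr => i _; rewrite rmorphXn /= horner_algX.
Qed.

(** Splitting A into the cosets x^i B factors the sum over A as [(u x - 1) ^+ p.-1] times the sum
    over B. The norm is thus the product with all exponents maximal, of weight exactly the vanishing
    bound. *)
Lemma adapted_norm A s : (forall w x, x \in S w -> filt w (u x - 1)) ->
  adapted A s -> filt (p.-1 * sumn [seq y.2 | y <- s]) (\sum_(a in A) u a).
Proof.
move=> filtS; elim=> {A s} [|A B x w s adB IH w_gt0 sSB sBA sAS xA xB xpB genA].
  by rewrite muln0 big_set1 u1; apply: filt1.
pose h (q : 'I_p * gT) := (x ^+ q.1 * q.2)%g.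
(* If i > k, then x^(i-k) and x^p both lie in B, and coprimality of i - k and p puts x there too. *)
have h_inj (i k : 'I_p) b c : (k <= i)%N -> b \in B -> c \in B ->
    (x ^+ i * b = x ^+ k * c)%g -> i = k.
  move=> le_ki bB cB; rewrite -(subnKC le_ki) expgD -mulgA => /mulgI eq_bc.
  apply: ord_inj; apply/eqP; rewrite eqn_leq le_ki andbT leqNgt.
  apply: contra xB => lt_ki; apply: (@expg_coprime_mem _ _ (i - k) p) => //.
  - by rewrite subn_gt0.
  - rewrite coprime_sym prime_coprime // gtnNdvd ?subn_gt0 //.
    exact: leq_ltn_trans (leq_subr _ _) (ltn_ord i).
  - by rewrite -(groupMr _ bB) eq_bc.
have -> : \sum_(a in A) u a =
    \sum_(q in setX [set: 'I_p]%SET B) u (h q).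
  have h_injA : {in setX [set: 'I_p]%SET B &, injective h}.
    move=> q r; case: q => i b; case: r => k c.
    rewrite !in_setX => /andP[_ bB] /andP[_ cB]; rewrite /h /= => eq_h.
    have eq_ik : i = k.
      case: (leqP k i) => [le_ki|/ltnW le_ik]; first exact: h_inj eq_h.
      by apply/esym; apply: h_inj (esym eq_h).
    by rewrite eq_ik in eq_h *; rewrite (mulgI _ _ _ eq_h).
  rewrite -(big_imset _ h_injA) /=.
  apply: eq_bigl => a; apply/idP/imsetP => [/genA[i _ [b bB ->]]|].
    by exists (i, b); rewrite // in_setX inE.
  move=> [[i b]]; rewrite in_setX => /andP[_ bB] ->.
  by apply: groupM; [apply: groupX|apply: (subsetP sBA)].
have -> : \sum_(q in setX [set: 'I_p]%SET B) u (h q) =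
    \sum_(i < p) \sum_(b in B) u (x ^+ i * b)%g.
  by rewrite pair_big /=; apply: eq_bigl => -[i b]; rewrite in_setX inE.
rewrite (eq_bigr (fun i : 'I_p => u x ^+ i * \sum_(b in B) u b)); last first.
  by move=> i _; rewrite mulr_sumr; apply: eq_bigr => b _; rewrite uM uX.
rewrite -mulr_suml geometric_sum_char mulnDr; apply: filtM => //.
by apply: filtX; apply: filtS; apply: (subsetP sAS).
Qed.

Lemma filt_norm : (forall w x, x \in S w -> filt w (u x - 1)) ->
  filt (p.-1 * series_weight S M) (\sum_x u x).
Proof.
move=> filtS; have [s [ads eqs]] := adapted_weight.
have := adapted_norm filtS ads; rewrite eqs.
by rewrite (eq_bigl xpredT) // => x; rewrite inE.
Qed.

End Adapted.

End Filtration.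

(** * Dimension subgroups *)

Section PCentral.
Local Open Scope group_scope.

(** The lower exponent-p central series starting at A, each term being the Frattini subgroup of the
    preceding one times its commutator with the whole group. *)
Lemma pcentral_series (gT : finGroupType) (p : nat) (A : {group gT}) :
    p.-group [set: gT] -> A <| [set: gT] ->
  exists (P : nat -> {group gT}) (r : nat), [/\ P 0%N = A, P r = 1%G &
    forall i, [/\ P i.+1 \subset P i,
      forall x y, x \in P i -> [~ x, y] \in P i.+1 &
      forall x, x \in P i -> x ^+ p \in P i.+1]].
Proof.
move=> pT; have [k] := ubnP #|A|; elim: k A => // k IH A lt_k nA.
have [A1|ntA] := eqsVneq A 1%G.
  exists (fun=> 1%G), 0%N; split=> // [|i]; first by apply/group_inj.
  split=> // [x y /set1P->|x /set1P->]; first by rewrite comm1g group1.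
  by rewrite expg1n group1.
have pA : p.-group A := pgroupS (subsetT _) pT.
have sRA : [~: A, [set: gT]] \subset A by rewrite commg_subl normal_norm.
have ltRA : [~: A, [set: gT]] \proper A.
  apply: (nil_comm_properl (pgroup_nil pT)); rewrite ?subsetT //.
  by rewrite subsetI subxx normal_norm.
pose B := ('Phi(A) <*> [~: A, [set: gT]])%G.
have sBA : B \subset A by rewrite join_subG sRA Phi_sub.
have ltBA : B \proper A.
  rewrite properEneq sBA andbT; apply/eqP => eqBA.
  have /= eqA := Phi_nongen eqBA.
  by rewrite genGid in eqA; rewrite eqA properxx in ltRA.
have nB : B <| [set: gT].
  apply: normalY; first exact: gFnormal_trans.
  by rewrite /normal subsetT commg_normr.
have [P [r [P0 Pr PS]]] := IH B (leq_trans (proper_card ltBA) lt_k) nB.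
exists (fun i => if i is i'.+1 then P i' else A), r.+1; split=> // -[|i] //.
rewrite P0; split=> // [x y xA|x xA].
  by rewrite mem_gen // inE orbC mem_commg // inE.
rewrite mem_gen // inE (Phi_joing pA) (mem_gen (A := _ :|: _)) // inE.
by rewrite (Mho_p_elt 1) ?orbT // (mem_p_elt pA).
Qed.

End PCentral.

Section Dimension.
Context (K : fieldType) (p : nat) (charK : p \in [pchar K]) (R : algType K).
Context (gT : finGroupType) (u : gT -> R).
Hypothesis u1 : u 1%g = 1.
Hypothesis uM : {morph u : x y / (x * y)%g >-> x * y}.
Context (Gam : nat -> {group gT}).
Hypothesis Gam0 : Gam 0 = [set: gT]%G.
Hypothesis Gam1 : Gam 1 = [set: gT]%G.
Hypothesis GamR : forall a b x y, x \in Gam a -> y \in Gam b ->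
  [~ x, y]%g \in Gam (a + b).+1.
Hypothesis GamS : forall m, Gam m.+1 \subset Gam m.
Context (c : nat).
Hypothesis Gamc : Gam c = 1%G.
Hypothesis pT : (p.-group [set: gT])%g.
Hypothesis u_inj : injective u.
Hypothesis norm_neq0 : \sum_x u x != 0.

Local Notation filt := (filt u Gam).

Let p_pr : prime p. Proof. by case/andP: charK. Qed.

Lemma Gam_le i k : (i <= k)%N -> Gam k \subset Gam i.
Proof.
move/subnKC <-; elim: (k - i)%N => [|d IH]; first by rewrite addn0.
by rewrite addnS; apply: subset_trans IH; apply: GamS.
Qed.

Definition dim_set m := [set x | `[< filt m (u x - 1) >]].

Lemma dim_group_set m : group_set (dim_set m).
Proof.
apply/group_setP; split=> [|x y].
  by rewrite inE; apply/asboolP; rewrite u1 subrr; apply: filt0.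
rewrite !inE => /asboolP fx /asboolP fy; apply/asboolP.
rewrite uM (_ : _ - 1 = (u x - 1) * u y + (u y - 1)); last first.
  by rewrite mulrBl mul1r addrA subrK.
by apply: filtD => //; apply: filtMr => //; apply: filt_unit.
Qed.

Canonical dim m := Group (dim_group_set m).

Lemma dimP m x : reflect (filt m (u x - 1)) (x \in dim m).
Proof. by rewrite inE; apply: asboolP. Qed.

Lemma Gam_dim m : Gam m \subset dim m.
Proof. by apply/subsetP => x Gx; apply/dimP; apply: filtU. Qed.

Lemma dim_le i k : (i <= k)%N -> dim k \subset dim i.
Proof.
by move=> le_ik; apply/subsetP => x /dimP fx; apply/dimP; apply: filtW fx.
Qed.

Lemma dim1 : dim 1 = [set: gT]%G.
Proof.
by have := Gam_dim 1; rewrite Gam1 subTset => /eqP/group_inj.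
Qed.

Lemma dim0 : dim 0 = [set: gT]%G.
Proof.
by have := Gam_dim 0; rewrite Gam0 subTset => /eqP/group_inj.
Qed.

Lemma dimR a b x y : x \in dim a -> y \in dim b ->
  [~ x, y]%g \in dim (a + b).+1.
Proof.
move=> /dimP fx /dimP fy; apply/dimP.
have -> : u [~ x, y]%g - 1 = u (y * x)^-1%g * (u x * u y - u y * u x).
  rewrite u_comm // mulrA u_invl // mul1r //.
apply: filtMl; first exact: filt_unit.
have -> : u x * u y - u y * u x =
    (u x - 1) * (u y - 1) - (u y - 1) * (u x - 1).
  by rewrite comm_subl1 -[RHS]opprB comm_subl1 opprB.
exact: filt_comm.
Qed.

Lemma dimX a x : x \in dim a -> (x ^+ p)%g \in dim (p * a).
Proof.
by move=> /dimP fx; apply/dimP; rewrite -(usub1_expp charK) //; apply: filtX.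
Qed.

(** The exponent-p central series is stretched logarithmically. With b >= p and b >= c, neither
    adding two degrees nor multiplying one by p raises [trunc_log b] of the larger by more than 1,
    while a central step or a p-th power moves one term down. Degrees below b give the whole group,
    and from b on [Gam] is trivial. *)
Lemma initial_series : exists S M, good_series p Gam S M.
Proof.
have [P [r [P0 Pr PS]]] := pcentral_series pT (normal_refl [set: gT]).
have Ple i k : (i <= k)%N -> P k \subset P i.
  move/subnKC <-; elim: (k - i)%N => [|d IH]; first by rewrite addn0.
  by rewrite addnS; apply: subset_trans IH; case: (PS (i + d)%N).
have p_gt1 := prime_gt1 p_pr.
pose b := maxn p c; have b_gt1 : (1 < b)%N by rewrite leq_max p_gt1.
have le_pb : (p <= b)%N by apply: leq_maxl.
have log_mul n m : (0 < m)%N -> (n <= b * m)%N ->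
    (trunc_log b n <= (trunc_log b m).+1)%N.
  move=> m_gt0 le_n; rewrite -(trunc_logMp b_gt1 m_gt0).
  exact: leq_trunc_log.
have logR n k : (0 < n)%N -> (n <= k)%N ->
    (trunc_log b (n + k) <= (trunc_log b k).+1)%N.
  by move=> n_gt0 le_nk; apply: log_mul; nia.
exists (fun m => P (trunc_log b m)), (b ^ r)%N; split.
- by rewrite trunc_log0 trunc_log1 P0.
- move=> m; split; first by apply: Ple; apply: leq_trunc_log.
  have [lt_mb|le_bm] := ltnP m b.
    suff -> : trunc_log b m = 0%N by rewrite P0 subsetT.
    by apply/eqP; rewrite trunc_log_eq0; apply/orP; right; lia.
  suff -> : Gam m = 1%G by apply: sub1G.
  apply/group_inj/trivgP; rewrite -[1%g]/(gval 1%G) -Gamc; apply: Gam_le.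
  by apply: leq_trans le_bm; apply: leq_maxr.
- move=> n k x y xP yP.
  have [->|n_gt0] := posnP n.
    rewrite add0n -invgR groupV.
    by case: (PS (trunc_log b k)) => + + _ => /subsetP + H; apply; apply: H.
  have [->|k_gt0] := posnP k.
    rewrite addn0.
    by case: (PS (trunc_log b n)) => + + _ => /subsetP + H; apply; apply: H.
  have [le_nk|/ltnW le_kn] := leqP n k.
    rewrite -invgR groupV; apply: (subsetP (Ple _ _ (logR _ _ n_gt0 le_nk))).
    by case: (PS (trunc_log b k)) => _ + _; apply.
  rewrite addnC; apply: (subsetP (Ple _ _ (logR _ _ k_gt0 le_kn))).
  by case: (PS (trunc_log b n)) => _ + _; apply.
- move=> n x xP; have [->|n_gt0] := posnP n.
    by rewrite muln0 trunc_log0 P0 inE.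
  have le_log : (trunc_log b (p * n) <= (trunc_log b n).+1)%N.
    by apply: log_mul => //; rewrite leq_mul2r le_pb orbT.
  apply: (subsetP (Ple _ _ le_log)).
  by case: (PS (trunc_log b n)) => _ _; apply.
- by rewrite expn_gt0 (ltnW b_gt1) trunc_expnK.
Qed.

(** Any good series bounds the degrees of nonzero elements; beyond that bound [u x = 1]. *)
Lemma dim_trivial : exists2 M, (0 < M)%N & dim M = 1%G.
Proof.
have [S [M goodS]] := initial_series.
exists (p.-1 * series_weight p S M).+1 => //.
apply/group_inj/trivgP/subsetP => x /dimP fx.
have /eqP := filt_vanish charK u1 uM goodS pT (ltnSn _) fx.
by rewrite subr_eq0 -u1 => /eqP/u_inj->; rewrite inE.
Qed.

Lemma dim_good M : (0 < M)%N -> dim M = 1%G -> good_series p Gam dim M.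
Proof.
move=> M_gt0 dimM; split=> // [|m|a b x y xD yD|a x].
- by rewrite dim0 dim1.
- by rewrite Gam_dim dim_le.
- by apply: (subsetP (dim_le (leqnSn _))); apply: dimR.
- exact: dimX.
Qed.

Lemma dim_norm M : (0 < M)%N -> dim M = 1%G ->
  filt (p.-1 * series_weight p dim M) (\sum_x u x).
Proof.
move=> M_gt0 dimM; apply: (filt_norm charK u1 uM (dim_good M_gt0 dimM) pT).
by move=> w x /dimP.
Qed.

(* If H were smaller than dim m, replacing dim m by H would yield a series of
   smaller weight, hence too low a degree for the nonzero element
   \sum_x u x. *)
Lemma dim_min m (H : {group gT}) : (0 < m)%N ->
    Gam m \subset H -> dim m.+1 \subset H -> H \subset dim m ->
    (forall k x, (p * k)%N = m -> x \in dim k -> (x ^+ p)%g \in H) ->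
  H = dim m.
Proof.
move=> m_gt0 sGH sDH sHD powH; apply/group_inj/eqP; rewrite eqEcard sHD /=.
rewrite leqNgt; apply/negP => ltHD.
have [M M_gt0 dimM] := dim_trivial.
have lt_mM : (m < M)%N.
  rewrite ltnNge; apply/negP => le_Mm; move: ltHD.
  have sD1 : dim m \subset 1%G by rewrite -dimM dim_le.
  apply/negP; rewrite -leqNgt; apply: leq_trans (subset_leq_card sD1) _.
  by rewrite cards1 cardG_gt0.
pose S i := if i == m then H else dim i.
have SD i : S i \subset dim i by rewrite /S; case: eqP => [->|].
have DS i : dim i.+1 \subset S i by rewrite /S; case: eqP => [->|_] //; apply: dim_le.
have m_neq1 : m != 1%N.
  apply/eqP => m1; move: ltHD; rewrite ltnNge subset_leq_card //.
  by apply: subset_trans (subsetT _) _; rewrite m1 Gam1 in sGH.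
have goodS : good_series p Gam S M.
  split.
  - by rewrite /S eq_sym (gtn_eqF m_gt0) eq_sym (negbTE m_neq1) dim0 dim1.
  - move=> i; split; first exact: subset_trans (SD _) (DS _).
    by rewrite /S; case: eqP => [->|_] //; apply: Gam_dim.
  - move=> a b x y /(subsetP (SD _)) xD /(subsetP (SD _)) yD.
    by apply: (subsetP (DS _)); apply: dimR.
  - move=> a x /(subsetP (SD _)) xD; rewrite /S; case: eqP => [pam|_].
      exact: powH xD.
    exact: dimX.
  - by rewrite /S (gtn_eqF lt_mM) dimM.
case/eqP: norm_neq0; apply: (filt_vanish charK u1 uM goodS pT _ (dim_norm M_gt0 dimM)).
rewrite ltn_mul2l -ltnS prednK ?prime_gt0 // prime_gt1 //=.
have m_in : m \in index_iota 1 M by rewrite mem_index_iota m_gt0.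
rewrite /series_weight (bigD1_seq m) ?iota_uniq //=.
rewrite [X in (_ < X)%N](bigD1_seq m) ?iota_uniq //= /S eqxx -addSn.
apply: leq_add.
  have pX (X : {group gT}) : (p.-group X)%g := pgroupS (subsetT _) pT.
  by rewrite -(ltn_exp2l _ _ (prime_gt1 p_pr)) -!card_pgroup.
by apply: leq_sum => i /negbTE->.
Qed.

Lemma dim_degree : exists M, [/\ (0 < M)%N, dim M = 1%G,
  filt (p.-1 * series_weight p dim M) (\sum_x u x) &
  forall f, filt (p.-1 * series_weight p dim M).+1 f -> f = 0].
Proof.
have [M M_gt0 dimM] := dim_trivial; exists M; split=> // [|f].
  exact: dim_norm.
exact: (filt_vanish charK u1 uM (dim_good M_gt0 dimM) pT (ltnSn _)).
Qed.

(** * Operators on the filtration, later conjugation by elements of G *)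

Section Action.
Context (I : Type) (al : I -> gT -> gT) (be : I -> R -> R).
Hypothesis beD : forall i, {morph be i : x y / x + y}.
Hypothesis beZ : forall i k, {morph be i : x / k *: x}.
Hypothesis beM : forall i, {morph be i : x y / x * y}.
Hypothesis be1 : forall i, be i 1 = 1.
Hypothesis beu : forall i x, be i (u x) = u (al i x).
Hypothesis Gam_act : forall i m x, x \in Gam m -> (x^-1 * al i x)%g \in Gam m.+1.
Hypothesis Gam_gen : forall m (H : {group gT}), (0 < m)%N ->
  (forall i x, x \in Gam m -> x^-1 * al i x \in H)%g -> Gam m.+1 \subset H.

(** The operator analogue of [filt_comm]: the gain of one degree on [u x - 1] comes from [Gam_act],
    and it passes to products since only one factor changes at a time. *)
Lemma filt_act i m f : filt m f -> filt m.+1 (be i f - f).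
Proof.
elim=> {m f}.
- by rewrite be1 subrr; apply: filt0.
- move=> w x Gx; have -> : be i (u x - 1) - (u x - 1) =
      u x * (u (x^-1 * al i x)%g - 1).
    rewrite beD -scaleN1r beZ be1 scaleN1r beu opprB addrA subrK.
    by rewrite mulrBr mulr1 -uM mulKVg.
  apply: filtMl; first exact: filt_unit.
  by apply: filtU; apply: Gam_act.
- move=> m; rewrite -[X in be i X](scale0r (0 : R)) beZ scale0r subrr.
  exact: filt0.
- by move=> m x y _ Fx _ Fy; rewrite beD opprD addrACA; apply: filtD.
- by move=> m k x _ Fx; rewrite beZ -scalerBr; apply: filtZ.
- move=> a b x y fx Fx fy Fy; rewrite beM.
  have -> : be i x * be i y - x * y = (be i x - x) * be i y + x * (be i y - y).
    by rewrite mulrBl mulrBr addrA subrK.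
  apply: filtD; last by rewrite -addnS; apply: filtM.
  rewrite -addSn; apply: filtM => //.
  by rewrite -[be i y](subrK y); apply: filtD => //; apply: filtW Fy.
- by move=> m k x le_mk _ Fx; apply: filtW Fx.
Qed.

Lemma filt_be i m f : filt m f -> filt m (be i f).
Proof.
move=> Ff; rewrite -[be i f](subrK f); apply: filtD => //.
by apply: filtW (filt_act i Ff).
Qed.

Lemma dim_act i m x : x \in dim m -> (x^-1 * al i x)%g \in dim m.+1.
Proof.
move=> /dimP Fx; apply/dimP; have := filt_act i Fx.
rewrite beD -scaleN1r beZ be1 scaleN1r beu opprB addrA subrK => Fb.
have -> : u (x^-1 * al i x)%g - 1 = u x^-1%g * (u (al i x) - u x).
  by rewrite mulrBr -!uM mulVg u1.
by apply: filtMl => //; apply: filt_unit.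
Qed.

(** Once a term of the lower central series is deeper than its own degree, so are all later terms,
    because they arise by applying operators. *)
Lemma Gam_dim_up m : (0 < m)%N ->
  Gam m \subset dim m.+1 -> Gam m.+1 \subset dim m.+2.
Proof.
move=> m_gt0 /subsetP sGD; apply: Gam_gen => // i x /sGD.
exact: dim_act.
Qed.

Let pX (X : {group gT}) : (p.-group X)%g := pgroupS (subsetT _) pT.

Lemma dim_log_lt m :
  (logn p #|dim m.+1| < logn p #|dim m|)%N = (dim m.+1 \proper dim m).
Proof.
rewrite properEcard (dim_le (leqnSn m)) /=.
by rewrite -(ltn_exp2l _ _ (prime_gt1 p_pr)) -!card_pgroup.
Qed.

(** If [Gam m] lies in D_(m+1), then by [dim_min] a drop at m is due to p-th powers from D_k with p
    k = m; without a drop at k these would have degree p (k + 1) > m. If it does not, [Gam_dim_up]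
    read backwards shows that no [Gam i] with i <= m lies in D_(i+1), so every such i is a drop. *)
Lemma dim_closed m : (0 < m)%N -> dim m.+1 \proper dim m ->
  (forall i, (0 < i <= m)%N -> dim i.+1 \proper dim i) \/
  (exists2 k, m = (p * k)%N & dim k.+1 \proper dim k).
Proof.
move=> m_gt0 ltDm; have [sGD|nsGD] := boolP (Gam m \subset dim m.+1).
  have [/andP[/dvdnP[k eq_k] ltD]|noK] :=
      boolP ((p %| m)%N && (dim (m %/ p)%N.+1 \proper dim (m %/ p)%N)).
    right; exists k; first by rewrite eq_k mulnC.
    by move: ltD; rewrite eq_k mulnK // prime_gt0.
  move: ltDm; rewrite -(dim_min m_gt0 sGD (subxx _)) ?properxx //.
    exact: dim_le.
  move=> k x eq_k xD; move: noK.
  rewrite -eq_k dvdn_mulr // mulKn ?prime_gt0 // properEneq.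
  rewrite (dim_le (leqnSn k)) andbT negbK => /eqP eqD.
  rewrite -eqD in xD; apply: subsetP (dimX xD).
  by apply: dim_le; rewrite mulnS addnC -ltn_subLR ?subnn ?prime_gt0 // leq_addr.
left; have nsG i : (0 < i <= m)%N -> ~~ (Gam i \subset dim i.+1).
  case/andP=> i_gt0 /subnKC eq_m; apply: contra nsGD; rewrite -eq_m.
  elim: (m - i)%N => [|d IH] sG; first by rewrite addn0.
  by rewrite addnS; apply: Gam_dim_up; [rewrite addn_gt0 i_gt0|apply: IH].
move=> i i_in; rewrite properE (dim_le (leqnSn i)) /=.
apply: contra (nsG i i_in); apply: subset_trans; exact: Gam_dim.
Qed.

End Action.

End Dimension.

Local Close Scope ring_scope.

(** * The upper Lie powers of a group algebra *)

Section FinSubgroup.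
Context (G : groupType) (A : {fset G}) (gA : group_closed (mem A)).
(** The closure proof is a parameter of the alias, so that the finite type can carry a group
    structure depending on it. *)
Definition finsubgroup of group_closed (mem A) : Type := fset_sub_type A.
Local Notation H := (finsubgroup gA).
HB.instance Definition _ := SubType.on H.
HB.instance Definition _ := Finite.on H.
HB.instance Definition _ := SubChoice_isSubGroup.Build G _ H gA.
End FinSubgroup.

Local Open Scope ring_scope.

Lemma conj_mul (R : nzRingType) (u v x y : R) :
  u * v = 1 -> v * (x * y) * u = v * x * u * (v * y * u).
Proof. by move=> uv; rewrite !mulrA -(mulrA _ u v) uv mulr1. Qed.

Section LiePowers.
Context (R : nzRingType).
Local Notation I m := (upper_lie_power R m.+1).

Lemma two_sided_setT : two_sided_ideal (@classical_sets.setT R).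
Proof. by []. Qed.

Lemma ideal_genP (A : set R) : two_sided_ideal (ideal_gen A).
Proof.
split=> [B [[]]//|x y Ax Ay B AB|r x Ax].
  by have [[_ BD _] _] := AB; apply: BD; [apply: Ax|apply: Ay].
by split=> B AB; have [[_ _ BM] _] := AB; case: (BM r x (Ax _ AB)).
Qed.

Lemma lie_power_ideal m : two_sided_ideal (I m).
Proof. by case: m => [|m]; [exact: two_sided_setT|exact: ideal_genP]. Qed.

Lemma lie_power0 m : I m 0. Proof. by case: (lie_power_ideal m). Qed.

Lemma lie_powerD m x y : I m x -> I m y -> I m (x + y).
Proof. by case: (lie_power_ideal m) => _ + _; apply. Qed.

Lemma lie_powerMl m r x : I m x -> I m (r * x).
Proof. by case: (lie_power_ideal m) => _ _ + Ix => /(_ r x Ix)[]. Qed.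

Lemma lie_powerMr m r x : I m x -> I m (x * r).
Proof. by case: (lie_power_ideal m) => _ _ + Ix => /(_ r x Ix)[]. Qed.

Lemma lie_powerN m x : I m x -> I m (- x).
Proof. by rewrite -mulN1r; apply: lie_powerMl. Qed.

Lemma lie_powerB m x y : I m x -> I m y -> I m (x - y).
Proof. by move=> Ix Iy; apply: lie_powerD => //; apply: lie_powerN. Qed.

Lemma lie_power_comm m x y : I m x -> I m.+1 (x * y - y * x).
Proof. by move=> Ix B [_]; apply; exists x => //; exists y. Qed.

Lemma lie_power_min m (J : set R) : two_sided_ideal J ->
  (forall x y, I m x -> J (x * y - y * x)) -> forall x, I m.+1 x -> J x.
Proof.
move=> idJ commJ x; apply; split=> // _ [y Iy [z _ <-]]; exact: commJ.
Qed.

Lemma lie_powerS m x : I m.+1 x -> I m x.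
Proof.
apply: (lie_power_min (lie_power_ideal m)) => {}x y Ix.
by apply: lie_powerB; [apply: lie_powerMr|apply: lie_powerMl].
Qed.

Lemma lie_power_le i k x : (i <= k)%N -> I k x -> I i x.
Proof.
move/subnKC <-; elim: (k - i)%N => [|d IH]; first by rewrite addn0.
by rewrite addnS => /lie_powerS.
Qed.

(** Induction on [b] over the generators of the ideal, through t [y, z] = [t y, z] - [t, z] y. The
    degrees add because [I m] is shifted by one against the index of the Lie power. *)
Lemma lie_powerM a b x y : I a x -> I b y -> I (a + b) (x * y).
Proof.
elim: b a x y => [|b IH] a x y Ix Iy; first by rewrite addn0; apply: lie_powerMr.
pose J y := forall a x, I a x -> I (a + b.+1) (x * y).
suff: J y by apply.
move: y Iy; apply: lie_power_min => [|y z Iy c t It].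
  split=> [c t It|y z Jy Jz c t It|r y Jy].
  - by rewrite mulr0; apply: lie_power0.
  - by rewrite mulrDr; apply: lie_powerD; [apply: Jy|apply: Jz].
  - split=> c t It; rewrite mulrA; first by apply: Jy; apply: lie_powerMr.
    by apply: lie_powerMr; apply: Jy.
have -> : t * (y * z - z * y) = (t * y * z - z * (t * y)) - (t * z - z * t) * y.
  by rewrite lieMl addrK.
apply: lie_powerB; first by rewrite addnS; apply: lie_power_comm; apply: IH.
by rewrite addnS -addSn; apply: IH => //; apply: lie_power_comm.
Qed.

End LiePowers.

Section GroupRing.
Context (K : fieldType) (G : groupType).
Local Notation KG := (grpalg K G).

Definition gaU (g : G) : KG := (<< g >>)%M.

Lemma gaU1 : gaU 1%g = 1. Proof. by []. Qed.

Lemma gaUM : {morph gaU : x y / (x * y)%g >-> x * y}.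
Proof. by move=> x y; rewrite [RHS]gamulUU mulr1. Qed.

Lemma gaU_ind (P : KG -> Prop) :
    P 0 -> (forall x y, P x -> P y -> P (x + y)) ->
    (forall k g, P (k *: gaU g)) ->
  forall x, P x.
Proof.
move=> P0 PD PU x; rewrite [x]monalgE.
elim/big_ind: _ => // g _; have -> : << x@_g *g g >> = x@_g *: gaU g by
  rewrite gascaleEl [RHS]gamulUU mulr1 mul1g.
exact: PU.
Qed.

Lemma gaU_inj : injective gaU.
Proof.
move=> x y /(congr1 (fun a : {malg K[G]} => a@_y)); rewrite !mcoeffU eqxx.
by case: eqP => // _ /eqP; rewrite eq_sym oner_eq0.
Qed.

Lemma gaU_sum_neq0 (I : finType) (h : I -> G) (i : I) : injective h ->
  \sum_i gaU (h i) != 0.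
Proof.
move=> h_inj; apply/eqP => /(congr1 (fun a : {malg K[G]} => a@_(h i))).
rewrite mcoeff0 raddf_sum (bigD1 i) //= mcoeffU eqxx big1 ?addr0 => [|k nki].
  by move/eqP; rewrite oner_eq0.
by rewrite mcoeffU (inj_eq h_inj) (negbTE nki).
Qed.

End GroupRing.

(** * The commutator subgroup as a finite group with operators from G *)

Section Preimages.
Context (G : groupType) (gT : finGroupType) (j : gT -> G).
Hypothesis jM : {morph j : x y / (x * y)%g}.

Definition preG (A : set G) : {set gT} := [set x | `[< A (j x) >]].

Lemma preGP (A : set G) x : reflect (A (j x)) (x \in preG A).
Proof. by rewrite inE; apply: asboolP. Qed.

Lemma j1 : j 1%g = 1%g.
Proof. by apply: (mulgI (j 1%g)); rewrite -jM !mulg1. Qed.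

Lemma jV x : j x^-1%g = (j x)^-1%g.
Proof. by apply: (mulgI (j x)); rewrite -jM !mulgV j1. Qed.

Lemma jX x m : j (x ^+ m)%g = (j x ^+ m)%g.
Proof. by elim: m => [|m IH]; rewrite ?expg0 ?j1 // !expgS jM IH. Qed.

Lemma jR x y : j [~ x, y]%g = [~ j x, j y]%g.
Proof. by rewrite !(commg_def, conjg_def) !(jM, jV). Qed.

Lemma preG_group_set A : subgroup A -> group_set (preG A).
Proof.
case=> A1 AM _; apply/group_setP; split=> [|x y /preGP Ax /preGP Ay].
  by apply/preGP; rewrite j1.
by apply/preGP; rewrite jM; apply: AM.
Qed.

Definition preG_group A (gA : subgroup A) : {group gT} :=
  Group (preG_group_set gA).

(* gamma_{m+1}(G) seen in gT; the index 0 is treated as 1. *)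
Definition gam m : {group gT} := preG_group (lcs_subgroup G (maxn m 1).+1).

Lemma gamP m x : reflect (lcs G (maxn m 1).+1 (j x)) (x \in gam m).
Proof. exact: preGP. Qed.

Hypothesis jI : injective j.
Hypothesis jE : forall g, lcs G 2 g <-> exists x, j x = g.

Lemma gam0 : gam 0 = [set: gT]%G.
Proof.
apply/group_inj/eqP; rewrite -subTset; apply/subsetP => x _.
by apply/gamP/jE; exists x.
Qed.

Lemma gam1 : gam 1 = [set: gT]%G. Proof. exact: gam0. Qed.

Lemma gamR a b x y : x \in gam a -> y \in gam b -> [~ x, y]%g \in gam (a + b).+1.
Proof.
move=> /gamP Ax /gamP By; apply/gamP; rewrite jR.
apply: lcs_le (lcs_commg Ax By); lia.
Qed.

Lemma gamS m : gam m.+1 \subset gam m.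
Proof. by apply/subsetP => x /gamP Ax; apply/gamP; apply: lcs_le Ax; lia. Qed.

Lemma gam_nil : nilpotent_group G -> exists c, gam c = 1%G.
Proof.
move=> [c nilc]; exists c; apply/group_inj/trivgP/subsetP => x /gamP Ax.
have : lcs G c.+1 (j x) by apply: lcs_le Ax; lia.
by rewrite nilc => jx; rewrite inE; apply/eqP/jI; rewrite j1.
Qed.

Lemma gam_le i k : (i <= k)%N -> gam k \subset gam i.
Proof. exact: Gam_le gamS _ _. Qed.

Lemma gam_strict i : nilpotent_group G -> (0 < i)%N -> gam i != 1%G -> gam i.+1 \proper gam i.
Proof.
move=> nilG i_gt0; apply: contraR.
rewrite properEneq gamS andbT negbK => /eqP eq_gam.
suff lcs1 : lcs G i.+1 = [set 1%g]%classic.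
  apply/eqP/group_inj/trivgP/subsetP => x /gamP.
  have -> : (maxn i 1).+1 = i.+1 by lia.
  by rewrite lcs1 => jx; rewrite inE; apply/eqP/jI; rewrite j1.
apply: lcsS_id nilG _; apply/seteqP; split=> g; first exact: lcsSS.
move=> Ag; have [x jx] : exists x, j x = g by apply/jE; apply: lcs_le Ag.
have : x \in gam i.
  by apply/gamP; rewrite jx; have -> : (maxn i 1).+1 = i.+1 by lia.
rewrite -eq_gam.
by move=> /gamP; rewrite jx; have -> : (maxn i.+1 1).+1 = i.+2 by lia.
Qed.

(** The default 1 is never taken: G' is normal in G, so the conjugate has a preimage. *)
Definition conj_pre (g : G) (x : gT) : gT :=
  odflt 1%g [pick y | j y == (j x ^ g)%g].

Lemma conj_preE g x : j (conj_pre g x) = (j x ^ g)%g.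
Proof.
rewrite /conj_pre; case: pickP => [y /eqP//|noy].
have [y jy] : exists y, j y = (j x ^ g)%g.
  by apply/jE; apply: lcs_conj; apply/jE; exists x.
by have := noy y; rewrite jy eqxx.
Qed.

Lemma conj_pre_comm g x : j (x^-1 * conj_pre g x)%g = [~ j x, g]%g.
Proof. by rewrite jM jV conj_preE. Qed.

Lemma gam_act g m x : x \in gam m -> (x^-1 * conj_pre g x)%g \in gam m.+1.
Proof.
move=> /gamP Ax; apply/gamP; rewrite conj_pre_comm.
by apply: lcs_le (lcsS_comm g Ax); lia.
Qed.

(** The commutators range over all g in G, not just in G'; hence operators, rather than commutators
    inside [gT], generate the next term. *)
Lemma gam_gen m (H : {group gT}) : (0 < m)%N ->
  (forall g x, x \in gam m -> x^-1 * conj_pre g x \in H)%g -> gam m.+1 \subset H.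
Proof.
move=> m_gt0 genH; apply/subsetP => x /gamP.
have -> : (maxn m.+1 1).+1 = m.+2 by lia.
suff sAH : forall g, lcs G m.+2 g -> exists2 y, y \in H & j y = g.
  by move=> /sAH[y yH /jI <-].
apply: (@lcsS_min _ _ (fun g => exists2 y, y \in H & j y = g)).
  split=> [|_ _ [y yH <-] [z zH <-]|_ [y yH <-]].
  - by exists 1%g; rewrite ?group1 ?j1.
  - by exists (y * z)%g; rewrite ?groupM ?jM.
  - by exists y^-1%g; rewrite ?groupV ?jV.
move=> y g Ay; have [z jz] : exists z, j z = y.
  by apply/jE; apply: lcs_le Ay.
exists (z^-1 * conj_pre g z)%g; last by rewrite conj_pre_comm jz.
apply: genH; apply/gamP; rewrite jz; have -> // : maxn m 1 = m by lia.
Qed.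

(** * Upper Lie powers of KG from the filtration of the commutator subgroup *)

Section Index.
Context (K : fieldType) (p : nat) (charK : p \in [pchar K]).
Hypothesis nilG : nilpotent_group G.
Hypothesis pT : (p.-group [set: gT])%g.
Local Notation KG := (grpalg K G).
Local Notation I m := (upper_lie_power KG m.+1).
Local Notation U := (@gaU K G).

Definition preU (x : gT) : KG := U (j x).
Local Notation filt := (filt preU gam).

Lemma preU1 : preU 1%g = 1. Proof. by rewrite /preU j1. Qed.

Lemma preUM : {morph preU : x y / (x * y)%g >-> x * y}.
Proof. by move=> x y; rewrite /preU jM gaUM. Qed.

Lemma preU_inj : injective preU.
Proof. by move=> x y /gaU_inj/jI. Qed.

Lemma preU_norm : \sum_x preU x != 0.
Proof. exact: gaU_sum_neq0 1%g jI. Qed.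

Definition conjU (g : G) (f : KG) : KG := U g^-1%g * f * U g.

Lemma U_inv g : U g * U g^-1%g = 1. Proof. by rewrite -gaUM mulgV. Qed.
Lemma U_invl g : U g^-1%g * U g = 1. Proof. by rewrite -gaUM mulVg. Qed.

Lemma conjUD g : {morph conjU g : x y / x + y}.
Proof. by move=> x y; rewrite /conjU mulrDr mulrDl. Qed.

Lemma conjUZ g k : {morph conjU g : x / k *: x}.
Proof. by move=> x; rewrite /conjU -scalerAr -scalerAl. Qed.

Lemma conjUM g : {morph conjU g : x y / x * y}.
Proof. by move=> x y; rewrite /conjU (conj_mul _ _ (U_inv g)). Qed.

Lemma conjU1 g : conjU g 1 = 1.
Proof. by rewrite /conjU mulr1 U_invl. Qed.

Lemma conjU_pre g x : conjU g (preU x) = preU (conj_pre g x).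
Proof. by rewrite /conjU /preU conj_preE -!gaUM conjg_def mulgA. Qed.

Lemma U_comm (x y : G) :
  U x * U y - U y * U x = U (y * x)%g * (U [~ x, y]%g - 1).
Proof. by rewrite mulrBr mulr1 -!gaUM -commgC. Qed.

Lemma lcs_lie m g : lcs G m.+1 g -> I m (U g - 1).
Proof.
elim: m g => [//|m IH] g.
have gA : subgroup (fun g => I m.+1 (U g - 1)).
  split=> [|x y Ix Iy|x Ix].
  - by rewrite gaU1 subrr; apply: lie_power0.
  - have -> : U (x * y)%g - 1 = (U x - 1) * U y + (U y - 1).
      by rewrite gaUM mulrBl mul1r addrA subrK.
    by apply: lie_powerD => //; apply: lie_powerMr.
  - have -> : U x^-1%g - 1 = - (U x^-1%g * (U x - 1)).
      by rewrite mulrBr mulr1 U_invl opprB.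
    by apply: lie_powerN; apply: lie_powerMl.
move: g; apply: (lcsS_min gA) => x y /IH Ix.
have -> : U [~ x, y]%g - 1 = U (y * x)^-1%g * (U x * U y - U y * U x).
  by rewrite U_comm mulrA U_invl mul1r.
by apply: lie_powerMl; rewrite -comm_subl1; apply: lie_power_comm.
Qed.

Lemma filt_lie m f : filt m f -> I m f.
Proof.
elim=> {m f} //.
- move=> w x /gamP Gx; apply: (lie_power_le (k := maxn w 1)); first by lia.
  exact: lcs_lie.
- by move=> m; apply: lie_power0.
- by move=> m x y _ Ix _ Iy; apply: lie_powerD.
- by move=> m k x _ Ix; rewrite gascaleEl; apply: lie_powerMl.
- by move=> a b x y _ Ix _ Iy; apply: lie_powerM.
- by move=> m k x le_mk _; apply: lie_power_le.
Qed.

(** The right ideal E_m KG. It will turn out to be two-sided and to contain KG^(m+1). *)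
Inductive filtKG (m : nat) : KG -> Prop :=
| filtKG0 : filtKG m 0
| filtKGD x y : filtKG m x -> filtKG m y -> filtKG m (x + y)
| filtKGM e r : filt m e -> filtKG m (e * r).

Lemma filtKGMr m r f : filtKG m f -> filtKG m (f * r).
Proof.
elim=> [|x y _ Fx _ Fy|e s Fe].
- by rewrite mul0r; apply: filtKG0.
- by rewrite mulrDl; apply: filtKGD.
- by rewrite -mulrA; apply: filtKGM.
Qed.

Lemma filtKGZ m k f : filtKG m f -> filtKG m (k *: f).
Proof. by rewrite gascaleEr; apply: filtKGMr. Qed.

Lemma filtKGMfilt a b e f : filt a e -> filtKG b f -> filtKG (a + b) (e * f).
Proof.
move=> Fe; elim=> [|x y _ Fx _ Fy|d s Fd].
- by rewrite mulr0; apply: filtKG0.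
- by rewrite mulrDr; apply: filtKGD.
- by rewrite mulrA; apply: filtKGM; apply: filtM.
Qed.

Lemma filt_conj g m f : filt m f -> filt m (conjU g f).
Proof.
exact: (filt_be preUM gam0 conjUD conjUZ conjUM conjU1 conjU_pre gam_act).
Qed.

(** A group element g passes an element e of E_m by g e = (g e g^-1) g, and E_m is stable under
    conjugation by G. *)
Lemma filtKGMl m r f : filtKG m f -> filtKG m (r * f).
Proof.
move=> Ff; move: r; apply: gaU_ind => [|x y Fx Fy|k g].
- by rewrite mul0r; apply: filtKG0.
- by rewrite mulrDl; apply: filtKGD.
rewrite -scalerAl; apply: filtKGZ; elim: Ff => [|x y _ Fx _ Fy|e s Fe].
- by rewrite mulr0; apply: filtKG0.
- by rewrite mulrDr; apply: filtKGD.
have -> : U g * (e * s) = conjU g^-1 e * (U g * s).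
  by rewrite /conjU invgK -!mulrA (mulrA (U g^-1%g)) U_invl mul1r.
by apply: filtKGM; apply: filt_conj.
Qed.

Lemma filtKG_ideal m : two_sided_ideal (filtKG m).
Proof.
split=> [|x y|r x Fx]; [exact: filtKG0|exact: filtKGD|].
by split; [apply: filtKGMl|apply: filtKGMr].
Qed.

Lemma filtKG1_comm r s : filtKG 1 (r * s - s * r).
Proof.
move: r s; apply: gaU_ind => [s|x y Fx Fy s|k g].
- by rewrite mul0r mulr0 subrr; apply: filtKG0.
- by rewrite lieDl; apply: filtKGD.
apply: gaU_ind => [|x y Fx Fy|l h].
- by rewrite mul0r mulr0 subrr; apply: filtKG0.
- by rewrite lieDr; apply: filtKGD.
rewrite -!scalerAl -!scalerAr scalerA (scalerA l) (mulrC l) -scalerBr.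
apply: filtKGZ; rewrite U_comm; apply: filtKGMl.
have [x jx] : exists x, j x = [~ g, h]%g.
  by apply/jE; apply: lcsS_comm.
rewrite -jx -[U _ - 1]mulr1; apply: filtKGM.
by apply: (@filtU _ _ _ preU gam 1 x); rewrite gam1 inE.
Qed.

(** In [e r, s] = e [r, s] + [e, s] r the first term gains a degree because [r, s] lies in E_1 KG,
    the second because conjugation by G changes e only by an element of E_(m+1). *)
Lemma filtKG_comm m f s : filtKG m f -> filtKG m.+1 (f * s - s * f).
Proof.
elim=> [|x y _ Fx _ Fy|e r Fe].
- by rewrite mul0r mulr0 subrr; apply: filtKG0.
- by rewrite lieDl; apply: filtKGD.
rewrite lieMl; apply: filtKGD.
  by rewrite -addn1; apply: filtKGMfilt => //; apply: filtKG1_comm.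
apply: filtKGMr; move: s; apply: gaU_ind => [|x y Fx Fy|k g].
- by rewrite mul0r mulr0 subrr; apply: filtKG0.
- by rewrite lieDr; apply: filtKGD.
rewrite -scalerAl -scalerAr -scalerBr; apply: filtKGZ.
have -> : e * U g - U g * e = U g * ((conjU g e - e) * 1).
  by rewrite mulr1 mulrBr /conjU !mulrA U_inv mul1r.
apply: filtKGMl; apply: filtKGM.
exact: (filt_act preUM gam0 conjUD conjUZ conjUM conjU1 conjU_pre gam_act).
Qed.

Lemma lie_filtKG m f : I m f -> filtKG m f.
Proof.
elim: m f => [f _|m IH].
  by rewrite -[f]mul1r; apply: filtKGM; apply: filt1.
apply: lie_power_min; first exact: filtKG_ideal.
by move=> x y /IH; apply: filtKG_comm.
Qed.

(** The element f survives in KG^(L+1), the Lie power matching E_L, whereas KG^(L+2) lies in E_(L+1)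
    KG = 0. *)
Lemma tL_eq L f : filt L f -> f != 0 -> (forall g, filt L.+1 g -> g = 0) ->
  tL KG = L.+2.
Proof.
move=> FLf f_neq0 FL0.
have vanL : lie_vanishes KG L.+2.
  split=> //; apply/seteqP; split=> x; last by move=> ->; apply: (@lie_power0 _ L.+1).
  move/lie_filtKG; elim=> [//|y z _ -> _ ->|e r /FL0->]; first by rewrite addr0.
  by rewrite mul0r.
rewrite /tL; case: pselect => [h|]; last by case; exists L.+2; apply/asboolP.
case: ex_minnP => m /asboolP[m_gt0 van_m] min_m.
apply/eqP; rewrite eqn_leq min_m; last exact/asboolP.
rewrite ltnNge; apply: contra f_neq0 => le_mL.
have : I m.-1 f by apply: filt_lie; apply: filtW FLf; lia.
by rewrite prednK // van_m => ->.
Qed.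

End Index.
End Preimages.

Local Close Scope ring_scope.

(** * The index in terms of three terms of the lower central series *)

Section PowerSubgroups.
Context (gT : finGroupType).
Local Open Scope group_scope.
Implicit Types (A B : {group gT}).

Definition powg (A : {set gT}) m : {group gT} := <<[set x ^+ m | x in A]>>%G.

Lemma mem_powg (A : {set gT}) m x : x \in A -> x ^+ m \in powg A m.
Proof. by move=> Ax; apply: mem_gen; apply: imset_f. Qed.

Lemma powg_sub (A : {set gT}) m B :
  (forall x, x \in A -> x ^+ m \in B) -> powg A m \subset B.
Proof.
by move=> AB; rewrite gen_subG; apply/subsetP => _ /imsetP[x Ax ->]; apply: AB.
Qed.

Lemma powgS A m : powg A m \subset A.
Proof. by apply: powg_sub => x Ax; apply: groupX. Qed.

Lemma powg_mono (A C : {set gT}) m : A \subset C -> powg A m \subset powg C m.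
Proof. by move/subsetP=> AC; apply: powg_sub => x /AC; apply: mem_powg. Qed.

Lemma powg_Phi (p : nat) A : p.-group A -> powg A p \subset 'Phi(A).
Proof.
move=> pA; apply: powg_sub => x Ax; rewrite /= (Phi_joing pA) mem_gen // inE.
by rewrite (Mho_p_elt 1) ?orbT // (mem_p_elt pA).
Qed.

Lemma powg_norm (A : {set gT}) m x : x \in 'N(A) -> x \in 'N(powg A m).
Proof.
move=> Nx; rewrite inE -genJ genS //; apply/subsetP => _ /imsetP[_ /imsetP[y Ay ->] ->].
by rewrite conjXg; apply: imset_f; rewrite memJ_norm.
Qed.

Lemma powg_cycle (x : gT) m : powg <[x]> m = <[x ^+ m]>%G.
Proof.
apply/group_inj/eqP; rewrite eqEsubset; apply/andP; split.
  by apply: powg_sub => _ /cycleP[i ->]; rewrite expgAC mem_cycle.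
by rewrite cycle_subG mem_powg // cycle_id.
Qed.

Lemma cyclic4_powg A : #|A| = 4 -> powg A 2 :!=: 1 -> cyclic A.
Proof.
move=> A4 ntA; have /existsP[x /andP[Ax x2]] : [exists x, (x \in A) && (x ^+ 2 != 1)].
  apply: contraR ntA; rewrite negb_exists => /forallP A2.
  apply/eqP/trivgP; apply: powg_sub => x Ax; have := A2 x.
  by rewrite Ax negbK inE.
apply/cyclicP; exists x; apply/eqP; rewrite eq_sym eqEcard cycle_subG Ax A4 /=.
have : #[x] %| 4 by rewrite -A4 order_dvdG.
have : ~~ (#[x] %| 2) by rewrite order_dvdn.
by rewrite -orderE; move: #[x] => k; case: k => [|[|[|[|]]]].
Qed.

Lemma cyclic4_powg_card A : cyclic A -> #|A| = 4 -> #|powg A 2| = 2.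
Proof.
move=> cA A4; have [x defA] := cyclicP cA.
by rewrite {1}defA powg_cycle /= -orderE orderXdiv orderE -defA A4.
Qed.

Lemma proper_cyclic4 A B : cyclic A -> #|A| = 4 -> B \proper A ->
  B \subset powg A 2.
Proof.
move=> cA A4 ltBA; have [x defA] := cyclicP cA.
have sPA : powg A 2 \subset A by apply: powgS.
rewrite -(cardSg_cyclic cA) // ?(proper_sub ltBA) //.
rewrite (cyclic4_powg_card cA A4).
have := cardSg (proper_sub ltBA); have := proper_card ltBA; rewrite A4.
by have := cardG_gt0 B; move: #|B| => k; case: k => [|[|[|[|]]]].
Qed.

End PowerSubgroups.

(** * The index 19 and the subgroup H *)

Section Criterion.
Local Open Scope ring_scope.
Context (G : groupType) (gT : finGroupType) (j : gT -> G).
Hypothesis jM : {morph j : x y / (x * y)%g}.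
Hypothesis jI : injective j.
Hypothesis jE : forall g, lcs G 2 g <-> exists x, j x = g.
Context (K : fieldType) (p : nat) (charK : p \in [pchar K]).
Hypothesis nilG : nilpotent_group G.
Context (n : nat) (cardT : #|[set: gT]| = (p ^ n)%N).
Local Notation gam := (gam jM).
Local Notation KG := (grpalg K G).
Local Notation filt := (filt (preU j K) gam).
Local Notation dim := (dim (preU1 jM K) (preUM jM K) (gam0 jM jE)).

(** This is H: [gam] is indexed by weight, so [gam 2] is gamma_3(G), and [gam 3] below is
    gamma_4(G). *)
Definition hgrp : {group gT} := (gam 2 <*> powg [set: gT] 2)%G.

Definition criterion :=
  [/\ #|hgrp| = 16%N, cyclic (powg hgrp 2), #|powg hgrp 2| = 4%N
    & gam 3 \subset powg hgrp 2].

Let p_pr : prime p. Proof. by case/andP: charK. Qed.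
Let pT : (p.-group [set: gT])%g.
Proof. by rewrite /pgroup cardT pnatX pnat_id // orbT. Qed.

Local Notation GU1 := (preU1 jM K).
Local Notation GUM := (preUM jM K).
Local Notation G0 := (gam0 jM jE).
Local Notation G1 := (gam1 jM jE).
Local Notation GI := (preU_inj jI (K := K)).
Local Notation GN := (preU_norm jI K).

Let dim_up m : (0 < m)%N -> gam m \subset dim m.+1 -> gam m.+1 \subset dim m.+2.
Proof.
exact: (Gam_dim_up (u1 := GU1) (uM := GUM) (Gam0 := G0) (@conjUD G K) (@conjUZ G K) (@conjUM G K) (@conjU1 G K) (conjU_pre jE K)
  (@gam_act _ _ _ jM jE) (@gam_gen _ _ _ jM jI jE)).
Qed.

Let dim_minimal m (H : {group gT}) : (0 < m)%N ->
    gam m \subset H -> dim m.+1 \subset H -> H \subset dim m ->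
    (forall k x, (p * k)%N = m -> x \in dim k -> (x ^+ p)%g \in H) ->
  H = dim m.
Proof.
have [c gamc] := gam_nil jM jI nilG.
exact: (dim_min charK (u1 := GU1) (uM := GUM) (Gam0 := G0) G1 (@gamR _ _ _ jM) (gamS jM) gamc pT GI GN).
Qed.

Lemma criterion_of_tL :
  (tL KG)%:Z = (p ^ n)%N%:Z - 14 * p%:Z + 15 -> [/\ p = 2%N, n = 5%N & criterion].
Proof.
have [c gamc] := gam_nil jM jI nilG.
have [M [M_gt0 dimM normF vanF]] :=
  dim_degree charK GU1 GUM G0 G1 (@gamR _ _ _ jM) (gamS jM) gamc pT GI GN.
have -> := tL_eq jE charK pT normF GN vanF => tL_E.
pose l i := logn p #|dim i|.
have l_le i k : (i <= k)%N -> dim k \subset dim i by apply: dim_le.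
have l1 : l 1%N = n.
  by rewrite /l (dim1 GU1 GUM G0 G1) cardT pfactorK.
have lS m : (l m.+1 <= l m)%N by rewrite dvdn_leq_log ?cardG_gt0 // cardSg ?l_le.
have lM : l M = 0%N by rewrite /l dimM cards1 logn1.
have l_closed m : (0 < m)%N -> (l m.+1 < l m)%N ->
    (forall i, 0 < i <= m -> l i.+1 < l i)%N \/
    (exists2 k, m = (p * k)%N & (l k.+1 < l k)%N).
  move=> m_gt0; rewrite (dim_log_lt charK GU1 GUM G0 pT) => ltD.
  have [alt|[k eq_k ltDk]] := dim_closed charK (u1 := GU1) (uM := GUM) (Gam0 := G0) G1 (@gamR _ _ _ jM) (gamS jM)
    gamc pT GI GN (@conjUD G K) (@conjUZ G K) (@conjUM G K) (@conjU1 G K) (conjU_pre jE K)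
    (@gam_act _ _ _ jM jE) (@gam_gen _ _ _ jM jI jE) m_gt0 ltD.
    by left=> i /alt; rewrite /l (dim_log_lt charK GU1 GUM G0 pT).
  by right; exists k; rewrite /l ?(dim_log_lt charK GU1 GUM G0 pT).
have l_sum : (p.-1 * (\sum_(1 <= i < M) l i) + 14 * p = p ^ n + 13)%N.
  by move: tL_E; rewrite /series_weight /l; lia.
have [p2 n5 l2 l3 [l4 l5 l8 l9]] :=
  series_classification p_pr l1 lS lM M_gt0 l_closed l_sum.
split=> //.
have cardD i : #|dim i| = (2 ^ l i)%N.
  by rewrite -p2 -card_pgroup // (pgroupS (subsetT _) pT).
have eqD i k : (i <= k)%N -> l i = l k -> dim k = dim i.
  move=> le_ik eq_l; apply/group_inj/eqP; rewrite eqEcard l_le //=.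
  by rewrite !cardD eq_l.
have half_inj k m : (2 * k = 2 * m)%N -> k = m by move/eqP; rewrite eqn_pmul2l // => /eqP.
have D34 : dim 4 = dim 3 by apply: eqD; rewrite // l3.
have D58 : dim 8 = dim 5 by apply: eqD; rewrite // l5.
have D9 : dim 9 = 1%G.
  by apply/group_inj/card1_trivg; rewrite cardD l9.
(* Since D_3 = D_4, gamma_4(G) is deeper than its degree, and hence so is every later term. In
   degrees 4 and 8 only squares then remain besides the next D_m. *)
have g3 : gam 3 \subset dim 4 by rewrite D34 Gam_dim.
have g4 := dim_up (isT : 0 < 3)%N g3; have g5 := dim_up (isT : 0 < 4)%N g4.
have g6 := dim_up (isT : 0 < 5)%N g5; have g7 := dim_up (isT : 0 < 6)%N g6.
have g8 : gam 8 \subset dim 9 by do 2?apply: dim_up.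
have eq8 : powg (dim 4) 2 = dim 8.
  apply: dim_minimal => //.
  - by apply: subset_trans g8 _; rewrite D9 sub1G.
  - by rewrite D9 sub1G.
  - by apply: powg_sub => x xD; move: (dimX charK xD); rewrite p2.
  - move=> k x; rewrite p2 => k8; have -> : k = 4%N by apply: half_inj.
    exact: mem_powg.
have p4 : (p.-group (dim 4))%g := pgroupS (subsetT _) pT.
have eq4 : (powg (dim 2) 2 <*> dim 5)%G = dim 4.
  apply: dim_minimal => //.
  - by apply: subset_trans g4 _; apply: joing_subr.
  - exact: joing_subr.
  - rewrite join_subG l_le // andbT.
    by apply: powg_sub => x xD; move: (dimX charK xD); rewrite p2.
  - move=> k x; rewrite p2 => k4; have -> : k = 2%N by apply: half_inj.
    by move=> xD; apply: (subsetP (joing_subl _ _)); apply: mem_powg.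
have Z4 : powg (dim 2) 2 = dim 4.
  apply/group_inj; rewrite -[LHS]genGid; apply: (@Phi_nongen _ (dim 4)).
  apply/eqP; rewrite eqEsubset join_subG Phi_sub /=.
  have -> : powg (dim 2) 2 \subset dim 4 by rewrite -eq4 joing_subl.
  have s45 : dim 4 \subset (powg (dim 2) 2 <*> dim 5)%G by rewrite eq4.
  apply: subset_trans s45 _; rewrite join_subG joing_subr /=.
  apply: subset_trans (joing_subl _ _).
  by move: (powg_Phi p4); rewrite p2 eq8 D58.
(* D_3 = D_4 is generated by squares, so H contains it and minimality of D_2 applies to H. *)
have sZH : dim 3 \subset hgrp.
  rewrite -D34 -Z4; apply: subset_trans (joing_subr _ _).
  exact/powg_mono/subsetT.
have eqH : hgrp = dim 2.
  apply: dim_minimal => //.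
  - exact: joing_subl.
  - rewrite join_subG (Gam_dim GU1 GUM G0) /=.
    apply: (@powg_sub _ _ _ (dim 2)) => x _; have xD : x \in dim 1 by rewrite (dim1 GU1 GUM G0 G1) inE.
    by move: (dimX charK xD); rewrite p2.
  - move=> k x; rewrite p2 => k2 _.
    by apply: (subsetP (joing_subr _ _)); apply: mem_powg; rewrite inE.
rewrite /criterion eqH Z4 !cardD l2 l4; split=> //.
apply: cyclic4_powg; rewrite ?cardD ?l4 // eq8 -cardG_gt1 cardD l8 //.
Qed.

Lemma comm_gen_mem (A B C : {group gT}) x y :
  [~: A, B]%g \subset C -> x \in A -> y \in B -> [~ x, y]%g \in C.
Proof. by move=> /subsetP sC xA yB; apply: sC; apply: mem_commg. Qed.

(** If gamma_5(G) were Z, the group gamma_4(G) between it and Z would equal it, against nilpotency.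
    So gamma_5(G) lies in the subgroup of order 2 of Z, and gamma_6(G) = 1. *)
Lemma gam_of_criterion : criterion ->
  gam 4 \subset powg (powg hgrp 2) 2 /\ gam 5 = 1%G.
Proof.
case=> _ cZ Z4 g3Z; pose Z := powg hgrp 2; pose Z2 := powg Z 2.
have Z2_card : #|Z2| = 2%N := cyclic4_powg_card cZ Z4.
have g4Z2 : gam 4 \subset Z2.
  apply: proper_cyclic4 => //; rewrite properEneq (subset_trans _ g3Z) ?gam_le //.
  rewrite andbT; apply/eqP => g4Z.
  have g3nt : gam 3 != 1%G.
    apply/eqP => g31; move: Z4; suff -> : powg hgrp 2 = 1%G by rewrite cards1.
    by apply/group_inj/trivgP; rewrite -g4Z -[1%g]/(gval 1%G) -g31 gam_le.
  have := gam_strict jI jE nilG (isT : 0 < 3)%N g3nt; rewrite g4Z.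
  by move/properP => [_ [x xZ /negP[]]]; apply: (subsetP g3Z).
split=> //; have [g41|g4nt] := eqVneq (gam 4) 1%G.
  by apply/group_inj/trivgP; rewrite -[1%g]/(gval 1%G) -g41 gam_le.
have ltg5 := proper_sub_trans (gam_strict jI jE nilG (isT : 0 < 4)%N g4nt) g4Z2.
apply/group_inj/eqP; rewrite trivg_card_le1.
by have := proper_card ltg5; rewrite Z2_card.
Qed.

(** The explicit series [S] is good and contained in (D_m). Goodness gives the vanishing above
    degree 17, containment puts the norm in degree 17, and the index is 17 + 2. *)
Lemma tL_of_criterion : p = 2%N -> n = 5%N -> criterion -> tL KG = 19%N.
Proof.
move=> p2 n5 crit; have [H16 cZ Z4 _] := crit; have nilT := pgroup_nil pT.
pose Z := powg hgrp 2; pose Z2 := powg Z 2.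
have Z2_card : #|Z2| = 2%N := cyclic4_powg_card cZ Z4.
have Z_ntriv : Z :!=: 1%g by rewrite -cardG_gt1 Z4.
have Z2_ntriv : Z2 :!=: 1%g by rewrite -cardG_gt1 Z2_card.
have nH : [set: gT] \subset 'N(hgrp)%g.
  apply/subsetP => x _; rewrite inE; apply/subsetP => _ /imsetP[y yH ->].
  rewrite conjg_mulR groupM //; apply: (subsetP (joing_subl _ _)).
  by have := @gamR _ _ _ jM 1 0 y x; rewrite G0 G1 !inE; apply.
have nZ : [set: gT] \subset 'N(Z)%g.
  by apply/subsetP => x _; apply: powg_norm; apply: (subsetP nH); rewrite inE.
have nZ2 : [set: gT] \subset 'N(Z2)%g.
  by apply/subsetP => x _; apply: powg_norm; apply: (subsetP nZ); rewrite inE.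
have sZ2Z : Z2 \subset Z := powgS _ _.
have sZH : Z \subset hgrp := powgS _ _.
have comm_nt (A : {group gT}) : A :!=: 1%g -> [set: gT] \subset 'N(A)%g ->
    [~: A, [set: gT]]%g \proper A.
  move=> ntA nA; apply: (nil_comm_properl nilT) => //; first exact: subsetT.
  by rewrite subsetI subxx.
have RZ : [~: Z, [set: gT]]%g \subset Z2.
  exact: proper_cyclic4 cZ Z4 (comm_nt Z Z_ntriv nZ).
have trivial_proper (A : {group gT}) : A \proper Z2 -> A = 1%G.
  move/proper_card; rewrite Z2_card ltnS => A1.
  by apply/group_inj/eqP; rewrite trivg_card_le1.
have RZ2 : [~: Z2, [set: gT]]%G = 1%G.
  by apply: trivial_proper; apply: comm_nt.
have [g4Z2 g5] := gam_of_criterion crit; have [_ _ _ g3Z] := crit.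
pose T := [set: gT]%G.
(* From index 1 on the logarithms of the orders are 5, 4, 2, 2, 1, 1, 1, 1, with sum 17. *)
pose S i : {group gT} := nth 1%G [:: T; T; hgrp; Z; Z; Z2; Z2; Z2; Z2] i.
have S9 i : S (9 + i)%N = 1%G by rewrite /S nth_default.
have sZT : Z \subset T := subsetT Z.
have sZ2H : Z2 \subset hgrp := subset_trans sZ2Z sZH.
have SZ2 i : (i <= 8)%N -> Z2 \subset S i.
  by do 9?[case: i => [|i] //]; rewrite /S /= subsetT.
have SZ i : (i <= 4)%N -> Z \subset S i.
  by do 5?[case: i => [|i] //]; rewrite /S /= subsetT.
have SH i : (i <= 2)%N -> hgrp \subset S i.
  by do 3?[case: i => [|i] //]; rewrite /S /= subsetT.
have S5 i : (4 < i)%N -> S i \subset Z2.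
  do 9?[case: i => [|i] //]; move=> _; rewrite -[i.+4.+4.+1]/(9 + i)%N S9.
  exact: sub1G.
have S3 i : (2 < i)%N -> S i \subset Z.
  do 5?[case: i => [|i] //] => _; apply: subset_trans sZ2Z; exact: S5.
have S2 i : (1 < i)%N -> S i \subset hgrp.
  do 3?[case: i => [|i] //] => _; apply: subset_trans sZH; exact: S3.
(* For a <= 2 the commutator lies in gamma_4(G), inside Z, and a + b <= 4. For a = 3 or 4 it lies in
   [Z, T], inside Z^2, and a + b <= 8. Beyond that it lies in [Z^2, T] = 1. *)
have RS a b x y : (b <= a)%N -> x \in S a -> y \in S b -> [~ x, y]%g \in S (a + b)%N.
  move=> le_ba xS yS; have [le_a2|lt2a] := leqP a 2.
    apply: (subsetP (SZ _ (leq_add le_a2 (leq_trans le_ba le_a2)))).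
    apply: (subsetP g3Z); have := @gamR _ _ _ jM 1 1 x y.
    by rewrite G1 !inE; apply.
  have [le_a4|lt4a] := leqP a 4.
    apply: (subsetP (SZ2 _ (leq_add le_a4 (leq_trans le_ba le_a4)))).
    apply: comm_gen_mem RZ _ _; last by rewrite inE.
    exact: subsetP (S3 _ lt2a) _ xS.
  suff /set1gP-> : [~ x, y]%g \in 1%G by apply: group1.
  rewrite -RZ2; apply: mem_commg; last by rewrite inE.
  exact: subsetP (S5 _ lt4a) _ xS.
have goodS : good_series p gam S 9.
  split=> // [m|a b x y xS yS|a x xS].
  - split.
      do 9?[case: m => [|m] //]; rewrite -?[m.+4.+4.+2]/(9 + m.+1)%N ?S9 ?sub1G //.
      exact: subsetT.
    have sg m' : (5 <= m')%N -> gam m' \subset S m'.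
      by move=> /(gam_le jM); rewrite g5 => /subset_trans; apply; apply: sub1G.
    case: m => [|[|[|[|[|m]]]]]; first [exact: sg | exact: subsetT | exact: g3Z |
      exact: (subset_trans g4Z2 sZ2Z) | exact: joing_subl].
  - case: (leqP b a) => [le_ba|/ltnW le_ab]; first exact: RS.
    by rewrite -invgR groupV addnC; apply: RS.
  - rewrite p2; have [le_a1|lt1a] := leqP a 1.
      apply: (subsetP (SH _ (leq_mul (leqnn 2) le_a1))).
      by apply: (subsetP (joing_subr _ _)); apply: mem_powg; rewrite inE.
    have [le_a2|lt2a] := leqP a 2.
      apply: (subsetP (SZ _ (leq_mul (leqnn 2) le_a2))).
      by apply: mem_powg; apply: subsetP (S2 _ lt1a) _ xS.
    have [le_a4|lt4a] := leqP a 4.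
      apply: (subsetP (SZ2 _ (leq_mul (leqnn 2) le_a4))).
      by apply: mem_powg; apply: subsetP (S3 _ lt2a) _ xS.
    have xZ2 := subsetP (S5 _ lt4a) _ xS.
    have -> : (x ^+ 2 = 1)%g; last exact: group1.
    by apply/eqP; rewrite -order_dvdn -Z2_card order_dvdG.
have weightS : series_weight p S 9 = 17%N.
  rewrite /series_weight; do 8!rewrite big_ltn //; rewrite big_geq // /S /=.
  by rewrite cardT n5 H16 Z4 Z2_card p2.
have p1 : p.-1 = 1%N by rewrite p2.
have sSD w : S w \subset dim w.
  have HD : hgrp \subset dim 2.
    rewrite join_subG (Gam_dim GU1 GUM G0) /=.
    apply: (@powg_sub _ _ _ (dim 2)) => x _.
    have xD : x \in dim 1 by rewrite (dim1 GU1 GUM G0 G1) inE.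
    by move: (dimX charK xD); rewrite p2.
  have ZD : Z \subset dim 4.
    apply: (@powg_sub _ _ _ (dim 4)) => x /(subsetP HD) xD.
    by move: (dimX charK xD); rewrite p2.
  have Z2D : Z2 \subset dim 8.
    apply: (@powg_sub _ _ _ (dim 8)) => x /(subsetP ZD) xD.
    by move: (dimX charK xD); rewrite p2.
  have le_dim i k : (i <= k)%N -> dim k \subset dim i by apply: dim_le.
  case: (leqP w 1) => [le_w1|lt1w].
    by apply: subset_trans (le_dim _ _ le_w1); rewrite (dim1 GU1 GUM G0 G1) subsetT.
  case: (leqP w 2) => [le_w2|lt2w].
    exact: subset_trans (S2 _ lt1w) (subset_trans HD (le_dim _ _ le_w2)).
  case: (leqP w 4) => [le_w4|lt4w].
    exact: subset_trans (S3 _ lt2w) (subset_trans ZD (le_dim _ _ le_w4)).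
  case: (leqP w 8) => [le_w8|lt8w].
    exact: subset_trans (S5 _ lt4w) (subset_trans Z2D (le_dim _ _ le_w8)).
  by rewrite -(subnKC lt8w) S9 sub1G.
have normF := filt_norm charK GU1 GUM goodS pT
  (fun w x xS => elimT (dimP GU1 GUM G0 w x) (subsetP (sSD w) x xS)).
rewrite weightS p1 mul1n in normF.
apply: (tL_eq jE charK pT normF GN) => g.
by apply: (filt_vanish charK GU1 GUM goodS pT); rewrite weightS p1.
Qed.

End Criterion.

Local Open Scope group_scope.

(** * Groups of order 32 *)

Section Generators.

Lemma two_gen_bound (gT : finGroupType) (x y : gT) a b :
    0 < a -> 0 < b -> x ^+ a = 1 -> y ^+ b = 1 -> x ^ y \in <[x]> ->
  #|<[x]> <*> <[y]>| <= a * b.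
Proof.
move=> a_gt0 b_gt0 xa yb xy; rewrite norm_joinEr ?norms_cycle //.
apply: leq_trans (_ : #[x] * #[y] <= _).
  by rewrite !orderE mul_cardG leq_pmulr ?cardG_gt0.
by apply: leq_mul; rewrite dvdn_leq // order_dvdn ?xa ?yb.
Qed.

Lemma three_gen_bound (gT : finGroupType) (x y z : gT) a b c :
    0 < a -> 0 < b -> 0 < c -> x ^+ a = 1 -> y ^+ b = 1 -> z ^+ c = 1 ->
    x ^ y \in <[x]> -> x ^ z \in <[x]> <*> <[y]> -> y ^ z \in <[x]> <*> <[y]> ->
  #|<[x]> <*> <[y]> <*> <[z]>| <= a * b * c.
Proof.
move=> a_gt0 b_gt0 c_gt0 xa yb zc xy xz yz.
have nz : <[z]> \subset 'N(<[x]> <*> <[y]>).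
  by rewrite cycle_subG inE conjYg -!cycleJ join_subG !cycle_subG xz yz.
rewrite norm_joinEr //; apply: leq_trans (_ : #|<[x]> <*> <[y]>| * #[z] <= _).
  by rewrite orderE mul_cardG leq_pmulr ?cardG_gt0.
by apply: leq_mul; [apply: two_gen_bound|rewrite dvdn_leq // order_dvdn zc].
Qed.

(* The subgroup of gT * rT generated by the pairs of generators satisfies the
   same relations, so it is no larger than S, onto which it projects. *)
Lemma homg_diagonal (gT rT : finGroupType) (S : {group gT}) (H : {group rT})
    (W : {group gT * rT}) :
  [morphism of (fun q : gT * rT => q.1)] @* W = S ->
  [morphism of (fun q : gT * rT => q.2)] @* W = H -> #|W| <= #|S| -> H \homg S.
Proof.
move=> WS WH leWS; have isoSW : S \isog W.
  by rewrite isogEcard leWS andbT -WS morphim_homg.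
by apply: homg_trans (isog_hom (isog_symr isoSW)); rewrite -WH morphim_homg.
Qed.

Lemma two_gen_homg (gT rT : finGroupType) (S : {group gT}) (x y : gT)
    (H : {group rT}) (x' y' : rT) a b e :
    0 < a -> 0 < b -> #|S| = (a * b)%N ->
    S :=: <[x]> <*> <[y]> -> x ^+ a = 1 -> y ^+ b = 1 -> x ^ y = x ^+ e ->
    H :=: <[x']> <*> <[y']> -> x' ^+ a = 1 -> y' ^+ b = 1 -> x' ^ y' = x' ^+ e ->
  H \homg S.
Proof.
move=> a_gt0 b_gt0 oS defS xa yb xy defH xa' yb' xy'.
have expP (u : gT) (v : rT) m : (u, v) ^+ m = (u ^+ m, v ^+ m).
  by elim: m => // m IH; rewrite !expgS IH.
pose W := (<[(x, x')]> <*> <[(y, y')]>)%G.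
apply: (@homg_diagonal _ _ S H W).
- by rewrite morphimY ?subsetT // !morphim_cycle ?inE.
- by rewrite morphimY ?subsetT // !morphim_cycle ?inE.
rewrite oS; apply: two_gen_bound => //; rewrite ?expP ?xa ?xa' ?yb ?yb' //.
have -> : (x, x') ^ (y, y') = (x ^ y, x' ^ y') by [].
by rewrite xy xy' -expP mem_cycle.
Qed.

Lemma three_gen_homg (gT rT : finGroupType) (S : {group gT}) (x y z : gT)
    (H : {group rT}) (x' y' z' : rT) a b c e f g :
    0 < a -> 0 < b -> 0 < c -> #|S| = (a * b * c)%N ->
    S :=: <[x]> <*> <[y]> <*> <[z]> ->
    x ^+ a = 1 -> y ^+ b = 1 -> z ^+ c = 1 ->
    x ^ y = x ^+ e -> x ^ z = x ^+ f -> y ^ z = y * x ^+ g ->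
    H :=: <[x']> <*> <[y']> <*> <[z']> ->
    x' ^+ a = 1 -> y' ^+ b = 1 -> z' ^+ c = 1 ->
    x' ^ y' = x' ^+ e -> x' ^ z' = x' ^+ f -> y' ^ z' = y' * x' ^+ g ->
  H \homg S.
Proof.
move=> a_gt0 b_gt0 c_gt0 oS defS xa yb zc xy xz yz defH xa' yb' zc' xy' xz' yz'.
have expP (u : gT) (v : rT) m : (u, v) ^+ m = (u ^+ m, v ^+ m).
  by elim: m => // m IH; rewrite !expgS IH.
pose W := (<[(x, x')]> <*> <[(y, y')]> <*> <[(z, z')]>)%G.
apply: (@homg_diagonal _ _ S H W).
- by rewrite !morphimY ?subsetT // !morphim_cycle ?inE.
- by rewrite !morphimY ?subsetT // !morphim_cycle ?inE.
rewrite oS; apply: three_gen_bound => //;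
  rewrite ?expP ?xa ?xa' ?yb ?yb' ?zc ?zc' //.
- have -> : (x, x') ^ (y, y') = (x ^ y, x' ^ y') by [].
  by rewrite xy xy' -expP mem_cycle.
- have -> : (x, x') ^ (z, z') = (x ^ z, x' ^ z') by [].
  by rewrite xz xz' -expP mem_gen // inE mem_cycle.
have -> : (y, y') ^ (z, z') = (y, y') * (x ^+ g, x' ^+ g).
  by rewrite -[LHS]/(y ^ z, y' ^ z') yz yz'.
by rewrite -expP groupM // mem_gen // inE ?cycle_id ?mem_cycle ?orbT.
Qed.

Lemma two_gen_isog (gT rT : finGroupType) (S : {group gT}) (x y : gT)
    (H : {group rT}) (x' y' : rT) a b e :
    0 < a -> 0 < b -> #|S| = (a * b)%N -> #|H| = (a * b)%N ->
    S :=: <[x]> <*> <[y]> -> x ^+ a = 1 -> y ^+ b = 1 -> x ^ y = x ^+ e ->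
    H :=: <[x']> <*> <[y']> -> x' ^+ a = 1 -> y' ^+ b = 1 -> x' ^ y' = x' ^+ e ->
  H \isog S.
Proof.
move=> a0 b0 oS oH defS xa yb xy defH xa' yb' xy'.
rewrite isogEcard oS oH leqnn andbT.
exact: (two_gen_homg a0 b0 oS defS xa yb xy defH xa' yb' xy').
Qed.

(* x ^ y = x ^+ 1 expresses commutation in the form used by two_gen_isog. *)
Lemma ZnxZm_gen a b : 1 < a -> 1 < b ->
  exists x y : 'Z_a * 'Z_b,
  [/\ [set: 'Z_a * 'Z_b] = <[x]> <*> <[y]>, x ^+ a = 1, y ^+ b = 1,
      x ^ y = x ^+ 1 & #|[set: 'Z_a * 'Z_b]| = (a * b)%N].
Proof.
move=> a_gt1 b_gt1; exists (Zp1, 1), (1, Zp1).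
have expP (u : 'Z_a) (v : 'Z_b) m : (u, v) ^+ m = (u ^+ m, v ^+ m).
  by elim: m => // m IH; rewrite !expgS IH.
have ea : (Zp1 : 'Z_a) ^+ a = 1.
  by apply/eqP; rewrite -order_dvdn order_Zp1 Zp_cast.
have eb : (Zp1 : 'Z_b) ^+ b = 1.
  by apply/eqP; rewrite -order_dvdn order_Zp1 Zp_cast.
split; rewrite ?expP ?ea ?eb ?expg1n ?expg1 //.
- apply/eqP; rewrite eq_sym -subTset; apply/subsetP => -[u v] _.
  have -> : (u, v) = (u, 1) * (1, v) by rewrite -[RHS]/(u * 1, 1 * v) mulg1 mul1g.
  have /cycleP[i ->] : u \in <[Zp1]> by rewrite -Zp_cycle inE.
  have /cycleP[k ->] : v \in <[Zp1]> by rewrite -Zp_cycle inE.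
  have -> : (Zp1 ^+ i, 1) = (Zp1, 1) ^+ i :> 'Z_a * 'Z_b by rewrite expP expg1n.
  have -> : (1, Zp1 ^+ k) = (1, Zp1) ^+ k :> 'Z_a * 'Z_b by rewrite expP expg1n.
  by rewrite groupM // mem_gen // inE mem_cycle ?orbT.
- by rewrite -[LHS]/(Zp1 ^ 1, 1 ^ Zp1) conjg1 conj1g.
- transitivity #|{: 'Z_a * 'Z_b}|; first by apply: eq_card => q; rewrite !inE.
  by rewrite card_prod !card_ord !Zp_cast.
Qed.

Lemma isog_ZnxZm (gT : finGroupType) (A : {group gT}) x y a b :
    1 < a -> 1 < b -> #|A| = (a * b)%N -> A :=: <[x]> <*> <[y]> ->
    x ^+ a = 1 -> y ^+ b = 1 -> commute x y ->
  A \isog [set: 'Z_a * 'Z_b].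
Proof.
move=> a_gt1 b_gt1 oA defA xa yb cxy.
have [u [v [defZ ua vb uv oZ]]] := ZnxZm_gen a_gt1 b_gt1.
apply: (@two_gen_isog _ _ [set: 'Z_a * 'Z_b]%G u v A x y a b 1) => //.
- exact: ltnW.
- exact: ltnW.
- by rewrite expg1; apply/conjg_fixP/commgP.
Qed.

Lemma isog_Zn (gT : finGroupType) (A : {group gT}) a :
  1 < a -> (A \isog [set: 'Z_a]) = cyclic A && (#|A| == a).
Proof.
move=> a_gt1; have oZ : #|[set: 'Z_a]| = a by transitivity #|{: 'Z_a}|; [apply: eq_card => q; rewrite !inE|rewrite card_ord Zp_cast].
have cZ : cyclic [set: 'Z_a] by apply/cyclicP; exists Zp1; rewrite Zp_cycle.
by rewrite isog_sym isog_cyclic_card // oZ.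
Qed.

Lemma ZnxZm_isog (gT : finGroupType) (A : {group gT}) a b :
    1 < a -> 1 < b -> A \isog [set: 'Z_a * 'Z_b] ->
  exists x y, [/\ A :=: <[x]> <*> <[y]>, #[x] = a, y ^+ b = 1,
      commute x y & #|A| = (a * b)%N].
Proof.
move=> a_gt1 b_gt1 isoA; have [u [v [defZ ua vb uv oZ]]] := ZnxZm_gen a_gt1 b_gt1.
have oA : #|A| = (a * b)%N by rewrite (card_isog isoA).
have [f injf fZ] := isogP (isog_symr isoA).
have [uT vT] : u \in [set: 'Z_a * 'Z_b] /\ v \in [set: 'Z_a * 'Z_b] by rewrite !inE.
have defA : A :=: <[f u]> <*> <[f v]>.
  transitivity (f @* (<[u]> <*> <[v]>)); first by rewrite -defZ -fZ.
  by rewrite morphimY ?subsetT // !morphim_cycle.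
have cuv : commute (f u) (f v).
  by apply/commgP/conjg_fixP; rewrite -morphJ // uv expg1.
have fua : f u ^+ a = 1 by rewrite -morphX // ua morph1.
have fvb : f v ^+ b = 1 by rewrite -morphX // vb morph1.
exists (f u), (f v); split=> //; apply/eqP; rewrite eqn_leq.
rewrite dvdn_leq ?order_dvdn ?fua ?(ltnW a_gt1) //= leqNgt; apply/negP => lt_oa.
have conj_mem : f u ^ f v \in <[f u]>.
  by have -> : f u ^ f v = f u; [apply/conjg_fixP/commgP|apply: cycle_id].
have := two_gen_bound (order_gt0 (f u)) (ltnW b_gt1) (expg_order _) fvb conj_mem.
by rewrite -defA oA leq_mul2r [b == 0]gtn_eqF ?(ltnW b_gt1) //= leqNgt lt_oa.
Qed.

End Generators.

(** * Power subgroups and splittings *)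

Section PowerLemmas.
Context (gT : finGroupType).
Implicit Types (A B T : {group gT}) (x y z : gT).

(** Take z outside <t>, a subgroup of index 2, and write z^2 = t^k. An odd k would make z of order
    2^(r+1), so k is even and z t^(-k/2) is the required involution. *)
Lemma abelian_split A t r :
    abelian A -> 0 < r -> #|A| = (2 * 2 ^ r)%N -> t \in A -> #[t] = (2 ^ r)%N ->
    (forall z, z \in A -> #[z] != (2 * 2 ^ r)%N) ->
  exists y, [/\ y \in A, y ^+ 2 = 1 & A :=: <[t]> <*> <[y]> ].
Proof.
move=> abA r_gt0 oA tA ot noZ.
have stA : <[t]> \subset A by rewrite cycle_subG.
have idx : #|A : <[t]>| = 2 by rewrite -divgS // -orderE ot oA mulnK // expn_gt0.
have [z zA zt] : exists2 z, z \in A & z \notin <[t]>.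
  apply/subsetPn; apply/negP => /subset_leq_card.
  by rewrite -orderE ot oA leqNgt -{1}[(2 ^ r)%N]mul1n ltn_mul2r expn_gt0.
have nt : <[t]> <| A by rewrite -sub_abelian_normal.
have z2 : z ^+ 2 \in <[t]>.
  have Nz : z \in 'N(<[t]>) by apply: (subsetP (normal_norm nt)).
  apply: coset_idr; rewrite ?groupX // morphX //; apply/eqP.
  rewrite -order_dvdn -idx -card_quotient ?normal_norm //.
  by apply: order_dvdG; apply: mem_quotient.
have /cycleP[k z2E] := z2.
have even_k : ~~ odd k.
  apply/negP => odd_k; have := noZ z zA; case/eqP.
  have o2 : #[z ^+ 2] = (2 ^ r)%N.
    by rewrite z2E orderXgcd ot (eqP (_ : coprime _ _)) ?divn1 // coprimeXl // coprime2n.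
  have dvd2z : 2 %| #[z].
    apply: dvdn_trans (orderXdvd z 2); rewrite o2 -{1}(expn1 2).
    by rewrite dvdn_exp2l.
  by rewrite -o2 orderXdiv // mulnC divnK.
pose m := k./2; have k_E : k = (m * 2)%N by rewrite muln2 -[LHS]odd_double_half (negbTE even_k).
have czt : commute z (t ^+ m) by apply: (centsP abA); rewrite ?groupX.
exists (z * (t ^+ m)^-1); split.
- by rewrite groupM // groupV groupX.
- rewrite expgMn; last by apply: commuteV.
  by rewrite z2E k_E expgM expgVn mulgV.
set y := z * _; have yA : y \in A by rewrite groupM // groupV groupX.
have yt : y \notin <[t]> by rewrite groupMr // groupV mem_cycle.
apply/eqP; rewrite eq_sym eqEcard join_subG !cycle_subG tA yA /=.
rewrite oA -(mulnC (2 ^ r)%N) -ot orderE.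
have pr : <[t]> \proper <[t]> <*> <[y]>.
  rewrite properE joing_subl /=; apply: contra yt => /subsetP; apply.
  by rewrite mem_gen // inE cycle_id orbT.
by rewrite -(Lagrange (proper_sub pr)) leq_mul2l indexg_gt1 proper_subn ?orbT.
Qed.

Lemma powg_two_gen A x y k : A :=: <[x]> <*> <[y]> -> commute x y -> y ^+ k = 1 ->
  powg A k = <[x ^+ k]>%G.
Proof.
move=> defA cxy yk; apply/group_inj/eqP; rewrite eqEsubset; apply/andP; split.
  apply: (@powg_sub _ _ _ <[x ^+ k]>%G) => u.
  rewrite defA norm_joinEr; last by rewrite cents_norm // cent_cycle cycle_subG; apply/cent1P.
  case/mulsgP => _ _ /cycleP[i ->] /cycleP[l ->] ->.
  rewrite expgMn; last by apply: commuteX2.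
  by rewrite (expgAC y) yk expg1n mulg1 expgAC mem_cycle.
by rewrite cycle_subG mem_powg // defA mem_gen // inE cycle_id.
Qed.

(** The quotient of A by the subgroup of squares has exponent 2 and two generators. *)
Lemma powg_index A x y : A :=: <[x]> <*> <[y]> -> #|A| <= 4 * #|powg A 2|.
Proof.
move=> defA; set B := powg A 2.
have sBA : B \subset A := powgS A 2.
have nB : A \subset 'N(B).
  by apply/subsetP => z zA; apply: powg_norm; apply: (subsetP (normG A)).
have xA : x \in A by rewrite defA mem_gen // inE cycle_id.
have yA : y \in A by rewrite defA mem_gen // inE cycle_id orbT.
have sq z : z \in A -> coset B z ^+ 2 = 1.
  by move=> zA; rewrite -morphX ?(subsetP nB) //= coset_id // mem_powg.
rewrite -(Lagrange sBA) mulnC leq_mul2r; apply/orP; right.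
rewrite -card_quotient // {1}defA quotientY ?cycle_subG ?(subsetP nB) //.
rewrite !quotient_cycle ?(subsetP nB) //.
apply: (@two_gen_bound _ _ _ 2 2) => //; try exact: sq.
have inv z : z \in A -> (coset B z)^-1 = coset B z.
  by move=> zA; apply/eqP; rewrite eq_invg_mul -expg2 sq.
have [Nx Ny] := (subsetP nB x xA, subsetP nB y yA).
have cxy : coset B x * coset B y = coset B y * coset B x.
  have := inv (x * y) (groupM xA yA).
  by rewrite morphM // invMg (inv x) // (inv y).
by rewrite conjgE cxy mulKg cycle_id.
Qed.

(** T / B is abelian, so taking n-th powers is multiplicative modulo B. *)
Lemma pow_pre_group T B n : [~: T, T] \subset B -> B \subset T ->
  group_set [set x in T | x ^+ n \in B].
Proof.
move=> sTB sBT; have nB : T \subset 'N(B).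
  by apply: normal_norm; apply: sub_der1_normal.
have abQ : abelian (T / B) by apply: sub_der1_abelian.
apply/group_setP; split=> [|x y]; first by rewrite inE group1 expg1n group1.
rewrite !inE => /andP[xT xB] /andP[yT yB]; rewrite groupM //=.
have [Nx Ny] := (subsetP nB x xT, subsetP nB y yT).
apply: coset_idr; first by rewrite groupX // groupM.
rewrite morphX ?groupM // morphM // expgMn; last first.
  by apply: (centsP abQ); apply: mem_quotient.
by rewrite -!morphX //= !coset_id // mulg1.
Qed.

Lemma pow_pre_sub T B n A : [~: T, T] \subset B -> B \subset T ->
    A \subset T -> (exists2 X : {set gT}, A :=: <<X>> & forall x, x \in X -> x ^+ n \in B) ->
  forall x, x \in A -> x ^+ n \in B.
Proof.
move=> sTB sBT sAT [X defA XB] x xA.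
have : A \subset Group (pow_pre_group n sTB sBT).
  rewrite defA gen_subG; apply/subsetP => y yX; rewrite inE XB // andbT.
  by apply: (subsetP sAT); rewrite defA mem_gen.
by move/subsetP/(_ x xA); rewrite inE => /andP[].
Qed.

(** Squares being multiplicative modulo B, those of the join come from squares of A and fourth
    powers of T. *)
Lemma powg_join_sub T B A : [~: T, T] \subset B -> B \subset T -> A \subset T ->
    powg A 2 \subset B -> powg T 4 \subset B ->
  powg (A <*> powg T 2) 2 \subset B.
Proof.
move=> sTB sBT sAT sA2 sT4; apply: powg_sub => x xH.
apply: (pow_pre_sub (n := 2) sTB sBT _ _ xH).
  by rewrite join_subG sAT powgS.
exists (A :|: [set t ^+ 2 | t in T]); first by rewrite /= joing_idr.
move=> y; rewrite inE => /orP[yA|/imsetP[t tT ->]].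
  by apply: (subsetP sA2); apply: mem_powg.
by rewrite -expgM; apply: (subsetP sT4); apply: mem_powg.
Qed.

End PowerLemmas.

(** * Presentations of the groups of order 32 *)

Section Presentations.

(** The relations by themselves only bound the order from above. Equality comes from the semidirect
    product of [Extremal], built on the automorphism b -> b^e, whose order divides p; it has the
    same presentation. *)
Lemma metacyclic_card (gT : finGroupType) (S : {group gT}) q p e :
    1 < q -> 1 < p -> coprime q e -> e ^ p = 1 %[mod q] ->
    S \isog Grp (x : y : (x ^+ q, y ^+ p, x ^ y = x ^+ e)) ->
  #|S| = (p * q)%N.
Proof.
move=> q_gt1 p_gt1 co_qe ep1 isoS.
pose b : 'Z_q := Zp1; have ob : #[b] = q by rewrite order_Zp1 Zp_cast.
have aut_b : exists s, [/\ s \in Aut <[b]>, #[s] %| p & s b = b ^+ e].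
  have obe : #[b ^+ e] = #[b] by rewrite orderXgcd ob (eqP co_qe) divn1.
  have dvd_be : #[b ^+ e] %| #[b] by rewrite obe.
  have inj_e : 'injm (eltm_morphism dvd_be) by rewrite injm_eltm obe.
  have im_e : eltm_morphism dvd_be @* <[b]> = <[b]>.
    rewrite im_eltm; apply/eqP; rewrite eqEcard cycle_subG mem_cycle /=.
    by rewrite -!orderE obe.
  pose s := aut inj_e im_e; have As : s \in Aut <[b]> := Aut_aut _ _.
  have sb : s b = b ^+ e by rewrite autE ?cycle_id //= eltm_id.
  exists s; split=> //; rewrite order_dvdn; apply/eqP.
  apply: (eq_Aut (groupX p As) (group1 _)) => _ /cycleP[i ->].
  have sX k : (s ^+ k) b = b ^+ (e ^ k).
    elim: k => [|k IH]; first by rewrite perm1 expn0 expg1.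
    rewrite expgSr permM IH -(autmE As) morphX ?cycle_id //= autmE sb.
    by rewrite -expgM expnS.
  rewrite -(autmE (groupX p As)) morphX ?cycle_id //= autmE sX perm1.
  by congr (_ ^+ i); apply/eqP; rewrite -{2}[b]expg1 eq_expg_mod_order ob; apply/eqP.
have isoM := Extremal.Grp p_gt1 q_gt1 aut_b.
rewrite -(Extremal.card e p_gt1 q_gt1); apply: card_isog.
by rewrite isogEhom isoM isoGrp_hom //= isoS isoGrp_hom.
Qed.

Lemma metacyclic_isoGrp (gT : finGroupType) (S : {group gT}) x y q p e :
    0 < q -> 0 < p -> #|S| = (q * p)%N -> S :=: <[x]> <*> <[y]> ->
    x ^+ q = 1 -> y ^+ p = 1 -> x ^ y = x ^+ e ->
  S \isog Grp (x : y : (x ^+ q, y ^+ p, x ^ y = x ^+ e)).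
Proof.
move=> q_gt0 p_gt0 oS defS xq yp xy; apply: intro_isoGrp.
  by apply/existsP; exists (x, y); rewrite /= -defS xq yp xy !eqxx.
move=> rT H /existsP[[x' y']] /= /eqP[defH xq' yp' xy'].
exact: (two_gen_homg q_gt0 p_gt0 oS defS xq yp xy (esym defH)).
Qed.

Lemma S37_isoGrp (gT : finGroupType) (S : {group gT}) x y z :
    #|S| = 32 -> S :=: <[x]> <*> <[y]> <*> <[z]> ->
    x ^+ 8 = 1 -> y ^+ 2 = 1 -> z ^+ 2 = 1 -> x ^ y = x ^+ 5 ->
    commute x z -> commute y z ->
  small_group_32 37 S.
Proof.
move=> oS defS x8 y2 z2 xy cxz cyz; apply: intro_isoGrp.
  apply/existsP; exists (x, y, z); rewrite /= -defS x8 y2 z2 xy.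
  by rewrite (eqP (introT commgP cxz)) (eqP (introT commgP cyz)) !eqxx.
move=> rT H /existsP[[[x' y'] z']] /= /eqP[defH x8' y2' z2' xy' xz' yz'].
have conjE (hT : finGroupType) (u v : hT) : [~ u, v] = 1 -> u ^ v = u.
  by move/eqP=> uv; apply/conjg_fixP.
apply: (@three_gen_homg _ _ S x y z H x' y' z' 8 2 2 5 1 0) => //.
- by rewrite expg1; apply/conjg_fixP/commgP.
- by rewrite expg0 mulg1; apply/conjg_fixP/commgP.
- by rewrite expg1 conjE.
- by rewrite expg0 mulg1 conjE.
Qed.

Lemma S38_isoGrp (gT : finGroupType) (S : {group gT}) x y z :
    #|S| = 32 -> S :=: <[x]> <*> <[y]> <*> <[z]> ->
    x ^+ 8 = 1 -> y ^+ 2 = 1 -> z ^+ 2 = 1 -> commute x y -> commute x z ->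
    [~ y, z] = x ^+ 4 ->
  small_group_32 38 S.
Proof.
move=> oS defS x8 y2 z2 cxy cxz yz; apply: intro_isoGrp.
  apply/existsP; exists (x, y, z); rewrite /= -defS x8 y2 z2 yz.
  by rewrite (eqP (introT commgP cxz)) (eqP (introT commgP cxy)) !eqxx.
move=> rT H /existsP[[[x' y'] z']] /= /eqP[defH x8' y2' z2' xy' xz' yz'].
have conjE (hT : finGroupType) (u v : hT) : [~ u, v] = 1 -> u ^ v = u.
  by move/eqP=> uv; apply/conjg_fixP.
have conjR (hT : finGroupType) (u v w : hT) : [~ u, v] = w -> u ^ v = u * w.
  by move=> <-; rewrite commgEl mulKVg.
apply: (@three_gen_homg _ _ S x y z H x' y' z' 8 2 2 1 1 4) => //.
- by rewrite expg1; apply/conjg_fixP/commgP.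
- by rewrite expg1; apply/conjg_fixP/commgP.
- exact: conjR.
- by rewrite expg1 conjE.
- by rewrite expg1 conjE.
- exact: conjR.
Qed.

Definition isS32 (gT : finGroupType) (T : {group gT}) m :=
  exists (hT : finGroupType) (S : {group hT}), small_group_32 m S /\ T \isog S.

Lemma isS32_refl (gT : finGroupType) (T : {group gT}) m :
  small_group_32 m T -> isS32 T m.
Proof. by move=> ST; exists gT, T; split=> //; apply: isog_refl. Qed.

(** The upper bound can be read off the relations. It gives order 32 as soon as T has a proper
    subgroup of order 16, as it does whenever gamma_3(G) is C_8 x C_2. *)
Lemma isS32_card_le (gT : finGroupType) (T : {group gT}) m :
  isS32 T m -> #|T| <= 32.
Proof.
case=> hT [S [ST isoT]]; rewrite (card_isog isoT).
have conjE (u v : hT) : [~ u, v] = 1 -> u ^ v = u.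
  by move/eqP=> uv; apply/conjg_fixP.
have conjR (u v w : hT) : [~ u, v] = w -> u ^ v = u * w.
  by move=> <-; rewrite commgEl mulKVg.
do 4!(case: m ST => [//|m] ST).
case: m ST => [|m] ST.
  have /existsP[[x y] /= /eqP[<- x8 y4 xy]] := isoGrp_hom ST.
  by apply: (@two_gen_bound _ _ _ 8 4); rewrite // xy mem_cycle.
case: m ST => [|m] ST.
  have /existsP[[[x y] z] /= /eqP[<- x8 y2 z2 xy xz yz]] := isoGrp_hom ST.
  (* With z = [x, y] placed before y, every generator normalizes the group generated by the
     preceding ones. *)
  have -> : <[x]> <*> <[y]> <*> <[z]> = <[x]> <*> <[z]> <*> <[y]>.
    by rewrite -!joingA (joingC <[y]>).
  apply: (@three_gen_bound _ _ _ _ 8 2 2) => //.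
  - by rewrite (conjE _ _ xz) cycle_id.
  - by rewrite (conjR _ _ _ xy) groupM // mem_gen // inE cycle_id ?orbT.
  - have zy : [~ z, y] = 1 by rewrite -invgR yz invg1.
    by rewrite (conjE _ _ zy) mem_gen // inE cycle_id orbT.
do 6!(case: m ST => [//|m] ST).
case: m ST => [|m] ST.
  have /existsP[[x y] /= /eqP[<- x4 y8 xy]] := isoGrp_hom ST.
  by apply: (@two_gen_bound _ _ _ 4 8); rewrite // xy groupV cycle_id.
do 4!(case: m ST => [//|m] ST).
case: m ST => [|m] ST.
  have /existsP[[x y] /= /eqP[<- x4 y8 xy]] := isoGrp_hom ST.
  by apply: (@two_gen_bound _ _ _ 16 2); rewrite // xy mem_cycle.
do 19!(case: m ST => [//|m] ST).
case: m ST => [|m] ST.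
  have /existsP[[[x y] z] /= /eqP[<- x8 y2 z2 xy xz yz]] := isoGrp_hom ST.
  apply: (@three_gen_bound _ _ _ _ 8 2 2) => //.
  - by rewrite xy mem_cycle.
  - by rewrite (conjE _ _ xz) mem_gen // inE cycle_id.
  - by rewrite (conjE _ _ yz) mem_gen // inE cycle_id orbT.
case: m ST => [|//] ST.
have /existsP[[[x y] z] /= /eqP[<- x8 y2 z2 xy xz yz]] := isoGrp_hom ST.
apply: (@three_gen_bound _ _ _ _ 8 2 2) => //.
- by rewrite (conjE _ _ xy) cycle_id.
- by rewrite (conjE _ _ xz) mem_gen // inE cycle_id.
- by rewrite (conjR _ _ _ yz) groupM // mem_gen // inE ?mem_cycle ?cycle_id ?orbT.
Qed.

(** For these two groups gamma_3(G) may have order 8, so |T| = 32 has to come from the presentation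
    itself. *)
Lemma isS32_metacyclic (gT : finGroupType) (T : {group gT}) m :
  (m == 4) || (m == 17) -> isS32 T m ->
  #|T| = 32 /\ exists x y, T :=: <[x]> <*> <[y]>.
Proof.
move=> m_in [hT [S [ST isoT]]].
have gens (R : {group hT}) (x y : hT) : S :=: <[x]> <*> <[y]> ->
    exists x y, T :=: <[x]> <*> <[y]>.
  move=> defS; have [f injf fS] := isogP (isog_symr isoT).
  have [xS yS] : x \in S /\ y \in S.
    by rewrite defS !mem_gen // inE cycle_id ?orbT.
  exists (f x), (f y); rewrite -fS.
  transitivity (f @* (<[x]> <*> <[y]>)); first by rewrite -defS.
  by rewrite morphimY ?cycle_subG // !morphim_cycle.
case/orP: m_in ST => /eqP-> ST.
  split; first by rewrite (card_isog isoT); apply: (metacyclic_card _ _ _ _ ST).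
  have /existsP[[x y] /= /eqP[defS _ _ _]] := isoGrp_hom ST.
  exact: (gens S x y (esym defS)).
split; first by rewrite (card_isog isoT); apply: (metacyclic_card _ _ _ _ ST).
have /existsP[[x y] /= /eqP[defS _ _ _]] := isoGrp_hom ST.
exact: (gens S x y (esym defS)).
Qed.

End Presentations.

(** * From the list of groups to the criterion *)

Lemma dvdn32_gt16 k : 16 < k -> k %| 32 -> k = 32.
Proof.
move=> gt16 /dvdnP[q]; case: q => [|[|q]] // eq32; first by rewrite eq32 mul1n.
by have : 2 * k <= 32; [rewrite eq32 leq_mul2r orbT|move: gt16; case: k {eq32}; lia].
Qed.

Lemma dvdn16_le32 k : 16 < k -> k <= 32 -> 16 %| k -> k = 32.
Proof. by move=> gt16 le32 /dvdnP[q eq_q]; lia. Qed.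

Lemma join_card_ge16 a b h i :
  8 <= b -> 2 * i <= a -> 0 < i -> a * b <= h * i -> 16 <= h.
Proof. nia. Qed.

Section Shape.
Context (gT : finGroupType) (T g3 g4 g5 : {group gT}).

(* The alternatives (i) to (xiii), in this order, with T in the role of G'. *)
Definition shape : Prop :=
  [/\ T \isog C16xC2, powg T 2 \subset g3, g3 \isog C8xC2
    & g4 \subset powg g3 2]
  \/
  [/\ T \isog C16xC2, g3 \isog C8, g4 \subset powg T 4
    & [/\ powg T 4 = powg g3 2 :> {set gT},
          powg g3 2 = powg T 2 :&: g3 :> {set gT}
        & powg T 2 :&: g3 \isog C4]]
  \/
  [/\ T \isog C16xC2, g3 \isog C4xC2, powg T 2 :&: g3 \isog C4,
      g4 \subset powg T 4 & powg g3 2 \subset powg T 4]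
  \/
  [/\ T \isog C16xC2, #|g3| = 4, #|powg T 2 :&: g3| = 2,
      g4 \subset powg T 4 & powg g3 2 \subset powg T 4]
  \/
  [/\ T \isog C16xC2, g3 \isog C2 & powg T 2 :&: g3 = 1]
  \/
  [/\ T \isog C8xC4, powg T 2 \subset g3, g3 \isog C8xC2
    & g4 \subset powg g3 2]
  \/
  [/\ T \isog C8xC4, g3 \isog C8, #|powg T 2 :&: g3| = 2,
      g4 \subset powg g3 2 & powg T 4 \subset powg g3 2]
  \/
  [/\ T \isog C8xC2xC2, powg T 2 \subset g3, g3 \isog C8xC2
    & g4 \subset powg g3 2]
  \/
  [/\ T \isog C8xC2xC2, g3 \isog C8, #|powg T 2 :&: g3| = 2,
      g4 \subset powg g3 2 & powg T 4 \subset powg g3 2]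
  \/
  [/\ [\/ isS32 T 4, isS32 T 5 | isS32 T 12],
      powg T 2 \subset g3, g3 \isog C8xC2, g4 = powg g3 2 :> {set gT}
    & g5 \isog C2]
  \/
  [/\ isS32 T 4, g3 \isog C8, powg T 4 \subset powg T 2 :&: g3,
      powg T 2 :&: g3 = g4 /\ g4 = powg g3 2 :> {set gT} & g5 \isog C2]
  \/
  [/\ isS32 T 37, powg T 2 \subset g3, g3 \isog C8xC2,
      g4 = powg g3 2 :> {set gT} & g5 \isog C2]
  \/
  [/\ isS32 T 17, g5 \isog C2 &
    [\/ [/\ powg T 2 \subset g3, g3 \isog C8xC2 & g4 = powg g3 2 :> {set gT}],
        [/\ g3 \isog C8, powg T 2 :&: g3 = g4, g4 = powg g3 2 :> {set gT}
          & powg g3 2 = powg T 4 :> {set gT}]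
      | [/\ g3 \isog C4xC2, powg g3 2 \subset powg T 2 :&: g3,
            powg T 2 :&: g3 = g4, g4 = powg T 4 :> {set gT}
          & powg T 4 \isog C4]]]
  \/
  [/\ isS32 T 38, powg T 2 \subset g3, g3 \isog C8xC2,
      g4 = powg g3 2 :> {set gT} & g5 \isog C2].

Definition crit := [/\ #|g3 <*> powg T 2| = 16,
  cyclic (powg (g3 <*> powg T 2) 2), #|powg (g3 <*> powg T 2) 2| = 4
  & g4 \subset powg (g3 <*> powg T 2) 2].

Hypothesis sg3T : g3 \subset T.
Hypothesis strict23 : T :!=: 1 -> g3 \proper T.
Hypothesis R1 : [~: T, T] \subset g4.
Hypothesis strict34 : g3 :!=: 1 -> g4 \proper g3.


Lemma C8xC2_powg (A : {group gT}) : A \isog C8xC2 ->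
  [/\ #|A| = 16, #|powg A 2| = 4 & cyclic (powg A 2)].
Proof.
case/(ZnxZm_isog (isT : 1 < 8) (isT : 1 < 2)) => x [y [defA ox y2 cxy oA]].
rewrite (powg_two_gen defA cxy y2) /= cycle_cyclic -orderE orderXdiv ox //.
Qed.

Lemma C8_powg (A : {group gT}) : A \isog C8 ->
  [/\ #|A| = 8, #|powg A 2| = 4 & cyclic (powg A 2)].
Proof.
rewrite isog_Zn // => /andP[cA /eqP oA]; split=> //.
  have [x defA] := cyclicP cA.
  by rewrite {1}defA powg_cycle /= -orderE orderXdiv orderE -defA oA.
exact: cyclicS (powgS A 2) cA.
Qed.

(** B is the candidate for H^2. If H were T, then gamma_3(G) would supplement the Frattini subgroup
    of T and so equal T. The squares of H lie in B by [powg_join_sub], and they contain both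
    gamma_3(G)^2 and T^4, one of which contains B. *)
Lemma crit_of_square (B : {group gT}) :
    #|T| = 32 -> 16 <= #|g3 <*> powg T 2| -> cyclic B -> #|B| = 4 -> g4 \subset B ->
    powg g3 2 \subset B -> powg T 4 \subset B ->
    (B \subset powg g3 2) || (B \subset powg T 4) ->
  crit.
Proof.
move=> oT le16 cB oB g4B g3B TB subB.
have sHT : g3 <*> powg T 2 \subset T by rewrite join_subG sg3T powgS.
have pT : 2.-group T by rewrite /pgroup oT.
have H16 : #|g3 <*> powg T 2| = 16.
  apply/eqP; rewrite eqn_leq le16 andbT leqNgt; apply/negP => gt16.
  have H32 : #|g3 <*> powg T 2| = 32.
    by apply: dvdn32_gt16 gt16 _; rewrite -oT cardSg.
  have eqH : g3 <*> powg T 2 = T by apply/eqP; rewrite eqEcard sHT H32 oT.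
  have eqPhi : 'Phi(T) <*> g3 = T.
    apply/eqP; rewrite eqEsubset join_subG Phi_sub sg3T /= -{1}eqH.
    by rewrite join_subG joing_subr (subset_trans (powg_Phi pT)) ?joing_subl.
  have := Phi_nongen eqPhi; rewrite genGid => eq3.
  have /strict23 : T :!=: 1 by rewrite -cardG_gt1 oT.
  by rewrite eq3 properxx.
suff eqB : powg (g3 <*> powg T 2) 2 = B :> {set gT}.
  by rewrite /crit eqB; split.
have sBT : B \subset T.
  by case/orP: subB => /subset_trans-> //; rewrite ?powgS // (subset_trans (powgS _ _)).
apply/eqP; rewrite eqEsubset powg_join_sub //=; last exact: subset_trans R1 g4B.
case/orP: subB => /subset_trans; apply.
  exact: powg_mono (joing_subl _ _).
apply: powg_sub => t tT; rewrite (expgM t 2 2); apply: mem_powg.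
by apply: (subsetP (joing_subr _ _)); apply: mem_powg.
Qed.

Lemma card_join_powg : (#|g3| * #|powg T 2| <= #|g3 <*> powg T 2| * #|powg T 2 :&: g3|)%N.
Proof.
rewrite mul_cardG setIC leq_mul2r subset_leq_card ?orbT //.
by rewrite mulG_subG joing_subl joing_subr.
Qed.

Lemma crit_big : #|T| = 32 -> powg T 2 \subset g3 -> g3 \isog C8xC2 ->
  g4 \subset powg g3 2 -> crit.
Proof.
move=> oT sT2 /C8xC2_powg[o3 oP cP] g4P.
apply: (crit_of_square oT _ cP oP g4P) => //.
- by rewrite -o3 subset_leq_card // joing_subl.
- apply: powg_sub => t tT; rewrite (expgM t 2 2); apply: mem_powg.
  by apply: (subsetP sT2); apply: mem_powg.
- by rewrite subxx.
Qed.

Lemma card32_big : #|T| <= 32 -> g3 \isog C8xC2 -> #|T| = 32.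
Proof.
move=> le32 /C8xC2_powg[o3 _ _]; apply: dvdn16_le32 => //; last by rewrite -o3 cardSg.
have ntT : T :!=: 1 by rewrite -cardG_gt1 (leq_trans _ (subset_leq_card sg3T)) ?o3.
by rewrite -o3 proper_card ?strict23.
Qed.

Lemma crit_small (B : {group gT}) k :
    #|T| = 32 -> 8 <= #|powg T 2| -> (2 * #|powg T 2 :&: g3| <= #|g3|)%N ->
    #|powg T 2 :&: g3| = k -> 0 < k ->
    cyclic B -> #|B| = 4 -> g4 \subset B ->
    powg g3 2 \subset B -> powg T 4 \subset B ->
    (B \subset powg g3 2) || (B \subset powg T 4) -> crit.
Proof.
move=> oT le8 le_g3 ok k_gt0; apply: crit_of_square => //.
have := card_join_powg; rewrite ok in le_g3 *.
exact: join_card_ge16.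
Qed.

Lemma C16xC2_facts : T \isog C16xC2 ->
  [/\ #|T| = 32, 8 <= #|powg T 2|, #|powg T 4| = 4 & cyclic (powg T 4)].
Proof.
case/(ZnxZm_isog (isT : 1 < 16) (isT : 1 < 2)) => x [y [defT ox y2 cxy oT]].
have y4 : y ^+ 4 = 1 by rewrite (expgM y 2 2) y2 expg1n.
rewrite (powg_two_gen defT cxy y4) (powg_two_gen defT cxy y2) /=.
by rewrite cycle_cyclic -!orderE !orderXdiv ox.
Qed.

Lemma metacyclic_facts m : (m == 4) || (m == 17) -> isS32 T m ->
  #|T| = 32 /\ 8 <= #|powg T 2|.
Proof.
move=> m_in /(isS32_metacyclic m_in)[oT [x [y defT]]]; split=> //.
by have := powg_index defT; rewrite oT (leq_pmul2l (m := 4) (n1 := 8)).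
Qed.

Lemma crit_of_shape : shape -> #|T| = 32 /\ crit.
Proof.
case=> [[isoT sT2 iso3 s4]|].
  by have [oT _ _ _] := C16xC2_facts isoT; split=> //; apply: crit_big.
case=> [[isoT iso3 s4 [e1 e2 iso4]]|].
  have [oT le8 o4 c4] := C16xC2_facts isoT; split=> //.
  have [o3 oP cP] := C8_powg iso3.
  have oI : #|powg T 2 :&: g3| = 4 by rewrite -e2.
  apply: (crit_small (B := powg T 4) oT le8 _ oI) => //.
  - by rewrite oI o3.
  - by rewrite e1.
  - by rewrite subxx orbT.
case=> [[isoT iso3 isoI s4 s3]|].
  have [oT le8 o4 c4] := C16xC2_facts isoT; split=> //.
  have [x [y [_ _ _ _ o3]]] := ZnxZm_isog (isT : 1 < 4) (isT : 1 < 2) iso3.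
  move: isoI; rewrite isog_Zn // => /andP[_ /eqP oI].
  apply: (crit_small (B := powg T 4) oT le8 _ oI) => //.
  - by rewrite oI o3.
  - by rewrite subxx orbT.
case=> [[isoT o3 oI s4 s3]|].
  have [oT le8 o4 c4] := C16xC2_facts isoT; split=> //.
  apply: (crit_small (B := powg T 4) oT le8 _ oI) => //.
  - by rewrite oI o3.
  - by rewrite subxx orbT.
case=> [[isoT iso3 I1]|].
  have [oT le8 o4 c4] := C16xC2_facts isoT; split=> //.
  move: iso3; rewrite isog_Zn // => /andP[c3 /eqP o3].
  have oI : #|powg T 2 :&: g3| = 1%N by rewrite I1 cards1.
  (* It is a proper subgroup of a group of order 2. *)
  have g4_1 : g4 = 1%G.
    have nt3 : g3 :!=: 1 by rewrite -cardG_gt1 o3.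
    apply/group_inj/eqP; rewrite trivg_card_le1.
    by have := proper_card (strict34 nt3); rewrite o3.
  apply: (crit_small (B := powg T 4) oT le8 _ oI) => //.
  - by rewrite oI o3.
  - by rewrite g4_1 sub1G.
  - have [z def3] := cyclicP c3.
    have z2 : z ^+ 2 = 1 by apply/eqP; rewrite -order_dvdn orderE -def3 o3.
    by rewrite {1}def3 powg_cycle /= z2 cycle1 sub1G.
  - by rewrite subxx orbT.
case=> [[isoT sT2 iso3 s4]|].
  have [x [y [_ _ _ _ oT]]] := ZnxZm_isog (isT : 1 < 8) (isT : 1 < 4) isoT.
  by split=> //; apply: crit_big.
case=> [[isoT iso3 oI s4 s3]|].
  have [x [y [defT _ _ _ oT]]] := ZnxZm_isog (isT : 1 < 8) (isT : 1 < 4) isoT.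
  have [o3 oP cP] := C8_powg iso3.
  have le8 : 8 <= #|powg T 2| by have := powg_index defT; rewrite oT (leq_pmul2l (m := 4) (n1 := 8)).
  split=> //; apply: (crit_small (B := powg g3 2) oT le8 _ oI) => //.
  - by rewrite oI o3.
  - by rewrite subxx.
have cardC : T \isog C8xC2xC2 -> #|T| = 32.
  move=> isoT; rewrite (card_isog isoT).
  transitivity #|{: 'Z_8 * 'Z_2 * 'Z_2}|; last by rewrite !card_prod !card_ord.
  by apply: eq_card => q; rewrite !inE.
case=> [[/cardC oT sT2 iso3 s4]|]; first by split=> //; apply: crit_big.
case=> [[/cardC oT iso3 oI s4 s3]|].
  have [o3 oP cP] := C8_powg iso3; split=> //.
  apply: (crit_of_square (B := powg g3 2)) => //; last by rewrite subxx.
  have le4 : 4 <= #|powg T 2| by rewrite -oP subset_leq_card // powg_mono.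
  have := card_join_powg; rewrite o3 oI mulnC => le_h.
  by rewrite -(leq_pmul2r (isT : 0 < 2)) (leq_trans _ le_h) // (leq_mul2r 8 4).
have big m : isS32 T m -> powg T 2 \subset g3 -> g3 \isog C8xC2 ->
    g4 = powg g3 2 :> {set gT} -> #|T| = 32 /\ crit.
  move=> ST sT2 iso3 e4; have oT := card32_big (isS32_card_le ST) iso3.
  by split=> //; apply: crit_big; rewrite ?e4.
case=> [[ST sT2 iso3 e4 _]|]; first by case: ST => ST; apply: big ST sT2 iso3 e4.
case=> [[ST iso3 s4 [e1 e2] _]|].
  have [oT le8] := metacyclic_facts (isT : (4 == 4) || (4 == 17)) ST.
  have [o3 oP cP] := C8_powg iso3; split=> //.
  have oI : #|powg T 2 :&: g3| = 4 by rewrite e1 e2.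
  apply: (crit_small (B := powg g3 2) oT le8 _ oI) => //.
  - by rewrite oI o3.
  - by rewrite e2.
  - by rewrite -e2 -e1.
  - by rewrite subxx.
case=> [[ST sT2 iso3 e4 _]|]; first exact: big ST sT2 iso3 e4.
case=> [[ST _ alt]|]; last by case=> ST sT2 iso3 e4 _; apply: big ST sT2 iso3 e4.
have [oT le8] := metacyclic_facts (isT : (17 == 4) || (17 == 17)) ST.
case: alt => [[sT2 iso3 e4]|[iso3 e1 e2 e3]|[iso3 s3 e1 e2 iso4]].
- exact: big ST sT2 iso3 e4.
- have [o3 oP cP] := C8_powg iso3; split=> //.
  have oI : #|powg T 2 :&: g3| = 4 by rewrite e1 e2.
  apply: (crit_small (B := powg g3 2) oT le8 _ oI) => //.
  - by rewrite oI o3.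
  - by rewrite e2.
  - by rewrite e3.
  - by rewrite subxx.
- move: iso4; rewrite isog_Zn // => /andP[c4 /eqP o4]; split=> //.
  have [x [y [_ _ _ _ o3]]] := ZnxZm_isog (isT : 1 < 4) (isT : 1 < 2) iso3.
  have oI : #|powg T 2 :&: g3| = 4 by rewrite e1 e2.
  apply: (crit_small (B := powg T 4) oT le8 _ oI) => //.
  - by rewrite oI o3.
  - by rewrite e2.
  - by rewrite -e2 -e1.
  - by rewrite subxx orbT.
Qed.

End Shape.

(** * From the criterion to the list of groups *)

Lemma pow2_divisor r d :
  d %| 2 ^ r.+1 -> ~~ (d %| 2 ^ r.-1) -> d != (2 ^ r.+1)%N -> d = (2 ^ r)%N.
Proof.
case/dvdn_pfactor=> // m le_m -> nd neq; congr (2 ^ _)%N.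
have lt_m : m != r.+1 by apply: contra neq => /eqP->.
have : ~~ (m <= r.-1) by apply: contra nd => le; rewrite dvdn_exp2l.
by lia.
Qed.

Section CyclicFour.
Context (gT : finGroupType).
Implicit Types (A B Q : {group gT}) (u x y : gT).

Lemma cyclic4_sq1 Q u : cyclic Q -> #|Q| = 4 -> u \in Q -> u ^+ 2 = 1 ->
  u \in powg Q 2.
Proof.
move=> cQ oQ uQ u2; have [q defQ] := cyclicP cQ.
move: uQ; rewrite {1}defQ => /cycleP[i ui].
have : #[q] %| i * 2 by rewrite order_dvdn expgM -ui u2.
rewrite orderE -defQ oQ -[4]/(2 * 2)%N dvdn_pmul2r // => /dvdnP[k i_E].
rewrite ui i_E expgM; apply: mem_powg.
by rewrite defQ mem_cycle.
Qed.

Lemma cycle2P u w : #[w] = 2 -> u \in <[w]> -> u = 1 \/ u = w.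
Proof.
move=> ow /cycleP[i ->]; rewrite -(expg_mod_order w i) ow modn2.
by case: odd; [right|left].
Qed.

Lemma mem_join2 x y : (x \in <[x]> <*> <[y]>) && (y \in <[x]> <*> <[y]>).
Proof. by rewrite -!cycle_subG joing_subl joing_subr. Qed.

Lemma mem_join3 x y u : [/\ x \in <[x]> <*> <[y]> <*> <[u]>,
  y \in <[x]> <*> <[y]> <*> <[u]> & u \in <[x]> <*> <[y]> <*> <[u]> ].
Proof.
have /andP[xW yW] := mem_join2 x y.
by split; rewrite -?cycle_subG ?joing_subr //; apply: subset_trans (joing_subl _ _);
  rewrite cycle_subG.
Qed.

Lemma invol_exp (w : gT) i : w ^+ 2 = 1 -> w ^+ i = w ^+ odd i.
Proof.
by move=> w2; rewrite -{1}(odd_double_half i) expgD -mul2n expgM w2 expg1n mulg1.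
Qed.

Lemma abelian_exp_powg A n (X : {set gT}) (B : {group gT}) :
    abelian A -> B \subset A -> B :=: <<X>> ->
  (forall x, x \in X -> x ^+ n = 1) -> forall x, x \in B -> x ^+ n = 1.
Proof.
move=> abA sBA defB X1 x xB; apply/set1P.
apply: (@pow_pre_sub _ A 1%G n B _ (sub1G _) sBA) => //.
  by rewrite -[[~: A, A]]/(A^`(1)) (derG1P abA).
by exists X => // y /X1->; rewrite group1.
Qed.

Lemma powg2_cyclic4_nontriv Q : cyclic Q -> #|Q| = 4 ->
  ~ (forall u, u \in Q -> u ^+ 2 = 1).
Proof.
move=> cQ oQ Q1; have := cyclic4_powg_card cQ oQ.
suff -> : powg Q 2 = 1%G by rewrite cards1.
by apply/group_inj/trivgP/powg_sub => u /Q1->; rewrite inE.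
Qed.

Lemma cycle_powg2_card (z : gT) r : #[z] = (2 ^ r.+1)%N ->
  #|powg <[z]> 2| = (2 ^ r)%N.
Proof.
move=> oz; rewrite powg_cycle /= -orderE orderXdiv oz ?expnS ?dvdn_mulr //.
by rewrite mulKn.
Qed.

(** An element of order 16 would give 8 squares, and exponent 4 would leave only involutions among
    the squares; so some element has order 8 and [abelian_split] applies. *)
Lemma abelian16_split A : abelian A -> #|A| = 16 -> cyclic (powg A 2) ->
    #|powg A 2| = 4 ->
  exists x y, [/\ x \in A, y \in A, #[x] = 8, y ^+ 2 = 1 & A :=: <[x]> <*> <[y]> ].
Proof.
move=> abA oA cQ oQ.
have no16 z : z \in A -> #[z] != 16.
  move=> zA; apply/eqP => oz.
  have defA : A :=: <[z]> by apply/eqP; rewrite eq_sym eqEcard cycle_subG zA oA -orderE oz.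
  by move: oQ; rewrite {1}defA (@cycle_powg2_card z 3).
have [x xA x4] : exists2 x, x \in A & x ^+ 4 != 1.
  have [/existsP[x /andP[xA x4]]|] := boolP [exists x, (x \in A) && (x ^+ 4 != 1)].
    by exists x.
  rewrite negb_exists => /forallP A4; case: (powg2_cyclic4_nontriv cQ oQ).
  apply: (abelian_exp_powg abA (powgS A 2) (erefl _)) => _ /imsetP[x xA ->].
  by have := A4 x; rewrite xA negbK -expgM => /eqP.
have ox : #[x] = 8.
  apply: (@pow2_divisor 3); last exact: no16.
    by rewrite -[(2 ^ 4)%N]oA order_dvdG.
  by rewrite order_dvdn.
have [|y [yA y2 defA]] := abelian_split (r := 3) abA isT oA xA ox.
  exact: no16.
by exists x, y.
Qed.

End CyclicFour.

Section ShapeOfCrit.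
Context (gT : finGroupType) (T g3 g4 g5 : {group gT}).
Hypothesis oT : #|T| = 32.
Hypothesis g3T : g3 \proper T.
Hypothesis n5 : T \subset 'N(g5).
Hypothesis s43 : g4 \subset g3.
Hypothesis s54 : g5 \subset g4.
Hypothesis R1 : [~: T, T] \subset g4.
Hypothesis R2 : [~: g3, T] \subset g5.
Hypothesis ab3 : abelian g3.
Hypothesis strict34 : g3 :!=: 1 -> g4 \proper g3.
Hypothesis strict45 : g4 :!=: 1 -> g5 \proper g4.
Hypothesis abT4 : abelian T -> #|powg T 4| <= 2 -> forall x, x \in g3 -> x ^+ 4 = 1.

Let H := (g3 <*> powg T 2)%G.
Let Q := powg H 2.
Hypothesis oH : #|H| = 16.
Hypothesis cQ : cyclic Q.
Hypothesis oQ : #|Q| = 4.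
Hypothesis g4Q : g4 \subset Q.
Hypothesis g5Q : g5 \subset powg Q 2.

Let sg3T : g3 \subset T := proper_sub g3T.
Let sHT : H \subset T. Proof. by rewrite join_subG sg3T powgS. Qed.
Let pT : 2.-group T. Proof. by rewrite /pgroup oT. Qed.

Lemma powg4_sub_Q : powg T 4 \subset Q.
Proof.
apply: powg_sub => t tT; rewrite (expgM t 2 2); apply: mem_powg.
by apply: (subsetP (joing_subr _ _)); apply: mem_powg.
Qed.

Lemma powg_g3_sub_Q : powg g3 2 \subset Q.
Proof. exact: powg_mono (joing_subl _ _). Qed.

(** H has index 2, so T = <a> gamma_3(G) T^2, and T^2 is absorbed by the Frattini subgroup. *)
Lemma T_generator : exists2 a, a \in T & T :=: <[a]> <*> g3.
Proof.
have [a aT aH] : exists2 a, a \in T & a \notin H.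
  by apply/subsetPn; apply/negP => /subset_leq_card; rewrite oT oH.
exists a => //; rewrite -[RHS]genGid; apply/esym; apply: Phi_nongen.
have sXT : <[a]> <*> H \subset T by rewrite join_subG cycle_subG aT.
have eqT : <[a]> <*> H = T.
  apply/eqP; rewrite eqEcard sXT oT leq_eqVlt; apply/orP; left; apply/eqP/esym.
  apply: dvdn32_gt16; last by rewrite -oT cardSg.
  rewrite -oH; apply: proper_card; rewrite properE joing_subr /=.
  apply: contra aH => /subsetP; apply; by rewrite mem_gen // inE cycle_id.
apply/eqP; rewrite eqEsubset join_subG Phi_sub join_subG cycle_subG aT sg3T /=.
rewrite -{1}eqT !join_subG /=; apply/and3P; split.
- exact: subset_trans (joing_subl _ _) (joing_subr _ _).
- exact: subset_trans (joing_subr _ _) (joing_subr _ _).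
- exact: subset_trans (powg_Phi pT) (joing_subl _ _).
Qed.

(** * Abelian commutator subgroup *)

Section AbelianCase.
Hypothesis abT : abelian T.

(** If T had exponent dividing 8, T^4 would be an exponent 2 subgroup of the cyclic group Q, hence
    of order at most 2. Then [abT4] gives gamma_3(G), and with it H, exponent dividing 4, so Q would
    have exponent 2. *)
Lemma abelian_order16 : exists2 t, t \in T & #[t] = 16.
Proof.
have no32 z : z \in T -> #[z] != 32.
  move=> zT; apply/eqP => oz.
  have defT : T :=: <[z]> by apply/eqP; rewrite eq_sym eqEcard cycle_subG zT oT -orderE oz.
  have /cyclicP[h defH] : cyclic H by apply: cyclicS sHT _; rewrite defT cycle_cyclic.
  have oh : #[h] = 16 by rewrite orderE -defH oH.
  by move: oQ; rewrite /Q defH (@cycle_powg2_card _ h 3).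
have [/existsP[t /andP[tT t8]]|] := boolP [exists t, (t \in T) && (t ^+ 8 != 1)].
  exists t => //; apply: (@pow2_divisor 4); last exact: no32.
    by rewrite -[(2 ^ 5)%N]oT order_dvdG.
  by rewrite order_dvdn.
rewrite negb_exists => /forallP T8'.
have T8 t : t \in T -> t ^+ 8 = 1.
  by move=> tT; have := T8' t; rewrite tT negbK => /eqP.
case: (powg2_cyclic4_nontriv cQ oQ).
have le2 : #|powg T 4| <= 2.
  have s : powg T 4 \subset powg Q 2; last first.
    by have := subset_leq_card s; rewrite (cyclic4_powg_card cQ oQ).
  apply: powg_sub => t tT; apply: cyclic4_sq1 => //.
    by apply: (subsetP powg4_sub_Q); apply: mem_powg.
  by rewrite -expgM T8.
have g34 := abT4 abT le2.
have H4 : forall h, h \in H -> h ^+ 4 = 1.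
  apply: (abelian_exp_powg (X := g3 :|: [set t ^+ 2 | t in T]) abT sHT).
    by rewrite /= joing_idr.
  move=> x; rewrite inE => /orP[/g34//|/imsetP[t tT ->]].
  by rewrite -expgM T8.
apply: (abelian_exp_powg abT _ (erefl _)) => [|_ /imsetP[h hH ->]].
  exact: subset_trans (powgS _ _) sHT.
by rewrite -expgM H4.
Qed.

Lemma abelian_shape : shape T g3 g4 g5.
Proof.
have [t tT ot] := abelian_order16.
have no32 z : z \in T -> #[z] != 32.
  move=> zT; apply/eqP => oz.
  have defT : T :=: <[z]> by apply/eqP; rewrite eq_sym eqEcard cycle_subG zT oT -orderE oz.
  have /cyclicP[h defH] : cyclic H by apply: cyclicS sHT _; rewrite defT cycle_cyclic.
  have oh : #[h] = 16 by rewrite orderE -defH oH.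
  by move: oQ; rewrite /Q defH (@cycle_powg2_card _ h 3).
have [y [yT y2 defT]] := abelian_split (r := 4) abT isT oT tT ot no32.
have cty : commute t y by apply: (centsP abT).
have t16 : t ^+ 16 = 1 by rewrite -ot expg_order.
have isoT : T \isog C16xC2 by exact: (@isog_ZnxZm _ T t y 16 2 isT isT oT defT t16 y2 cty).
have y4 : y ^+ 4 = 1 by rewrite (expgM y 2 2) y2 expg1n.
have P2 := powg_two_gen defT cty y2; have P4 := powg_two_gen defT cty y4.
have oP2 : #|powg T 2| = 8 by rewrite P2 /= -orderE orderXdiv ot.
have oP4 : #|powg T 4| = 4 by rewrite P4 /= -orderE orderXdiv ot.
have cP2 : cyclic (powg T 2) by rewrite P2 cycle_cyclic.
have cP4 : cyclic (powg T 4) by rewrite P4 cycle_cyclic.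
have QP4 : Q = powg T 4.
  by apply/group_inj/eqP; rewrite eq_sym eqEcard powg4_sub_Q oQ oP4.
have g4P : g4 \subset powg T 4 by rewrite -QP4.
have g3P : powg g3 2 \subset powg T 4 by rewrite -QP4 powg_g3_sub_Q.
set I := powg T 2 :&: g3.
(* Orders in H = gamma_3(G) T^2: |gamma_3(G)| * 8 = 16 * |I|. *)
have card3 : #|g3| = (2 * #|I|)%N.
  have eqH : g3 * powg T 2 = H.
    rewrite /= norm_joinEl //; apply: subset_trans sg3T _.
    by rewrite sub_abelian_norm // powgS.
  have := mul_cardG g3 (powg T 2); rewrite eqH oH oP2 setIC -/I.
  by move/eqP; rewrite (mulnC 16) -[16%N]/(2 * 8)%N mulnA (eqn_pmul2r (m := 8)) // mulnC => /eqP.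
have cI : cyclic I := cyclicS (subsetIl _ _) cP2.
have /(dvdn_pfactor _ 3 (isT : prime 2))[m le_m oI] : #|I| %| 2 ^ 3.
  by rewrite -[(2 ^ 3)%N]oP2 cardSg // subsetIl.
have exp3 x : x \in g3 -> x \in T by apply: (subsetP sg3T).
(* The order of gamma_3(G) is 2, 4, 8 or 16. At 8 the two alternatives are separated by the
   existence of an element of order 8. *)
case: m le_m oI => [|[|[|[|//]]]] _ oI; rewrite oI in card3.
- do 4!right; left; split=> //.
    by rewrite isog_Zn // prime_cyclic ?card3.
  by apply/eqP; rewrite trivg_card1 oI.
- by do 3!right; left; split.
- have oP3 : #|g3| = 8 by rewrite card3.
  have [/existsP[x /andP[x3 /eqP ox]]|no8] := boolP [exists x, (x \in g3) && (#[x] == 8)].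
    have def3 : g3 :=: <[x]>.
      by apply/eqP; rewrite eq_sym eqEcard cycle_subG x3 oP3 -orderE ox.
    have c3 : cyclic g3 by rewrite def3 cycle_cyclic.
    have o32 : #|powg g3 2| = 4 by rewrite {1}def3 (@cycle_powg2_card _ x 2).
    right; left; split=> //; first by rewrite isog_Zn // c3 oP3.
    have eI : powg g3 2 = I :> {set gT}.
      apply/eqP; rewrite eqEcard o32 oI andbT.
      by rewrite -(cardSg_cyclic c3) ?powgS ?subsetIr // o32 oI.
    split=> //; last by rewrite isog_Zn // cI oI.
    by apply/eqP; rewrite eq_sym eqEcard g3P o32 oP4.
  do 2!right; left; split=> //; last by rewrite isog_Zn // cI oI.
  have [s defI] := cyclicP cI; have os : #[s] = 4 by rewrite orderE -defI oI.
  have s3 : s \in g3.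
    by apply: (subsetP (subsetIr (powg T 2) g3)); rewrite -/I defI cycle_id.
  have [z z3|v [v3 v2 def3]] := abelian_split (r := 2) ab3 isT oP3 s3 os.
    by apply: contra no8 => oz; apply/existsP; exists z; rewrite z3.
  apply: (@isog_ZnxZm _ g3 s v 4 2 isT isT oP3 def3) => //.
    by rewrite -os expg_order.
  exact: (centsP ab3).
- have o3 : #|g3| = 16 by rewrite card3.
  have eqH : H = g3.
    by apply/group_inj/eqP; rewrite eq_sym eqEcard joing_subl oH o3.
  left; split=> //; first by rewrite -[in X in _ \subset X]eqH joing_subr.
    have := oQ; have := cQ; rewrite /Q eqH => cQ3 oQ3.
    have [x [v [x3 v3 ox v2 def3]]] := abelian16_split ab3 o3 cQ3 oQ3.
    apply: (@isog_ZnxZm _ g3 x v 8 2 isT isT o3 def3) => //.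
      by rewrite -ox expg_order.
    exact: (centsP ab3).
  by rewrite -[in X in powg X 2]eqH.
Qed.

End AbelianCase.

(** * Nonabelian commutator subgroup *)

Section NonabelianCase.
Hypothesis nabT : ~~ abelian T.

Lemma T_abelian_gen a : T :=: <[a]> <*> g3 ->
  (forall v, v \in g3 -> commute v a) -> abelian T.
Proof.
move=> defT ca; rewrite defT abelianY cycle_abelian ab3 /=.
by apply/centsP => v v3 _ /cycleP[i ->]; apply: commuteX; apply: ca.
Qed.

(** Modulo gamma_5(G) the subgroup gamma_3(G) is central in T, and T is generated by it and one more
    element. *)
Lemma der_sub_g5 : [~: T, T] \subset g5.
Proof.
have [a aT defT] := T_generator.
have sg5T : g5 \subset T := subset_trans s54 (subset_trans s43 sg3T).
apply: der1_min => //; rewrite {1}defT quotientY; last 2 first.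
- by rewrite cycle_subG (subsetP n5).
- exact: subset_trans sg3T n5.
rewrite abelianY !quotient_abelian ?cycle_abelian //=.
apply: quotient_cents2r; apply: subset_trans R2; apply: commgS.
by rewrite cycle_subG.
Qed.

Lemma card_g5 : #|g5| = 2.
Proof.
have nt5 : g5 :!=: 1.
  apply: contra nabT => /eqP g51; apply/commG1P/eqP.
  by rewrite -subG1 -g51 der_sub_g5.
apply/eqP; rewrite eqn_leq cardG_gt1 nt5 andbT.
by rewrite -(cyclic4_powg_card cQ oQ) subset_leq_card.
Qed.

Lemma g5_E : g5 :=: powg Q 2.
Proof. by apply/eqP; rewrite eqEcard g5Q card_g5 (cyclic4_powg_card cQ oQ). Qed.

(** The order of gamma_4(G) divides 4 and exceeds that of gamma_5(G), which is 2. *)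
Lemma g4_E : g4 :=: Q.
Proof.
apply/eqP; rewrite eqEcard g4Q oQ /=.
have nt4 : g4 :!=: 1.
  by rewrite -cardG_gt1 -card_g5 subset_leq_card.
have lt2 := proper_card (strict45 nt4); rewrite card_g5 in lt2.
have := cardSg g4Q; rewrite oQ; move: #|g4| lt2 => k.
by case: k => [|[|[|[|]]]].
Qed.

Lemma g5_iso : g5 \isog C2.
Proof. by rewrite isog_Zn // prime_cyclic card_g5. Qed.

Lemma comm_g3 w v a : g5 :=: <[w]> -> #[w] = 2 -> v \in g3 -> a \in T ->
  v ^ a = v \/ v ^ a = v * w.
Proof.
move=> def5 ow v3 aT; have : [~ v, a] \in g5.
  by apply: (subsetP R2); apply: mem_commg.
rewrite def5 => /(cycle2P ow); rewrite commgEl => -[] eq_v.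
  by left; rewrite -[RHS]mulg1 -eq_v mulKVg.
by right; rewrite -eq_v mulKVg.
Qed.

Section Order16.
Context (a x y : gT).
Hypothesis aT : a \in T.
Hypothesis defT : T :=: <[a]> <*> g3.
Hypothesis x3 : x \in g3.
Hypothesis y3 : y \in g3.
Hypothesis ox : #[x] = 8.
Hypothesis y2 : y ^+ 2 = 1.
Hypothesis def3 : g3 :=: <[x]> <*> <[y]>.
Hypothesis a2 : a ^+ 2 \in g3.

Let cxy : commute x y. Proof. exact: (centsP ab3). Qed.
Let x8 : x ^+ 8 = 1. Proof. by rewrite -ox expg_order. Qed.

Let a2E : exists i e, a ^+ 2 = x ^+ i * y ^+ e.
Proof.
move: a2; rewrite def3 norm_joinEr; last first.
  by rewrite cents_norm // cent_cycle cycle_subG; apply/cent1P.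
by case/mulsgP=> _ _ /cycleP[i ->] /cycleP[e ->] ->; exists i, e.
Qed.

Lemma T_gens3 b : b \in T -> a \in <[x]> <*> <[y]> <*> <[b]> ->
  T :=: <[x]> <*> <[y]> <*> <[b]>.
Proof.
move=> bT ab; apply/eqP; rewrite eqEsubset; apply/andP; split.
  by rewrite defT join_subG cycle_subG ab def3 joing_subl.
by rewrite join_subG -def3 sg3T cycle_subG.
Qed.

(** Since a^2 = x^i y^e commutes with a, the exponent i is even, i = 2k. Then b = a x^k acts as a
    does and b^2 = x^(2k + 6k) y^e = y^e. If this is 1, then T = <x, b> x <y>; otherwise it is y,
    and T = <x> <b> with b of order 4. *)
Lemma order16_type1 : x ^ a = x ^+ 5 -> y ^ a = y -> isS32 T 37 \/ isS32 T 4.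
Proof.
move=> xa ya; have [i [e a2_E]] := a2E.
have /eqP : a ^+ 2 ^ a = a ^+ 2 by rewrite conjXg conjgE mulKg.
rewrite a2_E conjMg !conjXg xa ya (inj_eq (mulIg _)) -expgM.
rewrite eq_expg_mod_order ox => eq_i.
have [k i_E] : exists k, i = (2 * k)%N.
  have : 4 * i = 0 %[mod 8].
    apply/eqP; rewrite -(eqn_modDr i) -mulSnr add0n //.
  move/eqP; rewrite mod0n -[8]/(4 * 2)%N -/(dvdn _ _) dvdn_pmul2l // => /dvdnP[k ->].
  by exists k; rewrite mulnC.
pose b := a * x ^+ k.
have b2 : b ^+ 2 = y ^+ e.
  have -> : b ^+ 2 = a ^+ 2 * x ^+ (6 * k).
    rewrite expg2 /b mulgA -(mulgA a) [x ^+ k * a]conjgC conjXg xa mulgA -expg2.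
    by rewrite -!mulgA -expgM -expgD -[k in (_ + k)%N]mul1n -mulnDl.
  rewrite a2_E -mulgA [y ^+ e * _]commuteX2; last exact: commute_sym.
  by rewrite mulgA -expgD i_E -mulnDl expgM x8 expg1n mul1g.
have xb : x ^ b = x ^+ 5.
  rewrite /b conjgM xa conjgE; have : commute (x ^+ 5) (x ^+ k) by apply: commuteX2.
  by move=> ->; rewrite mulKg.
have yb : commute y b.
  apply: commuteM; last by apply: commuteX; apply: commute_sym.
  by apply/commgP/conjg_fixP.
have bT : b \in T by rewrite groupM // groupX // (subsetP sg3T).
have genT : T :=: <[x]> <*> <[y]> <*> <[b]>.
  apply: T_gens3 => //; have -> : a = b * (x ^+ k)^-1 by rewrite mulgK.
  by have [xW _ bW] := mem_join3 x y b; rewrite groupM ?groupV ?groupX.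
have [ye|ye] : y ^+ e = 1 \/ y ^+ e = y.
  by rewrite (invol_exp e y2); case: (odd e); [right; rewrite expg1|left].
- left; apply: isS32_refl; apply: (@S37_isoGrp _ T x b y) => //.
  + by rewrite genT -!joingA (joingC <[y]>).
  + by rewrite b2.
- right; apply: isS32_refl; apply: (@metacyclic_isoGrp _ T x b 8 4 5) => //.
    apply/eqP; rewrite eqEsubset {1}genT !join_subG !cycle_subG bT (subsetP sg3T) //.
    rewrite andbT -andbA -ye -b2; apply/and3P; split; rewrite ?groupX // mem_gen // inE cycle_id ?orbT //.
  by rewrite (expgM b 2 2) b2 ye y2.
Qed.

(** Now a^2 commuting with a forces e even, so a^2 = x^i. For odd i, a has order 16 and a^y = a^9.
    For i = 2k, a x^(-k) is an involution which with y generates a dihedral group of order 8 meeting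
    <x> in <x^4>. *)
Lemma order16_type2 : x ^ a = x -> y ^ a = y * x ^+ 4 -> isS32 T 38 \/ isS32 T 17.
Proof.
move=> xa ya; have [i [e a2_E]] := a2E.
have cxa : commute x a by apply/commgP/conjg_fixP.
have w2 : x ^+ 4 ^+ 2 = 1 by rewrite -expgM.
have cyw : commute y (x ^+ 4) by apply: commuteX; apply: commute_sym.
have a2x : exists i, a ^+ 2 = x ^+ i.
  exists i; have /eqP : a ^+ 2 ^ a = a ^+ 2 by rewrite conjXg conjgE mulKg.
  rewrite a2_E conjMg !conjXg xa ya (inj_eq (mulgI _)) expgMn //.
  rewrite -{2}[y ^+ e]mulg1 (inj_eq (mulgI _)) -expgM -order_dvdn ox.
  rewrite -[8]/(4 * 2)%N dvdn_pmul2l // => /dvdnP[k ->].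
  by rewrite mulnC expgM y2 expg1n mulg1.
case: a2x => {i a2_E} i a2_E; pose k := i./2.
have wg5 : commute (x ^+ 4) a by apply: commute_sym; apply: commuteX; apply: commute_sym.
have [odd_i|even_i] := boolP (odd i).
  right; apply: isS32_refl.
  have a8 : a ^+ 8 = x ^+ 4.
    by rewrite (expgM a 2 4) a2_E expgAC (invol_exp i w2) odd_i.
  apply: (@metacyclic_isoGrp _ T a y 16 2 9) => //.
  - have /andP[aW yW] := mem_join2 a y.
    have xW : x \in <[a]> <*> <[y]>.
      have /cycleP[m ->] : x \in <[x ^+ i]>.
        have : generator <[x]> (x ^+ i).
          by rewrite generator_coprime ox -[8]/(2 ^ 3)%N coprimeXl // coprime2n.
        by move/eqP <-; apply: cycle_id.
      by rewrite -a2_E -expgM groupX.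
    apply/eqP; rewrite eqEsubset; apply/andP; split.
      by rewrite defT def3 !join_subG !cycle_subG aW xW.
    by rewrite join_subG !cycle_subG aT (subsetP sg3T).
  - by rewrite (expgM a 8 2) a8.
  have -> : a ^ y = a * [~ a, y] by rewrite commgEl mulKVg.
  rewrite (expgD a 1 8) a8 expg1 -invgR commgEl ya mulKg.
  by congr (_ * _); apply/eqP; rewrite eq_invg_mul -expg2 w2.
left; apply: isS32_refl.
have i_E : i = (2 * k)%N by rewrite mul2n -[LHS]odd_double_half (negbTE even_i).
pose b := a * (x ^+ k)^-1.
have cxb : commute x b.
  by apply: commuteM => //; apply: commuteV; apply: commuteX.
have cab : commute a (x ^+ k)^-1.
  by apply: commuteV; apply: commuteX; apply: commute_sym.
have b2 : b ^+ 2 = 1.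
  by rewrite expgMn // a2_E i_E mulnC expgM expVgn mulgV.
have bT : b \in T by rewrite groupM // groupV groupX // (subsetP sg3T).
have genT : T :=: <[x]> <*> <[y]> <*> <[b]>.
  apply: T_gens3 => //; have -> : a = b * x ^+ k by rewrite mulgVK.
  by have [xW _ bW] := mem_join3 x y b; rewrite groupM ?groupV ?groupX.
apply: (@S38_isoGrp _ T x y b) => //.
have yb : y ^ b = y * x ^+ 4.
  rewrite conjgM ya conjMg; congr (_ * _); apply/conjg_fixP/commgP.
    by apply: commuteV; apply: commuteX; apply: commute_sym.
  by apply: commuteV; apply: commuteX2.
by rewrite commgEl yb mulKg.
Qed.
End Order16.

Lemma square_mem_H a : a \in T -> a ^+ 2 \in H.
Proof.
by move=> aT; apply: (subsetP (joing_subr _ _)); apply: mem_powg.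
Qed.

Lemma shape16 : #|g3| = 16 -> shape T g3 g4 g5.
Proof.
move=> o3; have eqH : H = g3.
  by apply/group_inj/eqP; rewrite eq_sym eqEcard joing_subl oH o3.
have eqQ : Q = powg g3 2 by rewrite /Q eqH.
have sT2 : powg T 2 \subset g3 by rewrite -eqH joing_subr.
have e4 : g4 = powg g3 2 :> {set gT} by rewrite g4_E eqQ.
have cP : cyclic (powg g3 2) by rewrite -eqQ.
have oP : #|powg g3 2| = 4 by rewrite -eqQ.
have [x [y [x3 y3 ox y2 def3]]] := abelian16_split ab3 o3 cP oP.
have cxy : commute x y := centsP ab3 _ x3 _ y3.
have x8 : x ^+ 8 = 1 by rewrite -ox expg_order.
have iso3 : g3 \isog C8xC2.
  exact: (@isog_ZnxZm _ g3 x y 8 2 isT isT o3 def3 x8 y2 cxy).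
have [a aT defT] := T_generator.
have a2 : a ^+ 2 \in g3 by rewrite -eqH square_mem_H.
have def5 : g5 :=: <[x ^+ 4]>.
  by rewrite g5_E eqQ (powg_two_gen def3 cxy y2) powg_cycle -expgM.
have ow : #[x ^+ 4] = 2 by rewrite orderE -def5 card_g5.
have w2 : x ^+ 4 ^+ 2 = 1 by rewrite -expgM.
have done37 : isS32 T 37 -> shape T g3 g4 g5.
  by move=> S; do 11!right; left; split=> //; apply: g5_iso.
have done4 : isS32 T 4 -> shape T g3 g4 g5.
  by move=> S; do 9!right; left; split=> //; [constructor 1|apply: g5_iso].
have done38 : isS32 T 38 -> shape T g3 g4 g5.
  by move=> S; do 13!right; split=> //; apply: g5_iso.
have done17 : isS32 T 17 -> shape T g3 g4 g5.
  move=> S; do 12!right; left; split=> //; first exact: g5_iso.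
  by constructor 1.
case: (comm_g3 def5 ow x3 aT) => xa; case: (comm_g3 def5 ow y3 aT) => ya.
- case/negP: nabT; apply: T_abelian_gen defT _ => v.
  rewrite def3 norm_joinEr; last first.
    by rewrite cents_norm // cent_cycle cycle_subG; apply/cent1P.
  case/mulsgP=> _ _ /cycleP[i ->] /cycleP[k ->] ->.
  have cxa : commute x a by apply/commgP/conjg_fixP.
  have cya : commute y a by apply/commgP/conjg_fixP.
  apply: commute_sym; apply: commuteM; apply: commuteX; exact: commute_sym.
- by case: (order16_type2 aT defT x3 y3 ox y2 def3 a2 xa ya).
- have xa5 : x ^ a = x ^+ 5 by rewrite xa -[x in x * _]expg1 -expgD.
  by case: (order16_type1 aT defT x3 y3 ox y2 def3 a2 xa5 ya).
(* When a moves both generators it fixes their product, since x^4 is an involution; and z^4 = x^4,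
   so z can replace x. *)
pose z := x * y.
have z4 : z ^+ 4 = x ^+ 4 by rewrite expgMn // (expgM y 2 2) y2 expg1n mulg1.
have z3 : z \in g3 by rewrite groupM.
have oz : #[z] = 8.
  apply: (@pow2_divisor 3).
  - by rewrite -[(2 ^ 4)%N]o3 order_dvdG.
  - by rewrite order_dvdn z4 -order_dvdn ox.
  - apply/eqP => oz; have : z ^+ 4 ^+ 2 = 1 by rewrite z4.
    by rewrite -expgM => /eqP; rewrite -order_dvdn oz.
have defz : g3 :=: <[z]> <*> <[y]>.
  have /andP[zW yW] := mem_join2 z y.
  apply/eqP; rewrite eqEsubset; apply/andP; split.
    rewrite def3 join_subG !cycle_subG yW andbT.
    by have -> : x = z * y^-1; [rewrite mulgK|rewrite groupM ?groupV].
  by rewrite join_subG !cycle_subG z3.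
have za : z ^ a = z.
  have cyw : commute y (x ^+ 4) by apply: commuteX; apply: commute_sym.
  rewrite conjMg xa ya; set w := x ^+ 4 in cyw w2 *.
  by rewrite -(mulgA x) (mulgA w) -cyw -(mulgA y) -expg2 w2 mulg1.
by case: (order16_type2 aT defT z3 y3 oz y2 defz a2 za _) => //; rewrite z4.
Qed.

(** Otherwise gamma_3(G) lies in the Frattini subgroup, and T = <a> is cyclic. *)
Lemma meet_proper : ~~ (g3 \subset powg T 2).
Proof.
have [a aT defT] := T_generator; apply: contra nabT => s3.
have : <<(<[a]>)>> = T.
  apply: Phi_nongen; apply/eqP; rewrite eqEsubset join_subG Phi_sub cycle_subG aT /=.
  rewrite {1}defT join_subG joing_subr /=.
  exact: subset_trans s3 (subset_trans (powg_Phi pT) (joing_subl _ _)).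
by rewrite genGid => <-; apply: cycle_abelian.
Qed.

Lemma meet_eq : #|g3| = 8 -> Q \subset powg T 2 -> powg T 2 :&: g3 = Q.
Proof.
move=> o3 sQ; apply/eqP; rewrite eq_sym eqEcard subsetI sQ -g4_E s43 /= g4_E oQ.
have ltI : powg T 2 :&: g3 \proper g3.
  by rewrite properE subsetIr subsetI subxx andbT meet_proper.
have := cardSg (subsetIr (powg T 2) g3); have := proper_card ltI; rewrite o3.
by move: #|_| => k; case: k => [|[|[|[|[|[|[|[|]]]]]]]].
Qed.

(** As T is not abelian, a acts on gamma_3(G) = <x> by x -> x^5. The parity of k in a^4 = x^(2k)
    decides between the modular group and <x> extended by an element of order 4. *)
Lemma shape8_cyclic x : #|g3| = 8 -> x \in g3 -> #[x] = 8 -> shape T g3 g4 g5.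
Proof.
move=> o3 x3 ox.
have def3 : g3 :=: <[x]>.
  by apply/eqP; rewrite eq_sym eqEcard cycle_subG x3 o3 -orderE ox.
have c3 : cyclic g3 by rewrite def3 cycle_cyclic.
have iso3 : g3 \isog C8 by rewrite isog_Zn // c3 o3.
have P3 : powg g3 2 = <[x ^+ 2]>%G by rewrite {1}def3 powg_cycle.
have oP : #|powg g3 2| = 4 by rewrite P3 /= -orderE orderXdiv ox.
have eqQ : Q = powg g3 2.
  by apply/group_inj/eqP; rewrite eq_sym eqEcard powg_g3_sub_Q oQ oP.
have x8 : x ^+ 8 = 1 by rewrite -ox expg_order.
have def5 : g5 :=: <[x ^+ 4]>.
  by rewrite g5_E eqQ P3 powg_cycle -expgM.
have ow : #[x ^+ 4] = 2 by rewrite orderE -def5 card_g5.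
have w2 : x ^+ 4 ^+ 2 = 1 by rewrite -expgM.
have [a aT defT] := T_generator.
have xT := subsetP sg3T x x3.
have xa : x ^ a = x ^+ 5.
  case: (comm_g3 def5 ow x3 aT) => xa; last first.
    by rewrite xa -[x in x * _]expg1 -expgD.
  case/negP: nabT; apply: T_abelian_gen defT _ => v.
  rewrite def3 => /cycleP[i ->]; apply: commute_sym; apply: commuteX.
  by apply: commute_sym; apply/commgP/conjg_fixP.
have sQ : Q \subset powg T 2 by rewrite eqQ powg_mono.
have eqI := meet_eq o3 sQ.
have ca2 : commute x (a ^+ 2).
  apply/commgP/conjg_fixP; rewrite expg2 conjgM xa conjXg xa -expgM.
  by rewrite (expgD x (8 * 3) 1) expgM x8 expg1n mul1g.
have a4Q : a ^+ 4 \in Q by rewrite (expgM a 2 2) mem_powg // square_mem_H.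
have [k a4] : exists k, a ^+ 4 = x ^+ (2 * k).
  by move: a4Q; rewrite eqQ P3 => /cycleP[k ->]; exists k; rewrite expgM.
have done4 : isS32 T 4 -> shape T g3 g4 g5.
  move=> S; do 10!right; left; split=> //.
  - by rewrite eqI powg4_sub_Q.
  - by rewrite eqI g4_E eqQ.
  - exact: g5_iso.
have gens4 b : b \in T -> a \in <[x]> <*> <[b]> -> x ^ b = x ^+ 5 -> b ^+ 4 = 1 ->
    shape T g3 g4 g5.
  move=> bT ab xb b4; apply: done4; apply: isS32_refl.
  apply: (@metacyclic_isoGrp _ T x b 8 4 5) => //.
  apply/eqP; rewrite eqEsubset; apply/andP; split.
    by rewrite defT join_subG cycle_subG ab def3 joing_subl.
  by rewrite join_subG !cycle_subG xT.
have [odd_k|even_k] := boolP (odd k).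
  (* The fourth power a^4 = (x^k)^2 makes y an involution, and a^8 = x^(4k) = x^4 gives a order
     16. *)
  pose y := a ^+ 2 * (x ^+ k)^-1.
  have ca2k : commute (a ^+ 2) (x ^+ k)^-1.
    by apply: commuteV; apply: commuteX; apply: commute_sym.
  have y2 : y ^+ 2 = 1.
    by rewrite expgMn // -expgM a4 expVgn -expgM mulnC mulgV.
  have a8 : a ^+ 8 = x ^+ 4.
    by rewrite (expgM a 4 2) a4 -expgM mulnC mulnA expgM (invol_exp k w2) odd_k.
  have yT : y \in T by rewrite groupM ?groupX // groupV groupX.
  have ay : a ^ y = a ^+ 9.
    have -> : a ^ y = a * (x ^+ k ^ a * (x ^+ k)^-1).
      rewrite /y conjgM [a ^ (a ^+ 2)](_ : _ = a); last first.
        by apply/conjg_fixP/commgP; apply: commuteX.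
      by rewrite !conjgE invgK !mulgA mulgV mul1g.
    have -> : x ^+ k ^ a = x ^+ 4 ^+ k * x ^+ k.
      by rewrite conjXg xa -!expgM -expgD -mulSnr.
    by rewrite mulgK (invol_exp k w2) odd_k expg1 -a8 -expgS.
  have genT : T :=: <[a]> <*> <[y]>.
    have /andP[aW yW] := mem_join2 a y.
    have xW : x \in <[a]> <*> <[y]>.
      have /cycleP[m ->] : x \in <[x ^+ k]>.
        have : generator <[x]> (x ^+ k).
          by rewrite generator_coprime ox -[8]/(2 ^ 3)%N coprimeXl // coprime2n.
        by move/eqP <-; apply: cycle_id.
      rewrite groupX //; have -> : x ^+ k = y^-1 * a ^+ 2.
        by rewrite /y invMg invgK mulgVK.
      by rewrite groupM ?groupV ?groupX.
    apply/eqP; rewrite eqEsubset; apply/andP; split.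
      by rewrite defT def3 !join_subG !cycle_subG aW xW.
    by rewrite join_subG !cycle_subG aT.
  do 12!right; left; split=> //.
  - apply: isS32_refl; apply: (@metacyclic_isoGrp _ T a y 16 2 9) => //.
    by rewrite (expgM a 8 2) a8.
  - exact: g5_iso.
  constructor 2; split=> //.
  - by rewrite eqI g4_E.
  - by rewrite g4_E eqQ.
  - apply/eqP; rewrite -eqQ eq_sym eqEcard powg4_sub_Q oQ /=.
    have o4 : #[a ^+ 4] = 4.
      apply: (@pow2_divisor 2).
      + by rewrite order_dvdn -expgM (expgM a 8 4) a8 -expgM (expgM x 8 2) x8 expg1n.
      + by rewrite order_dvdn -expgM a8 -order_dvdn ox.
      + apply/eqP => o8; have : a ^+ 4 ^+ 4 = 1 by rewrite -expgM (expgM a 8 2) a8.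
        by move/eqP; rewrite -order_dvdn o8.
    have s4 : <[a ^+ 4]> \subset powg T 4 by rewrite cycle_subG mem_powg.
    by have := subset_leq_card s4; rewrite -orderE o4.
have k_E : k = (2 * k./2)%N by rewrite mul2n -[LHS]odd_double_half (negbTE even_k).
have a4w : a ^+ 4 = (x ^+ 4) ^+ (k./2) by rewrite a4 {1}k_E mulnA expgM.
rewrite (invol_exp _ w2) in a4w.
have /andP[xW _] := mem_join2 x a.
case: odd a4w => a4w; last first.
  by apply: (gens4 a) => //; case/andP: (mem_join2 x a).
(* Here a^4 = x^4, and the change of generator corrects it: b^4 = a^4 x^12 = x^16 = 1. *)
pose b := a * x.
have b2 : b ^+ 2 = a ^+ 2 * x ^+ 6.
  rewrite expg2 /b mulgA -(mulgA a) [x * a]conjgC xa mulgA -expg2 -mulgA.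
  by rewrite -[x in _ * (_ * x)]expg1 -expgD.
have b4 : b ^+ 4 = 1.
  rewrite (expgM b 2 2) b2 expgMn; last by apply: commuteX; apply: commute_sym.
  by rewrite -!expgM a4w expg1 -expgD (expgM x 8 2) x8 expg1n.
apply: (gens4 b) => //; first by rewrite groupM.
- have /andP[xW' bW] := mem_join2 x b.
  by have -> : a = b * x^-1; [rewrite mulgK|rewrite groupM ?groupV].
- rewrite conjgM xa conjgE; have : commute (x ^+ 5) x.
    by apply: commute_sym; apply: commuteX.
  by move=> ->; rewrite mulKg.
Qed.

(** Now gamma_3(G) is C_4 x C_2 and its squares fill only gamma_5(G), so Q must be generated by a^4.
    Hence a has order 16, and the involution v0 takes it to a^9. *)
Lemma shape8_noncyclic : #|g3| = 8 -> (forall x, x \in g3 -> #[x] != 8) ->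
  shape T g3 g4 g5.
Proof.
move=> o3 no8; have [a aT defT] := T_generator.
have sQ3 : Q \subset g3 by rewrite -g4_E.
have o5Q : #|powg Q 2| = 2 := cyclic4_powg_card cQ oQ.
have [q defQ] := cyclicP cQ.
have q3 : q \in g3 by apply: (subsetP sQ3); rewrite defQ cycle_id.
have oq : #[q] = 4 by rewrite orderE -defQ.
have [v0 [v03 v02 def30]] := abelian_split (r := 2) ab3 isT o3 q3 oq no8.
have cqv0 : commute q v0 := centsP ab3 _ q3 _ v03.
have P3 : powg g3 2 = powg Q 2 by rewrite (powg_two_gen def30 cqv0 v02) {1}defQ powg_cycle.
have sg5T : g5 \subset T := subset_trans s54 (subset_trans s43 sg3T).
have g32 x : x \in g3 -> x ^+ 2 \in g5 by move=> x3; rewrite g5_E -P3 mem_powg.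
have a4Q : a ^+ 4 \in Q by apply: (subsetP powg4_sub_Q); apply: mem_powg.
(* If a^8 = 1, then a^4 lies in gamma_5(G), and modulo gamma_5(G) all fourth powers in T and all
   squares in H vanish; so Q, of order 4, would lie in a group of order 2. *)
have a4n : a ^+ 4 ^+ 2 != 1.
  apply/eqP => a42; have a45 : a ^+ 4 \in g5 by rewrite g5_E cyclic4_sq1.
  have T4 t : t \in T -> t ^+ 4 \in g5.
    apply: (pow_pre_sub der_sub_g5 sg5T (subxx T)).
    exists (a |: g3); first by rewrite defT joing_idl.
    move=> x; rewrite !inE => /orP[/eqP->//|/g32 x2].
    by rewrite (expgM x 2 2) groupX.
  have sQ5 : Q \subset g5.
    apply: powg_sub; apply: (pow_pre_sub der_sub_g5 sg5T sHT).
    exists (g3 :|: [set t ^+ 2 | t in T]); first by rewrite /= joing_idr.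
    move=> x; rewrite inE => /orP[/g32//|/imsetP[t tT ->]].
    by rewrite -expgM T4.
  by have := subset_leq_card sQ5; rewrite oQ card_g5.
have a16 : a ^+ 16 = 1.
  by have := order_dvdG a4Q; rewrite oQ order_dvdn -expgM => /eqP.
have o4 : #[a ^+ 4] = 4.
  have dvd4 : #[a ^+ 4] %| 4 by rewrite order_dvdn -expgM a16.
  apply: (@pow2_divisor 2).
  - exact: dvdn_trans dvd4 _.
  - by rewrite order_dvdn.
  - by apply/eqP => o8; move: dvd4; rewrite o8.
have defQa : Q :=: <[a ^+ 4]>.
  by apply/eqP; rewrite eq_sym eqEcard cycle_subG a4Q oQ -orderE o4.
have o8 : #[a ^+ 8] = 2 by rewrite (expgM a 4 2) orderXdiv o4.
have def5 : g5 :=: <[a ^+ 8]>.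
  by rewrite g5_E (group_inj defQa : Q = <[a ^+ 4]>%G) powg_cycle -expgM.
have def3 : g3 :=: <[a ^+ 4]> <*> <[v0]> by rewrite -defQa defQ.
have sQ : Q \subset powg T 2.
  by rewrite defQa cycle_subG (expgM a 2 2) mem_powg ?groupX.
have eqI := meet_eq o3 sQ.
have eqP4 : Q = powg T 4 :> {set gT}.
  by apply/eqP; rewrite eqEsubset powg4_sub_Q defQa cycle_subG mem_powg.
have a43 : a ^+ 4 \in g3 by apply: (subsetP sQ3).
have vw : v0 ^ a = v0 * a ^+ 8.
  case: (comm_g3 def5 o8 v03 aT) => // va; case/negP: nabT.
  apply: T_abelian_gen defT _ => u.
  rewrite def3 norm_joinEr; last first.
    rewrite cents_norm // cent_cycle cycle_subG; apply/cent1P.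
    by apply: (centsP ab3).
  case/mulsgP=> _ _ /cycleP[i ->] /cycleP[k ->] ->.
  have cva : commute a v0 by apply: commute_sym; apply/commgP/conjg_fixP.
  by apply: commute_sym; apply: commuteM; rewrite -?expgM; apply: commuteX.
have av : a ^ v0 = a ^+ 9.
  have -> : a ^ v0 = a * [~ a, v0] by rewrite commgEl mulKVg.
  rewrite (expgD a 1 8) expg1 -invgR commgEl vw mulKg; congr (_ * _).
  by apply/eqP; rewrite eq_invg_mul -expg2 -expgM a16.
have genT : T :=: <[a]> <*> <[v0]>.
  have /andP[aW vW] := mem_join2 a v0.
  apply/eqP; rewrite eqEsubset; apply/andP; split.
    by rewrite defT def3 !join_subG !cycle_subG aW vW groupX.
  by rewrite join_subG !cycle_subG aT (subsetP sg3T).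
do 12!right; left; split.
- apply: isS32_refl.
  exact: (@metacyclic_isoGrp _ T a v0 16 2 9).
- exact: g5_iso.
constructor 3; split.
- by apply: (@isog_ZnxZm _ g3 q v0 4 2 isT isT o3 def30); rewrite // -oq expg_order.
- by rewrite eqI powg_g3_sub_Q.
- by rewrite eqI g4_E.
- by rewrite g4_E eqP4.
- by rewrite -eqP4 isog_Zn // cQ oQ.
Qed.

Lemma nonabelian_shape : shape T g3 g4 g5.
Proof.
have o4 : #|g4| = 4 by rewrite g4_E.
have dvd3 : #|g3| %| 2 ^ 4 by rewrite -[(2 ^ 4)%N]oH cardSg ?joing_subl.
have lt3 : 4 < #|g3|.
  have nt3 : g3 :!=: 1 by rewrite -cardG_gt1 (leq_trans _ (subset_leq_card s43)) ?o4.
  by have := proper_card (strict34 nt3); rewrite o4.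
have /(dvdn_pfactor _ _ (isT : prime 2))[m le_m o3] := dvd3.
case: m le_m o3 lt3 => [|[|[|[|[|//]]]]] _ o3; rewrite o3 // => _.
  have [/existsP[x /andP[x3 /eqP ox]]|no8] := boolP [exists x, (x \in g3) && (#[x] == 8)].
    exact: shape8_cyclic ox.
  apply: shape8_noncyclic => // x x3; apply: contra no8 => ox.
  by apply/existsP; exists x; rewrite x3.
exact: shape16.
Qed.

End NonabelianCase.

Lemma shape_of_crit : shape T g3 g4 g5.
Proof.
by have [abT|nabT] := boolP (abelian T); [apply: abelian_shape|apply: nonabelian_shape].
Qed.

End ShapeOfCrit.

Local Close Scope group_scope.

(** * Translation to subsets of an infinite group *)

Section Transport.
Local Open Scope classical_set_scope.
Local Open Scope card_scope.
Local Open Scope group_scope.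
Context (G : groupType) (gT : finGroupType) (j : gT -> G).
Hypothesis jM : {morph j : x y / (x * y)%g}.
Hypothesis jI : injective j.
Implicit Types (A B : {group gT}).

Definition im (A : {set gT}) : set G := fun g => exists2 x, x \in A & j x = g.

Lemma mem_im (A : {set gT}) x : im A (j x) <-> x \in A.
Proof. by split=> [[y yA /jI<-]//|xA]; exists x. Qed.

(** This and the following translations are equalities of propositions, so that the statement about
    G can be turned into [shape] by rewriting. *)
Lemma im_sub (A B : {set gT}) : (im A `<=` im B)%classic = (A \subset B).
Proof.
apply/propext; split=> [sAB|/subsetP sAB _ [x xA <-]]; last by exists x; rewrite ?sAB.
by apply/subsetP => x /mem_im/sAB/mem_im.
Qed.

Lemma im_eq (A B : {set gT}) : (im A = im B) = (A = B).
Proof.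
apply/propext; split=> [eqAB|->//]; apply/eqP; rewrite eqEsubset.
by apply/andP; rewrite -!im_sub eqAB; split=> ?.
Qed.

Lemma im_setI (A B : {set gT}) : (im A `&` im B)%classic = im (A :&: B).
Proof.
apply/seteqP; split=> [_ [[x xA <-] /mem_im xB]|_ [x /setIP[xA xB] <-]].
  by exists x; rewrite // inE xA.
by split; exists x.
Qed.

Lemma im_one : [set 1%g]%classic = im 1%g.
Proof.
apply/seteqP; split=> [_ ->|_ [x /set1gP-> <-]]; last exact: j1.
by exists 1; rewrite ?(j1 jM) ?group1.
Qed.

Lemma im_subgroup A : subgroup (im A).
Proof.
split=> [|_ _ [x xA <-] [y yA <-]|_ [x xA <-]].
- by exists 1; rewrite ?(j1 jM).
- by exists (x * y); rewrite ?groupM ?jM.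
- by exists x^-1; rewrite ?groupV ?(jV jM).
Qed.

Lemma im_powers A m : powers (im A) m = im (powg A m).
Proof.
apply/seteqP; split.
  apply: subgroup_gen_min; first exact: im_subgroup.
  by move=> _ [_ [x xA <-] <-]; exists (x ^+ m); rewrite ?mem_powg ?(jX jM).
move=> _ [x xP <-]; suff /subsetP/(_ x xP)/preGP : powg A m \subset preG j (powers (im A) m) by [].
apply: (@powg_sub _ _ _ (preG_group jM (subgroup_genP _))) => y yA.
by apply/preGP; apply: subgroup_gen_sub; exists (j y); rewrite ?(jX jM) //; exists y.
Qed.

Lemma im_card (A : {set gT}) : im A #= `I_#|A|.
Proof.
have -> : im A = (fun i : 'I_#|A| => j (enum_val i)) @` [set: 'I_#|A|]%classic.
  apply/seteqP; split=> [_ [x xA <-]|_ [i _ <-]].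
    by exists (enum_rank_in xA x); rewrite // enum_rankK_in.
  by exists (enum_val i); rewrite ?enum_valP.
apply: card_eq_trans (_ : [set: 'I_#|A|]%classic #= _); last by rewrite card_eq_sym card_II.
by apply: inj_card_eq => i k _ _ /jI/enum_val_inj.
Qed.

Lemma im_cardE (A : {set gT}) k : (im A #= `I_k) = (#|A| = k) :> Prop.
Proof.
apply/propext; split=> [imA|<-]; last exact: im_card.
apply/card_eq_II; apply: card_eq_trans imA.
by rewrite card_eq_sym im_card.
Qed.

Lemma im_iso A (rT : finGroupType) (S : {group rT}) :
  iso_to (im A) S = (A \isog S).
Proof.
apply/propext; split=> [[f [fM fI fS]]|].
  (* This is f pulled back along [j]; the default can occur only outside S. *)
  pose h x := odflt 1 [pick y | j y == f x].
  have hE x : x \in S -> j (h x) = f x.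
    move=> xS; have [y yA jy] : im A (f x) by rewrite -fS; exists x.
    by rewrite /h; case: pickP => [z /eqP//|/(_ y)]; rewrite jy eqxx.
  have hM : {in S &, {morph h : x y / x * y}}.
    by move=> x y xS yS; apply: jI; rewrite jM !hE ?groupM // fM.
  have hI : 'injm (Morphism hM).
    apply/injmP => x y xS yS /= eq_h; apply: fI => //.
    by rewrite -!hE // eq_h.
  have hS : Morphism hM @* S = A.
    apply/setP => y; apply/morphimP/idP => [[x xS _ ->]|yA] /=.
      by apply/mem_im; rewrite hE // -fS; exists x.
    have : im A (j y) by exists y.
    rewrite -fS => -[x /= xS fx]; exists x => //; apply: jI.
    by rewrite hE.
  by rewrite isog_sym; apply/isogP; exists (Morphism hM).
rewrite isog_sym => /isogP[f injf fS].
exists (fun x => j (f x)); split=> [x y xS yS|x y xS yS /jI|].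
- by rewrite morphM.
- by apply: (injmP injf).
apply/seteqP; split=> [_ [x /= xS <-]|_ [y + <-]].
  by apply/mem_im; rewrite -fS mem_morphim.
by rewrite -fS => /morphimP[x xS _ ->]; exists x.
Qed.

Lemma im_S32 A m : iso_to_S32 (im A) m = isS32 A m.
Proof.
by apply/propext; split=> -[hT [S [ST isoA]]]; exists hT, S; split=> //;
  move: isoA; rewrite im_iso.
Qed.

End Transport.

Section LowerCentralPreimages.
Local Open Scope group_scope.
Context (G : groupType) (gT : finGroupType) (j : gT -> G).
Hypothesis jM : {morph j : x y / (x * y)%g}.
Hypothesis jI : injective j.
Hypothesis jE : forall g, lcs G 2 g <-> exists x, j x = g.
Local Notation gam := (gam jM).
Local Notation T := [set: gT]%G.

(** For commuting elements (x^-1 x^g)^4 = x^-4 (x^4)^g. Both x^4 and its conjugate lie in a group of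
    order at most 2, so they coincide, whatever g in G is. *)
Lemma abelian_pow4 : abelian T -> (#|powg T 4| <= 2) ->
  forall x, x \in gam 2 -> (x ^+ 4 = 1).
Proof.
move=> abT le2.
have gH : group_set [set x : gT | x ^+ 4 == 1].
  apply/group_setP; split=> [|x y]; first by rewrite inE expg1n.
  rewrite !inE => /eqP x4 /eqP y4; rewrite expgMn ?x4 ?y4 ?mulg1 //.
  by apply: (centsP abT); rewrite inE.
suff s2 : gam 2 \subset Group gH.
  by move=> x /(subsetP s2); rewrite inE => /eqP.
apply: (gam_gen jI jE) => // g x _; rewrite inE.
set y := conj_pre j g x.
have -> : ((x^-1 * y) ^+ 4 = (x ^+ 4)^-1 * y ^+ 4).
  by rewrite expgMn ?expgVn //; apply: (centsP abT); rewrite inE.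
have y4 : j (y ^+ 4) = (j (x ^+ 4) ^ g).
  by rewrite !(jX jM) (conj_preE jE) conjXg.
rewrite -eq_mulVg1; have [x4|x4] := eqVneq (x ^+ 4) 1.
  rewrite x4 eq_sym; apply/eqP/jI; rewrite y4 x4 (j1 jM).
  by rewrite conj1g.
have xP : x ^+ 4 \in powg T 4 by rewrite mem_powg ?inE.
have o4 : #[x ^+ 4] = 2.
  apply/eqP; rewrite eqn_leq order_gt1 x4 andbT (leq_trans _ le2) //.
  by rewrite subset_leq_card ?cycle_subG.
have yP : y ^+ 4 \in <[x ^+ 4]>.
  suff <- : powg T 4 :=: <[x ^+ 4]> by rewrite mem_powg ?inE.
  by apply/eqP; rewrite eq_sym eqEcard cycle_subG xP -orderE o4.
case: (cycle2P o4 yP) => [y1|->//].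
case/eqP: x4; apply: jI; apply: (conjg_inj g).
by rewrite -y4 y1 (j1 jM) conj1g.
Qed.

Lemma gam_comm a b : [~: gam a, gam b] \subset gam (a + b).+1.
Proof.
by rewrite gen_subG; apply/subsetP => _ /imset2P[x y xa yb ->]; apply: gamR.
Qed.

Lemma lcs_im m : lcs G m.+2 = im j (gam m.+1).
Proof.
apply/seteqP; split=> [g Ag|_ [x /gamP + <-]] //.
have [x jx] : exists x, j x = g by apply/jE; apply: lcs_le Ag.
by exists x => //; apply/gamP; rewrite jx.
Qed.
End LowerCentralPreimages.

(** * Equivalence of the index condition and the list *)

Section LieIndexShape.
Local Open Scope ring_scope.
Context (G : groupType) (gT : finGroupType) (j : gT -> G).
Hypothesis jM : {morph j : x y / (x * y)%g}.
Hypothesis jI : injective j.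
Hypothesis jE : forall g, lcs G 2 g <-> exists x, j x = g.
Local Notation gam := (gam jM).
Local Notation T := [set: gT]%G.

Context (K : fieldType) (p : nat) (charK : p \in [pchar K]).
Hypothesis nilG : nilpotent_group G.
Context (n : nat) (cardT : #|[set: gT]| = (p ^ n)%N).

Let gam1T : gam 1 = T := gam1 jM jE.
Let strict i : (0 < i)%N -> gam i :!=: 1%g -> gam i.+1 \proper gam i.
Proof.
move=> i_gt0 nt_i; apply: (gam_strict jI jE nilG i_gt0).
by apply: contra nt_i => /eqP->.
Qed.
Let R := gam_comm jM.

Lemma tL_shape : (tL (grpalg K G))%:Z = (p ^ n)%N%:Z - 14 * p%:Z + 15 <->
  shape T (gam 2) (gam 3) (gam 4).
Proof.
have R1 : [~: T, T]%g \subset gam 3 by rewrite -gam1T; apply: R.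
have R2 : [~: gam 2, T]%g \subset gam 4 by rewrite -gam1T; apply: R.
have pT : (p.-group T)%g.
  by rewrite /pgroup cardT pnatX pnat_id ?orbT //; case/andP: charK.
have g3T : T :!=: 1%g -> gam 2 \proper T.
  by rewrite -gam1T; apply: strict.
split=> [|sh].
  case/(criterion_of_tL jM jI jE charK nilG cardT) => p2 n5 crit.
  have [g5 g6] := gam_of_criterion jI jE nilG crit.
  have oT : #|T| = 32 by rewrite cardT p2 n5.
  have [oH cQ oQ g4Q] := crit.
  apply: shape_of_crit => //; try exact: gamS.
  - by apply: g3T; rewrite -cardG_gt1 oT.
  - by rewrite -commg_subl -gam1T (subset_trans (R 4 1)) ?(gam_le jM).
  (* gamma_3(G) is abelian because its commutators lie in gamma_6(G) = 1. *)
  - apply/commG1P/trivgP; rewrite -[1%g]/(gval 1%G) -g6; exact: R.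
  - exact: strict.
  - exact: strict.
  - exact: abelian_pow4 jI jE.
have [oT [oH cQ oQ g4Q]] := crit_of_shape (subsetT _) g3T R1 (strict (isT : 0 < 2)%N) sh.
(* The order 32 = p^n determines p and n. *)
have [p2 n5] : p = 2%N /\ n = 5%N.
  have p_pr : prime p by case/andP: charK.
  move: cardT; rewrite oT => pn; have : logn 2 (p ^ n) = 5%N by rewrite -pn.
  rewrite lognX logn_prime //; case: eqP => [<-|_]; last by rewrite muln0.
  by rewrite muln1.
rewrite (tL_of_criterion jI jE charK nilG cardT p2 n5) ?p2 ?n5 //.
Qed.
End LieIndexShape.

Lemma finite_subgroup_embedding (G : groupType) (A : set G) :
    subgroup A -> finite_set A ->
  exists (gT : finGroupType) (j : gT -> G),
    [/\ {morph j : x y / (x * y)%g}, injective j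
      & forall g, A g <-> exists x, j x = g].
Proof.
move=> [A1 AM AV] finA.
have memA g : (g \in fset_set A) <-> A g by rewrite in_fset_set // in_setE.
have gA : group_closed (mem (fset_set A)).
  split=> [|x y xA yA]; first exact/memA.
  by apply/memA; apply: AM; [|apply: AV]; apply/memA.
exists (finsubgroup gA), (fun x => val x).
split=> [x y||g]; [exact: valM|exact: val_inj|].
split=> [Ag|[x <-]]; last by apply/memA; apply: (valP x).
by exists (Sub g (proj2 (memA g) Ag) : finsubgroup gA); rewrite SubK.
Qed.

Local Open Scope classical_set_scope.
Local Open Scope card_scope.
Local Open Scope ring_scope.

Theorem theorem2p1 (K : fieldType) (p : nat) (charK : p \in [pchar K])
  (G : groupType) (nilG : nilpotent_group G)
  (n : nat) (cardG' : lcs G 2 #= `I_(p ^ n)%N) :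
  let G' := lcs G 2 in
  let g3 := lcs G 3 in
  let g4 := lcs G 4 in
  let g5 := lcs G 5 in
  (tL (grpalg K G))%:Z = (p ^ n)%N%:Z - 14 * p%:Z + 15 <->
   (* (i) *)
   [/\ iso_to G' C16xC2, powers G' 2 `<=` g3, iso_to g3 C8xC2
     & g4 `<=` powers g3 2]
  \/
   (* (ii)(a) *)
   [/\ iso_to G' C16xC2, iso_to g3 C8, g4 `<=` powers G' 4
     & [/\ powers G' 4 = powers g3 2, powers g3 2 = powers G' 2 `&` g3
         & iso_to (powers G' 2 `&` g3) C4]]
  \/
   (* (ii)(b) *)
   [/\ iso_to G' C16xC2, iso_to g3 C4xC2, iso_to (powers G' 2 `&` g3) C4,
       g4 `<=` powers G' 4 & powers g3 2 `<=` powers G' 4]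
  \/
   (* (iii) *)
   [/\ iso_to G' C16xC2, g3 #= `I_4, powers G' 2 `&` g3 #= `I_2,
       g4 `<=` powers G' 4 & powers g3 2 `<=` powers G' 4]
  \/
   (* (iv) *)
   [/\ iso_to G' C16xC2, iso_to g3 C2 & powers G' 2 `&` g3 = [set 1%g]]
  \/
   (* (v) *)
   [/\ iso_to G' C8xC4, powers G' 2 `<=` g3, iso_to g3 C8xC2
     & g4 `<=` powers g3 2]
  \/
   (* (vi) *)
   [/\ iso_to G' C8xC4, iso_to g3 C8, powers G' 2 `&` g3 #= `I_2,
       g4 `<=` powers g3 2 & powers G' 4 `<=` powers g3 2]
  \/
   (* (vii) *)
   [/\ iso_to G' C8xC2xC2, powers G' 2 `<=` g3, iso_to g3 C8xC2
     & g4 `<=` powers g3 2]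
  \/
   (* (viii) *)
   [/\ iso_to G' C8xC2xC2, iso_to g3 C8, powers G' 2 `&` g3 #= `I_2,
       g4 `<=` powers g3 2 & powers G' 4 `<=` powers g3 2]
  \/
   (* (ix) *)
   [/\ [\/ iso_to_S32 G' 4, iso_to_S32 G' 5 | iso_to_S32 G' 12],
       powers G' 2 `<=` g3, iso_to g3 C8xC2, g4 = powers g3 2
     & iso_to g5 C2]
  \/
   (* (x) *)
   [/\ iso_to_S32 G' 4, iso_to g3 C8, powers G' 4 `<=` powers G' 2 `&` g3,
       powers G' 2 `&` g3 = g4 /\ g4 = powers g3 2 & iso_to g5 C2]
  \/
   (* (xi) *)
   [/\ iso_to_S32 G' 37, powers G' 2 `<=` g3, iso_to g3 C8xC2,
       g4 = powers g3 2 & iso_to g5 C2]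
  \/
   (* (xii) *)
   [/\ iso_to_S32 G' 17, iso_to g5 C2 &
     [\/ [/\ powers G' 2 `<=` g3, iso_to g3 C8xC2 & g4 = powers g3 2],
         [/\ iso_to g3 C8, powers G' 2 `&` g3 = g4, g4 = powers g3 2
           & powers g3 2 = powers G' 4]
       | [/\ iso_to g3 C4xC2, powers g3 2 `<=` powers G' 2 `&` g3,
             powers G' 2 `&` g3 = g4, g4 = powers G' 4
           & iso_to (powers G' 4) C4]]]
  \/
   (* (xiii) *)
   [/\ iso_to_S32 G' 38, powers G' 2 `<=` g3, iso_to g3 C8xC2,
       g4 = powers g3 2 & iso_to g5 C2].
Proof.
have [|gT [j [jM jI jE]]] := finite_subgroup_embedding (lcs_subgroup G 2).
  by exists (p ^ n)%N.
move=> G' g3 g4 g5.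
have eqG : G' = im j [set: gT]%G by rewrite /G' (lcs_im jM jE 0) (gam1 jM jE).
have eq3 : g3 = im j (gam jM 2) := lcs_im jM jE 1.
have eq4 : g4 = im j (gam jM 3) := lcs_im jM jE 2.
have eq5 : g5 = im j (gam jM 4) := lcs_im jM jE 3.
have cardT : #|[set: gT]%G| = (p ^ n)%N.
  by move: cardG'; rewrite -[lcs G 2]/G' eqG (im_cardE jI).
rewrite (tL_shape jM jI jE charK nilG cardT) eqG eq3 eq4 eq5 /shape.
rewrite !(im_powers jM) !(im_setI jI) (im_one jM).
rewrite !(im_sub jI) !(im_eq jI) !(im_cardE jI) !(im_iso jM jI) !(im_S32 jM jI).
by [].
Qed.
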